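(* Let $(k,\varsigma)$ be an effective difference field. A primitive recursive procedure can decide, given difference polynomials $f,f_1,\ldots,f_n$ over $(k,\varsigma)$, whether $$f\in\{f_1,\ldots,f_n\},$$ where $\{f_1,\ldots,f_n\}$ denotes the perfect closure of the set of $f_1,\ldots,f_n$ in the difference polynomial ring.
   Context: A difference ring is a ring with an endomorphism $\sigma$. The difference polynomial ring over $(k,\varsigma)$ in variables $x_1,\ldots,x_m$ is the polynomial ring over $k$ in the variables $\sigma^j(x_i)$ ($j\ge 0$) with the endomorphism $\sigma$ extending $\varsigma$ and sending $\sigma^j(x_i)$ to $\sigma^{j+1}(x_i)$. An ideal $I$ in a difference ring is perfect if $a\sigma(a)\in I$ implies that $a$ and $\sigma(a)$ are both in $I$. The perfect closure $\{E\}$ of a set $E$ is the least perfect ideal containing $E$. A field is primitive recursive if, modulo some Gödel numbering, it is a primitive recursive set and addition, multiplication and multiplicative inverse are primitive recursive functions; it has a splitting algorithm if there is a primitive recursive algorithm factoring elements of $k[T]$ into irreducible factors. A difference field $(k,\varsigma)$ with $\varsigma$ bijective is effective if $k$ is primitive recursive, perfect and has a splitting algorithm, and $\varsigma$ and $\varsigma^{-1}$ are primitive recursive functions. *)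

(* Defs.v *)
From HB Require Import structures.
From mathcomp Require Import all_boot all_order all_algebra all_field finmap.
From mathcomp.multinomials Require Import monalg.

Set Implicit Arguments.
Unset Strict Implicit.
Unset Printing Implicit Defensive.

Import GRing.Theory.
Local Open Scope ring_scope.

(* Primitive recursive functions nat^n -> nat.  The constructor [primrec_ext]
   only makes the predicate independent of functional extensionality. *)
Inductive primrec : forall n : nat, (n.-tuple nat -> nat) -> Prop :=
| primrec_zero n : @primrec n (fun=> 0%N)
| primrec_succ : @primrec 1 (fun v => (thead v).+1)
| primrec_proj n (i : 'I_n) : @primrec n (fun v => tnth v i)
| primrec_comp n p (f : p.-tuple nat -> nat) (g : 'I_p -> n.-tuple nat -> nat) :
    primrec f -> (forall i, primrec (g i)) ->
    primrec (fun v => f [tuple g i v | i < p])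
| primrec_rec n (f : n.-tuple nat -> nat) (g : n.+2.-tuple nat -> nat) :
    primrec f -> primrec g ->
    @primrec n.+1 (fun v => let xs : n.-tuple nat := [tuple of behead v] in
      nat_rect (fun=> nat) (f xs) (fun y r => g [tuple of y :: r :: xs])
        (thead v))
| primrec_ext n (f g : n.-tuple nat -> nat) :
    f =1 g -> primrec f -> primrec g.

Definition primrec1 (F : nat -> nat) : Prop :=
  @primrec 1 (fun v => F [tnth v 0]).
Definition primrec2 (F : nat -> nat -> nat) : Prop :=
  @primrec 2 (fun v => F [tnth v 0] [tnth v 1]).
Definition primrec3 (F : nat -> nat -> nat -> nat) : Prop :=
  @primrec 3 (fun v => F [tnth v 0] [tnth v 1] [tnth v 2]).

Section EffectiveField.
Variables (k : fieldType) (code : k -> nat).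

(* Finite sequences of natural numbers are coded by the (primitive recursive)
   bijection [CodeSeq.code : seq nat -> nat].  A univariate polynomial is coded
   by its sequence of coefficients, constant term first. *)
Definition poly_code (p : {poly k}) : nat := CodeSeq.code (map code p).

Definition primrec_set (A : nat -> Prop) : Prop :=
  exists2 P : nat -> bool, primrec1 P & forall n, P n <-> A n.

Definition primrec_op1 (f : k -> k) : Prop :=
  exists2 F, primrec1 F & forall a, F (code a) = code (f a).

Definition primrec_op2 (f : k -> k -> k) : Prop :=
  exists2 F, primrec2 F & forall a b, F (code a) (code b) = code (f a b).

(* The inverse is only required on nonzero elements. *)
Record primrec_field : Prop := PrimrecField {
  primrec_field_inj : injective code;
  primrec_field_set : primrec_set (fun n => exists a, code a = n);
  primrec_field_add : primrec_op2 +%R;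
  primrec_field_mul : primrec_op2 *%R;
  primrec_field_inv : exists2 F, primrec1 F &
    forall a, a != 0 -> F (code a) = code a^-1
}.

(* [%=] is equality up to a nonzero constant factor. *)
Definition splitting_algorithm : Prop :=
  exists2 F, primrec1 F &
    forall p : {poly k}, p != 0 ->
      exists s : seq {poly k},
        [/\ F (poly_code p) = CodeSeq.code (map poly_code s),
            forall q, q \in s -> irreducible_poly q
          & p %= \prod_(q <- s) q].

Definition perfect_field : Prop :=
  forall p : {poly k}, irreducible_poly p -> separable_poly p.

Record effective_difference_field (vs : {rmorphism k -> k}) : Prop :=
  EffectiveDifferenceField {
    edf_primrec : primrec_field;
    edf_perfect : perfect_field;
    edf_splitting : splitting_algorithm;
    edf_sigma : primrec_op1 vs;
    edf_sigma_inv : exists vsi : k -> k,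
      [/\ cancel vs vsi, cancel vsi vs & primrec_op1 vsi]
  }.

End EffectiveField.

Section PerfectClosure.
Variables (R : comNzRingType) (sigma : {rmorphism R -> R}).

(* Ideals are arbitrary (not necessarily decidable or proper) subsets. *)
Record is_ideal (I : R -> Prop) : Prop := IsIdeal {
  is_ideal0 : I 0;
  is_idealD : forall a b, I a -> I b -> I (a + b);
  is_idealM : forall a b, I b -> I (a * b)
}.

Definition is_perfect_ideal (I : R -> Prop) : Prop :=
  is_ideal I /\ (forall a, I (a * sigma a) -> I a /\ I (sigma a)).

Definition perfect_closure (E : R -> Prop) (a : R) : Prop :=
  forall I : R -> Prop,
    is_perfect_ideal I -> (forall b, E b -> I b) -> I a.

Lemma perfect_closure_perfect E : is_perfect_ideal (perfect_closure E).
Proof.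
split; first split.
- by move=> I [[I0 _ _] _] _.
- move=> a b Ha Hb I HI EI; case: (HI) => -[_ ID _] _.
  by apply: ID; [apply: Ha | apply: Hb].
- move=> a b Hb I HI EI; case: (HI) => -[_ _ IM] _.
  by apply: IM; apply: Hb.
- move=> a Ha; split=> I HI EI;
    by case: (HI) => _ /(_ a (Ha I HI EI)) [].
Qed.

Lemma sub_perfect_closure (E : R -> Prop) a : E a -> perfect_closure E a.
Proof. by move=> Ea I _; apply. Qed.

End PerfectClosure.

(* The variable sigma^j(x_i) is indexed by the pair (i, j). *)
Notation dvar m := ('I_m * nat)%type.
Notation dpoly k m := {malg k[{cmonom dvar m}]}.

Section DifferencePolynomials.
Variables (k : fieldType) (m : nat).

Definition dX (v : dvar m) : dpoly k m := << ucm v >>.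
Definition dC : k -> dpoly k m := malgC.
HB.instance Definition _ := GRing.RMorphism.on dC.

Definition dvar_shift (v : dvar m) : dvar m := (v.1, v.2.+1).

(* Value of a monomial when each variable v is replaced by sigma(v). *)
Definition dmonom_sigma (w : {cmonom dvar m}) : dpoly k m :=
  \prod_(v <- finsupp w) dX (dvar_shift v) ^+ w v.

Lemma dmonom_sigmaEw (d : {fset dvar m}) (w : {cmonom dvar m}) :
  (finsupp w `<=` d)%fset ->
  dmonom_sigma w = \prod_(v <- d) dX (dvar_shift v) ^+ w v.
Proof.
move=> le; rewrite /dmonom_sigma; apply: big_fset_incl => // v _ vw.
by rewrite fsfun_dflt.
Qed.

Lemma dmonom_sigma_mmorphism : mmorphism dmonom_sigma.
Proof.
split=> [x y|]; last first.
  by rewrite /dmonom_sigma mdom1 big_seq_fset0.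
pose d := (finsupp x `|` finsupp y)%fset.
rewrite (@dmonom_sigmaEw d) ?mdomD // (@dmonom_sigmaEw d x) ?fsubsetUl //.
rewrite (@dmonom_sigmaEw d y) ?fsubsetUr // -big_split /=.
by apply: eq_bigr => v _; rewrite cmM exprD.
Qed.
HB.instance Definition _ :=
  isMultiplicative.Build {cmonom dvar m} (dpoly k m) dmonom_sigma
    dmonom_sigma_mmorphism.

Definition dsigma (vs : {rmorphism k -> k}) : dpoly k m -> dpoly k m :=
  mmap (dC \o vs) dmonom_sigma.
HB.instance Definition _ vs := GRing.RMorphism.on (dsigma vs).

Lemma dsigmaC vs c : dsigma vs (dC c) = dC (vs c).
Proof. exact: mmapC. Qed.

Lemma dsigmaX vs v : dsigma vs (dX v) = dX (dvar_shift v).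
Proof.
rewrite /dsigma /dX mmapU /= rmorph1 mul1r /dmonom_sigma mdomU.
by rewrite big_seq_fset1 cmUU expr1.
Qed.

(* A difference polynomial is presented to an algorithm as a list of terms
   (c, [:: v_1; ...; v_d]) standing for the sum of the c * v_1 * ... * v_d.
   Repeated terms, zero coefficients and any order of the variables are
   allowed, so a difference polynomial has many presentations. *)
Definition dterms : Type := seq (k * seq (dvar m)).

Definition dpoly_of (t : dterms) : dpoly k m :=
  \sum_(u <- t) dC u.1 * \prod_(v <- u.2) dX v.

Definition dterms_code (code : k -> nat) (t : dterms) : nat :=
  CodeSeq.code
    [seq CodeSeq.code (code u.1 ::
           [seq CodeSeq.code [:: val v.1; v.2] | v <- u.2]) | u <- t].

Lemma dpoly_of_surj (f : dpoly k m) : exists t : dterms, f = dpoly_of t.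
Proof.
pose mon (w : {cmonom dvar m}) := 
  flatten [seq nseq (w v) v | v <- finsupp w].
have prod_mon w : \prod_(v <- mon w) dX v = << w >>.
  rewrite big_flatten big_map /=.
  have fgX (c d : {cmonom dvar m}) :
      << c >> * << d >> = << mmul c d >> :> dpoly k m.
    by rewrite malgM_def fgmulUU mulr1.
  have dXn v n : dX v ^+ n = << iterop n mmul (ucm v) mone >>.
    elim: n => [|n IHn] /=; first by [].
    rewrite exprS IHn fgX; congr << _ >>.
    by case: n {IHn} => [|n] //=; rewrite mulm1.
  transitivity (\prod_(v <- finsupp w) << iterop (w v) mmul (ucm v) mone >>
                : dpoly k m).
    apply: eq_bigr => v _; rewrite -dXn big_nseq.
    by rewrite -Monoid.iteropE.
  rewrite -(big_morph (fun c => << c >> : dpoly k m) 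
     (fun c d => esym (fgX c d)) erefl).
  congr << _ >>; apply/eqP/cmP => v.
  rewrite (big_morph (fun c : {cmonom dvar m} => c v) 
     (fun c d => cmM v c d) (cm1 v)).
  have E u : iterop (w u) mmul (ucm u) mone v = (w u * (u == v))%N.
    elim: (w u) => [|n IHn]; first by rewrite /= cm1.
    have -> : iterop n.+1 mmul (ucm u) mone = mmul (ucm u) (iterop n mmul (ucm u) mone).
      by case: n {IHn} => [|n] //=; rewrite mulm1.
    by rewrite cmM IHn cmU mulSn.
  under eq_bigr do rewrite E.
  have [vw|vw] := boolP (v \in finsupp w); last first.
    rewrite fsfun_dflt // big1_seq // => u /andP[_ uw]; case: eqP => [e|_]; last by rewrite muln0.
    by rewrite -e uw in vw.
  rewrite (big_fsetD1 v) //= eqxx muln1 big1_seq ?addn0 // => u /andP[_].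
  by rewrite !inE => /andP[/negPf-> _]; rewrite muln0.
exists [seq (f@_w, mon w) | w <- msupp f].
rewrite /dpoly_of big_map {1}[f]monalgE; apply: eq_bigr => w _ /=.
by rewrite prod_mon /dC malgM_def fgmulUU mulr1 mul1m.
Qed.

End DifferencePolynomials.

(* Main.v *)
Require Import Defs.
From HB Require Import structures.
From mathcomp Require Import all_boot all_order all_algebra all_field finmap.
From mathcomp.multinomials Require Import monalg.
From mathcomp Require Import zify ring.
From Stdlib Require Import Classical.

(* The procedure searches for a derivation of f from f_1, ..., f_n by the closure
   rules of perfect ideals, all of whose entries are below a primitive recursive
   bound.  Such a derivation clearly proves membership.  Conversely, consider the
   polynomials in the finitely many variables that occur, a few of their shifts
   included, and let J consist of those derivable within the bound; on polynomials
   of much smaller size J acts as a radical ideal compatible with sigma.  If f is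
   not in J, pass to (J : s), where s is f times as many small polynomials as
   possible subject to s not being in J: this keeps f out and decides every small
   polynomial.  By elimination there are points at which the small polynomials that
   vanish are those of J.  Over a chain of levels of smallness, the largest number
   of algebraically independent coordinates of such points has to repeat.  There,
   all the coordinates are algebraic over independent ones; a prime factor of the
   equation of a generic linear projection (found by the splitting algorithm, hence
   of bounded size) shows that the ideal of the point is determined by small
   polynomials, that is, by J.  As J is compatible with sigma, shifting the
   coordinates induces an isomorphism between the fields generated by all but the
   last block of coordinates and by all but the first one.  Such a kernel extends
   one coordinate at a time to points of any length where the f_i vanish and f does
   not.  The polynomials vanishing at all sufficiently long points where the f_i
   vanish form a perfect ideal, so f is not in the perfect closure. *)

Set Implicit Arguments.
Unset Strict Implicit.
Unset Printing Implicit Defensive.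

(** * Primitive recursive functions of environments *)

(** Two constraints shape the bounds. No bound may come from a termination argument such as
    Noetherianity, so the repetition of a dimension among boundedly many levels replaces the
    stabilisation of an ascending chain. And derivability below a bound is not closed under the
    ideal operations, so every argument on ideals is a computation with boundedly many operations
    whose level is tracked; primes cannot be chosen, and colon ideals do their work. In a perfect
    ideal [x * y] and [sigma x * y] lie together, so colon ideals stay compatible with [sigma] even
    if the divisor is not invariant. In positive characteristic the coordinates of a point need not
    be rational in its parameters and its generic linear form; their [q]-th powers are, for a
    suitable power [q] of the characteristic exponent, and this suffices because only vanishing
    matters. The bounds themselves are explicit primitive recursive functions; classical logic and
    arbitrary field extensions enter only the proof that the bounded search is complete. *)

(* Environment style: the [i]-th argument of [f] is [nth 0 e i], and arguments
   beyond the arity read as 0. *)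
Definition prs (f : seq nat -> nat) : Prop :=
  forall n, primrec (fun v : n.-tuple nat => f v).

Definition prb (P : seq nat -> bool) : Prop := prs (fun e => nat_of_bool (P e)).

Lemma prs_ext f g : f =1 g -> prs f -> prs g.
Proof. by move=> fg pf n; apply: primrec_ext (pf n) => v; exact: fg. Qed.

Lemma prb_ext P Q : P =1 Q -> prb P -> prb Q.
Proof. by move=> PQ; apply: prs_ext => e; rewrite PQ. Qed.

Lemma prs_nth i : prs (fun e => nth 0 e i).
Proof.
move=> n; have [lt_in|le_ni] := ltnP i n.
  apply: primrec_ext (primrec_proj (Ordinal lt_in)) => v.
  by rewrite (tnth_nth 0).
by apply: primrec_ext (primrec_zero n) => v; rewrite nth_default ?size_tuple.
Qed.

Lemma prs_reindex g (h : seq nat -> seq nat) :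
  prs g ->
  (forall n, exists m, exists2 t : 'I_m -> n.-tuple nat -> nat,
     forall i, primrec (t i) & forall v : n.-tuple nat, h v = [seq t i v | i : 'I_m]) ->
  prs (fun e => g (h e)).
Proof.
move=> pg ph n; have [m [t pt ht]] := ph n.
apply: primrec_ext (primrec_comp (pg m) pt) => v /=.
by rewrite ht /image_mem.
Qed.

Lemma prs_push g f : prs g -> prs f -> prs (fun e => g (f e :: e)).
Proof.
move=> pg pf; apply: (prs_reindex (h := fun e => f e :: e)) => // n.
exists n.+1, (fun i v => if unlift ord0 i is Some j then tnth v j else f v).
  by move=> i; case: unliftP => [j _|_]; [exact: primrec_proj | exact: pf].
move=> v; rewrite /image_mem enum_ordSl /= unlift_none; congr cons.
rewrite -map_comp -[LHS]map_tnth_enum; apply: eq_map => j /=.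
by rewrite liftK.
Qed.

Lemma prs_behead g : prs g -> prs (fun e => g (behead e)).
Proof.
move=> pg; apply: (prs_reindex (h := behead)) => // -[|n].
  exists 0, (fun i v => 0) => [i|v]; first exact: primrec_zero.
  by rewrite (tuple0 v) /image_mem enum_ord0.
exists n, (fun i v => tnth v (lift ord0 i)) => [i|v]; first exact: primrec_proj.
case/tupleP: v => x v /=; rewrite -[LHS]map_tnth_enum; apply: eq_map => i.
by rewrite tnthS.
Qed.

(** For [prs_sum]: the recursion step sees the index, the partial sum and the environment, while the
    summand must not see the partial sum. *)
Lemma prs_drop1 g : prs g ->
  prs (fun e => g (nth 0 e 0 :: behead (behead e))).
Proof.
move=> pg; apply: (prs_reindex (h := fun e => nth 0 e 0 :: behead (behead e))) => //.
case=> [|[|n]].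
- exists 1, (fun i v => nth 0 v 0) => [i|v]; first exact: (prs_nth 0).
  by rewrite (tuple0 v) /image_mem enum_ordSl enum_ord0.
- exists 1, (fun i v => nth 0 v 0) => [i|v]; first exact: (prs_nth 0).
  case/tupleP: v => x v; rewrite (tuple0 v) /image_mem enum_ordSl enum_ord0.
  by [].
exists n.+1, (fun i v => if unlift ord0 i is Some j
  then tnth v (lift ord0 (lift ord0 j)) else nth 0 v 0) => [i|v].
  by case: unliftP => [j _|_]; [exact: primrec_proj | exact: (prs_nth 0)].
case/tupleP: v => x v; case/tupleP: v => y v.
rewrite /image_mem enum_ordSl /= unlift_none; congr cons.
rewrite -map_comp -[LHS]map_tnth_enum; apply: eq_map => j /=.
by rewrite liftK !tnthS.
Qed.

Lemma prs_nil g : prs g -> prs (fun e => g [::]).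
Proof.
move=> pg; apply: (prs_reindex (h := fun=> [::])) => // n.
exists 0, (fun i v => 0) => [i|v]; first exact: primrec_zero.
by rewrite /image_mem enum_ord0.
Qed.

Lemma prs_zero : prs (fun e => 0).
Proof. by move=> n; exact: primrec_zero. Qed.

Lemma prs_succ f : prs f -> prs (fun e => (f e).+1).
Proof.
move=> pf n.
apply: primrec_ext (primrec_comp primrec_succ (fun i : 'I_1 => pf n)) => v.
by rewrite /= /thead tnth_mktuple.
Qed.

Lemma prs_const c : prs (fun e => c).
Proof. by elim: c => [|c IH]; [exact: prs_zero | exact: prs_succ]. Qed.

Lemma prs_rec f g h : prs f -> prs g -> prs h ->
  prs (fun e => nat_rect (fun=> nat) (f e) (fun y r => g (y :: r :: e)) (h e)).
Proof.
move=> pf pg ph.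
pose G (e : seq nat) := nat_rect (fun=> nat) (f (behead e))
  (fun y r => g (y :: r :: behead e)) (head 0 e).
suff pG : prs G by have := prs_push pG ph.
(* Recursion needs arity at least one. In the empty environment the recursion argument reads as 0
   and only the base case is left. *)
case=> [|n].
  have p := prs_nil (prs_behead pf).
  by apply: primrec_ext (p 0) => v; rewrite /G (tuple0 v).
apply: primrec_ext (primrec_rec (pf n) (pg n.+2)) => v /=.
by case/tupleP: v => x v.
Qed.

Lemma prs_comp1 g f : prs (fun e => g (nth 0 e 0)) -> prs f ->
  prs (fun e => g (f e)).
Proof. by move=> pg pf; have := prs_push pg pf. Qed.

Lemma prs_comp2 g f1 f2 : prs (fun e => g (nth 0 e 0) (nth 0 e 1)) ->
  prs f1 -> prs f2 -> prs (fun e => g (f1 e) (f2 e)).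
Proof.
move=> pg p1 p2.
have := prs_push (prs_push pg (prs_behead p1)) p2 => /=; apply: prs_ext => e /=.
by [].
Qed.

Lemma prs_comp3 g f1 f2 f3 :
  prs (fun e => g (nth 0 e 0) (nth 0 e 1) (nth 0 e 2)) ->
  prs f1 -> prs f2 -> prs f3 -> prs (fun e => g (f1 e) (f2 e) (f3 e)).
Proof.
move=> pg p1 p2 p3.
exact: (prs_push (prs_push (prs_push pg (prs_behead (prs_behead p1)))
  (prs_behead p2)) p3).
Qed.

Lemma prs_comp4 g f1 f2 f3 f4 :
  prs (fun e => g (nth 0 e 0) (nth 0 e 1) (nth 0 e 2) (nth 0 e 3)) ->
  prs f1 -> prs f2 -> prs f3 -> prs f4 ->
  prs (fun e => g (f1 e) (f2 e) (f3 e) (f4 e)).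
Proof.
move=> pg p1 p2 p3 p4.
exact: (prs_push (prs_push (prs_push (prs_push pg
  (prs_behead (prs_behead (prs_behead p1)))) (prs_behead (prs_behead p2)))
  (prs_behead p3)) p4).
Qed.

Lemma prs_iter f g h : prs f -> prs (fun e => g (nth 0 e 0) (behead e)) ->
  prs h -> prs (fun e => iter (h e) (fun r => g r e) (f e)).
Proof.
move=> pf pg ph; apply: prs_ext (prs_rec pf (prs_behead pg) ph) => e /=.
by elim: (h e) => //= n ->.
Qed.

Lemma prs_iter1 g f h : prs (fun e => g (nth 0 e 0)) -> prs f -> prs h ->
  prs (fun e => iter (h e) g (f e)).
Proof. by move=> pg pf ph; apply: (prs_iter (g := fun r _ => g r)). Qed.

Lemma prs_add f g : prs f -> prs g -> prs (fun e => f e + g e).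
Proof.
move=> pf pg; have := prs_iter1 (g := succn) (prs_succ (prs_nth 0)) pg pf.
by apply: prs_ext => e; elim: (f e) => //= n ->.
Qed.

Lemma prs_pred f : prs f -> prs (fun e => (f e).-1).
Proof.
move=> pf; have := prs_rec prs_zero (prs_nth 0) pf.
by apply: prs_ext => e; case: (f e).
Qed.

Lemma prs_sub f g : prs f -> prs g -> prs (fun e => f e - g e).
Proof.
move=> pf pg.
have := prs_iter1 (g := predn) (prs_pred (prs_nth 0)) pf pg.
by apply: prs_ext => e; elim: (g e) => /= [|n ->]; rewrite ?subn0 ?subnS.
Qed.

Lemma prs_mul f g : prs f -> prs g -> prs (fun e => f e * g e).
Proof.
move=> pf pg.
have := prs_iter (g := fun r e => g e + r) prs_zero
  (prs_add (prs_behead pg) (prs_nth 0)) pf.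
by apply: prs_ext => e; elim: (f e) => //= n ->; rewrite mulSn.
Qed.

Lemma prs_exp f g : prs f -> prs g -> prs (fun e => f e ^ g e).
Proof.
move=> pf pg.
have := prs_iter (g := fun r e => f e * r) (prs_const 1)
  (prs_mul (prs_behead pf) (prs_nth 0)) pg.
by apply: prs_ext => e; elim: (g e) => //= n ->; rewrite expnS.
Qed.

Lemma prb_eq0 f : prs f -> prb (fun e => f e == 0).
Proof.
move=> pf; apply: prs_ext (prs_sub (prs_const 1) pf) => e.
by case: (f e).
Qed.

Lemma prb_neg P : prb P -> prb (fun e => ~~ P e).
Proof. by move/prb_eq0; apply: prb_ext => e; case: (P e). Qed.

Lemma prb_and P Q : prb P -> prb Q -> prb (fun e => P e && Q e).
Proof.
move=> pP pQ; apply: prs_ext (prs_mul pP pQ) => e.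
by case: (P e); case: (Q e).
Qed.

Lemma prb_or P Q : prb P -> prb Q -> prb (fun e => P e || Q e).
Proof.
move=> pP pQ; apply: prb_ext (prb_neg (prb_and (prb_neg pP) (prb_neg pQ))) => e.
by rewrite negb_and !negbK.
Qed.

Lemma prb_leq f g : prs f -> prs g -> prb (fun e => f e <= g e).
Proof. by move=> pf pg; apply: (prb_eq0 (prs_sub pf pg)). Qed.

Lemma prb_eq f g : prs f -> prs g -> prb (fun e => f e == g e).
Proof.
move=> pf pg; apply: prb_ext (prb_and (prb_leq pf pg) (prb_leq pg pf)) => e.
by rewrite eqn_leq.
Qed.

Lemma prs_if P f g : prb P -> prs f -> prs g ->
  prs (fun e => if P e then f e else g e).
Proof.
move=> pP pf pg.
apply: prs_ext (prs_add (prs_mul pP pf) (prs_mul (prb_neg pP) pg)) => e.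
by case: (P e); rewrite ?mul1n ?mul0n ?addn0.
Qed.

Lemma prs_sum h g : prs h -> prs g ->
  prs (fun e => \sum_(i < h e) g (nat_of_ord i :: e)).
Proof.
move=> ph pg; pose G (e : seq nat) :=
  nth 0 e 1 + g (nth 0 e 0 :: behead (behead e)).
have pG : prs G.
  exact: (prs_add (prs_nth 1) (prs_drop1 pg)).
have := prs_rec prs_zero pG ph; apply: prs_ext => e.
by elim: (h e) => [|n IH]; rewrite ?big_ord0 // big_ord_recr /= IH.
Qed.

(** * Bounded quantifiers and bounded description *)

Definition allb n (P : nat -> bool) := all P (iota 0 n).
Definition hasb n (P : nat -> bool) := has P (iota 0 n).

Lemma hasbP n (P : nat -> bool) : reflect (exists2 i, i < n & P i) (hasb n P).
Proof.
by apply: (iffP hasP) => -[i]; [rewrite mem_iota|]; exists i; rewrite ?mem_iota.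
Qed.

Lemma allbP n (P : nat -> bool) :
  reflect (forall i, i < n -> P i) (allb n P).
Proof.
apply: (iffP allP) => H i; last by rewrite mem_iota => /H.
by move=> lt_in; apply: H; rewrite mem_iota.
Qed.

Lemma prb_all h P : prs h -> prb P ->
  prb (fun e => allb (h e) (fun i => P (i :: e))).
Proof.
move=> ph pP; apply: prb_ext (prb_eq0 (prs_sum ph (prb_neg pP))) => e.
rewrite sum_nat_eq0; apply/forall_inP/allbP => [H i lt_i | H i _].
  by have := H (Ordinal lt_i) isT; case: (P _).
by rewrite H.
Qed.

Lemma prb_has h P : prs h -> prb P ->
  prb (fun e => hasb (h e) (fun i => P (i :: e))).
Proof.
move=> ph pP; apply: prb_ext (prb_neg (prb_all ph (prb_neg pP))) => e.
by rewrite -has_predC /=; apply: eq_has => i /=; rewrite negbK.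
Qed.

(** Bounded description: a value singled out by a primitive recursive condition below a bound is a
    primitive recursive sum. This is how [ccons] is inverted. *)
Lemma sum_pick n (P : nat -> bool) t :
  t < n -> P t -> (forall u, u < n -> P u -> u = t) ->
  \sum_(u < n) P u * u = t.
Proof.
move=> lt_tn Pt uniqt; rewrite (bigD1 (Ordinal lt_tn)) //= Pt mul1n.
rewrite big1 ?addn0 // => u; case E: (P u) => //.
by rewrite -val_eqE /= (uniqt _ (ltn_ord u) E) eqxx.
Qed.

(** * Arithmetic of codes of finite sequences *)

Definition chead c := head 0 (CodeSeq.decode c).
Definition ctail c := CodeSeq.code (behead (CodeSeq.decode c)).
Definition cnth c i := nth 0 (CodeSeq.decode c) i.
Definition csize c := size (CodeSeq.decode c).
Definition ccons n c := 2 ^ n * c.*2.+1.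

Lemma code_cons n s : CodeSeq.code (n :: s) = ccons n (CodeSeq.code s).
Proof. by []. Qed.

Lemma ccons_inj n c n' c' : ccons n c = ccons n' c' -> n = n' /\ c = c'.
Proof.
move=> E; have : CodeSeq.code (n :: CodeSeq.decode c) =
    CodeSeq.code (n' :: CodeSeq.decode c').
  by rewrite !code_cons !CodeSeq.decodeK.
move/(can_inj CodeSeq.codeK) => -[-> /(can_inj CodeSeq.decodeK) ->].
by [].
Qed.

Lemma ccons_ltn n c : n < ccons n c /\ c < ccons n c.
Proof.
have lt_n := ltn_expl n (isT : 1 < 2); split; rewrite /ccons.
  by rewrite (leq_trans lt_n) // leq_pmulr.
have c_lt : c < c.*2.+1 by rewrite ltnS -addnn leq_addr.
by rewrite (leq_trans c_lt) // leq_pmull // expn_gt0.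
Qed.

Lemma code_head_tail c : 0 < c -> c = ccons (chead c) (ctail c).
Proof.
rewrite /chead /ctail -{1 2}[c]CodeSeq.decodeK.
by case: (CodeSeq.decode c) => // n s _.
Qed.

Lemma prs_ccons f g : prs f -> prs g -> prs (fun e => ccons (f e) (g e)).
Proof.
move=> pf pg; apply: prs_ext (prs_mul (prs_exp (prs_const 2) pf)
  (prs_succ (prs_add pg pg))) => e.
by rewrite /ccons addnn.
Qed.

Lemma prs_chead f : prs f -> prs (fun e => chead (f e)).
Proof.
apply: (@prs_comp1 chead).
pose P (e : seq nat) := hasb (nth 0 e 1) (fun t => nth 0 e 1 == ccons (nth 0 e 0) t).
have pP : prb P.
  apply: (prb_has (P := fun e => nth 0 e 2 == ccons (nth 0 e 1) (nth 0 e 0))).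
    exact: prs_nth.
  apply: prb_eq; first exact: prs_nth.
  by apply: prs_ccons; exact: prs_nth.
apply: prs_ext (prs_sum (prs_nth 0) (prs_mul pP (prs_nth 0))) => e.
rewrite /P /=; case: (posnP (nth 0 e 0)) => [->|c_gt0].
  by rewrite big_ord0.
set c := nth 0 e 0 in c_gt0 *.
have [lt_h lt_t] := ccons_ltn (chead c) (ctail c).
rewrite -(code_head_tail c_gt0) in lt_h lt_t.
apply: (sum_pick (P := fun u => hasb c (fun t => c == ccons u t))) => //.
  by apply/hasbP; exists (ctail c); rewrite // -code_head_tail.
move=> u _ /hasbP[t _ /eqP]; rewrite {1}(code_head_tail c_gt0).
by move/ccons_inj => -[].
Qed.

Lemma prs_ctail f : prs f -> prs (fun e => ctail (f e)).
Proof.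
apply: (@prs_comp1 ctail).
pose P (e : seq nat) := nth 0 e 1 == ccons (chead (nth 0 e 1)) (nth 0 e 0).
have pP : prb P.
  apply: prb_eq; first exact: prs_nth.
  by apply: prs_ccons; [apply: prs_chead|]; exact: prs_nth.
apply: prs_ext (prs_sum (prs_nth 0) (prs_mul pP (prs_nth 0))) => e.
rewrite /P /=; case: (posnP (nth 0 e 0)) => [->|c_gt0].
  by rewrite big_ord0.
set c := nth 0 e 0 in c_gt0 *.
have [lt_h lt_t] := ccons_ltn (chead c) (ctail c).
rewrite -(code_head_tail c_gt0) in lt_h lt_t.
apply: (sum_pick (P := fun u => c == ccons (chead c) u)) => //.
  by rewrite -code_head_tail.
by move=> u _ /eqP; rewrite {1}(code_head_tail c_gt0) => /ccons_inj[].
Qed.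

Lemma iter_ctail i c :
  iter i ctail c = CodeSeq.code (drop i (CodeSeq.decode c)).
Proof.
elim: i => [|i IH]; first by rewrite drop0 CodeSeq.decodeK.
by rewrite iterS IH /ctail CodeSeq.codeK -drop1 drop_drop add1n.
Qed.

Lemma prs_cnth f g : prs f -> prs g -> prs (fun e => cnth (f e) (g e)).
Proof.
move=> pf pg.
have p := prs_chead (prs_iter1 (g := ctail) (prs_ctail (prs_nth 0)) pf pg).
apply: prs_ext p => e; rewrite iter_ctail /chead CodeSeq.codeK.
by rewrite -nth0 nth_drop addn0.
Qed.

Lemma code_eq0 s : (CodeSeq.code s == 0) = (s == [::]).
Proof. by rewrite -[0]/(CodeSeq.code [::]) (can_eq CodeSeq.codeK). Qed.

Lemma size_code s : size s <= CodeSeq.code s.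
Proof.
elim: s => // n s IH; rewrite code_cons /=.
by have [_] := ccons_ltn n (CodeSeq.code s); apply: leq_ltn_trans.
Qed.

Lemma csize_leq c : csize c <= c.
Proof. by rewrite /csize -{2}[c]CodeSeq.decodeK size_code. Qed.

Lemma prs_csize f : prs f -> prs (fun e => csize (f e)).
Proof.
apply: (@prs_comp1 csize).
(* The length counts the [i] below the code for which [i] tails leave a nonempty list; [csize_leq]
   shows that this range is long enough. *)
have p := prb_neg (prb_eq0 (prs_iter1 (g := ctail) (prs_ctail (prs_nth 0))
  (prs_nth 1) (prs_nth 0))).
apply: prs_ext (prs_sum (prs_nth 0) p) => e /=.
set c := nth 0 e 0; under eq_bigr => i _ do
  rewrite iter_ctail code_eq0 -size_eq0 size_drop subn_eq0 -ltnNge.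
transitivity (\sum_(i < csize c) 1); last by rewrite sum1_card card_ord.
rewrite (big_ord_widen _ (fun=> 1) (csize_leq c)) [RHS]big_mkcond /=.
by apply: eq_bigr => i _; rewrite -/(csize c); case: (_ < _).
Qed.

(** * Growth functions *)

Record growth (phi : nat -> nat) : Prop := Growth {
  growth_prs : prs (fun e => phi (nth 0 e 0));
  growth_infl : forall N, N <= phi N;
  growth_mono : forall N M, N <= M -> phi N <= phi M
}.

Lemma growth_id : growth id.
Proof. by split=> //; exact: prs_nth. Qed.

Lemma growth_comp f g : growth f -> growth g -> growth (fun N => f (g N)).
Proof.
move=> [pf f1 f2] [pg g1 g2]; split=> [|N|N M le_NM].
- exact: (prs_comp1 pf pg).
- exact: leq_trans (g1 N) (f1 _).
- exact/f2/g2.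
Qed.

Lemma growth_add f g : growth f -> growth g -> growth (fun N => f N + g N).
Proof.
move=> [pf f1 f2] [pg g1 g2]; split=> [|N|N M le_NM].
- exact: prs_add.
- exact: leq_trans (f1 N) (leq_addr _ _).
- by apply: leq_add; [apply: f2 | apply: g2].
Qed.

Lemma growth_addn f c : growth f -> growth (fun N => f N + c).
Proof.
move=> [pf f1 f2]; split=> [|N|N M le_NM].
- by apply: prs_add => //; exact: prs_const.
- exact: leq_trans (f1 N) (leq_addr _ _).
- by rewrite leq_add2r f2.
Qed.

Lemma growth_mulS f g : growth f -> growth g -> growth (fun N => f N * (g N).+1).
Proof.
move=> [pf f1 f2] [pg g1 g2]; split=> [|N|N M le_NM].
- by apply: prs_mul => //; exact: prs_succ.
- exact: leq_trans (f1 N) (leq_pmulr _ _).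
- by apply: leq_mul; [apply: f2 | rewrite ltnS; apply: g2].
Qed.

Lemma iter_mono f n n' N N' : growth f -> n <= n' -> N <= N' ->
  iter n f N <= iter n' f N'.
Proof.
move=> [_ f1 f2] le_nn le_NN.
have H m : iter m f N <= iter m f N' by elim: m => //= m IH; apply: f2.
apply: leq_trans (H n) _; rewrite -(subnK le_nn) iterD.
by elim: (n' - n) => //= m IH; apply: leq_trans IH (f1 _).
Qed.

(** The number of iterations may depend on the argument. This rule is what allows bounds for a
    variable number of variables, equations or steps. *)
Lemma growth_iter f g h : growth f -> growth g -> growth h ->
  growth (fun N => iter (g N) f (h N)).
Proof.
move=> gf gg gh; split=> [|N|N M le_NM].
- exact: prs_iter1 (growth_prs gf) (growth_prs gh) (growth_prs gg).
- apply: leq_trans (growth_infl gh N) _.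
  exact: (iter_mono (n := 0) gf).
- by apply: iter_mono => //; [apply: growth_mono gg _ _ _ | apply: growth_mono gh _ _ _].
Qed.

Lemma growth_expS f g : growth f -> growth g ->
  growth (fun N => (f N).+2 ^ (g N).+1).
Proof.
move=> gf gg; split=> [|N|N M le_NM].
- apply: prs_exp; first by do 2!apply: prs_succ; apply: growth_prs.
  by apply: prs_succ; apply: growth_prs.
- apply: leq_trans (growth_infl gf N) _.
  by rewrite expnS -[X in X <= _]muln1 leq_mul ?expn_gt0 //; apply: leq_trans (leqnSn _) (leqnSn _).
- apply: (@leq_trans ((f N).+2 ^ (g M).+1)).
    by rewrite leq_exp2l // ltnS; apply: (growth_mono gg le_NM).
  by rewrite leq_exp2r //; exact: (growth_mono gf le_NM).
Qed.

Lemma primrec1_prs F f : primrec1 F -> prs f -> prs (fun e => F (f e)).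
Proof.
move=> pF pf n; have := primrec_comp (g := fun _ : 'I_1 => fun v : n.-tuple nat => f v) pF (fun=> pf n).
by apply: primrec_ext => v; rewrite tnth_mktuple.
Qed.

Lemma primrec2_prs F f g : primrec2 F -> prs f -> prs g -> prs (fun e => F (f e) (g e)).
Proof.
move=> pF pf pg n.
have := primrec_comp (g := fun i : 'I_2 => fun v : n.-tuple nat => if i == 0 :> nat then f v else g v) pF.
have H (i : 'I_2) : primrec (fun v : n.-tuple nat => if i == 0 :> nat then f v else g v).
  by case: (i == 0 :> nat); [apply: pf | apply: pg].
by move=> /(_ H); apply: primrec_ext => v; rewrite !tnth_mktuple.
Qed.

Lemma prb_all2 h Q : prs h -> prb (fun e => Q (nth 0 e 0) (behead e)) ->
  prb (fun e => allb (h e) (fun i => Q i e)).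
Proof. by move=> ph pQ; apply: (prb_all ph pQ). Qed.

Lemma prb_has2 h Q : prs h -> prb (fun e => Q (nth 0 e 0) (behead e)) ->
  prb (fun e => hasb (h e) (fun i => Q i e)).
Proof. by move=> ph pQ; apply: (prb_has ph pQ). Qed.

Lemma prs_sum2 h g : prs h -> prs (fun e => g (nth 0 e 0) (behead e)) ->
  prs (fun e => \sum_(i < h e) g i e).
Proof. by move=> ph pg; apply: (prs_sum ph pg). Qed.

Lemma prs_rec2 f g h : prs f -> prs (fun e => g (nth 0 e 0) (nth 0 e 1) (behead (behead e))) ->
  prs h -> prs (fun e => nat_rect (fun=> nat) (f e) (fun y r => g y r e) (h e)).
Proof. by move=> pf pg ph; apply: (prs_rec pf pg ph). Qed.

(** * Automation for primitive recursiveness *)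

Ltac prs_leaf := lazymatch goal with
  | |- prs (fun e => nth 0 (behead (behead (behead (behead (behead (behead e)))))) ?i) =>
    exact (prs_behead (prs_behead (prs_behead (prs_behead (prs_behead (prs_behead (prs_nth i)))))))
  | |- prs (fun e => nth 0 (behead (behead (behead (behead (behead e))))) ?i) =>
    exact (prs_behead (prs_behead (prs_behead (prs_behead (prs_behead (prs_nth i))))))
  | |- prs (fun e => nth 0 (behead (behead (behead (behead e)))) ?i) =>
    exact (prs_behead (prs_behead (prs_behead (prs_behead (prs_nth i)))))
  | |- prs (fun e => nth 0 (behead (behead (behead e))) ?i) =>
    exact (prs_behead (prs_behead (prs_behead (prs_nth i))))
  | |- prs (fun e => nth 0 (behead (behead e)) ?i) => exact (prs_behead (prs_behead (prs_nth i)))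
  | |- prs (fun e => nth 0 (behead e) ?i) => exact (prs_behead (prs_nth i))
  | |- prs (fun e => nth 0 e ?i) => exact (prs_nth i)
  | |- prs (fun e => ?c) => exact (prs_const c)
  end.

Ltac prs_step := first
  [ prs_leaf
  | lazymatch goal with
    | |- prb (fun e => allb _ _) => refine (prb_all2 _ _)
    | |- prb (fun e => hasb _ _) => refine (prb_has2 _ _)
    | |- prb (fun e => _ && _) => refine (prb_and _ _)
    | |- prb (fun e => _ || _) => refine (prb_or _ _)
    | |- prb (fun e => leq _ _) => refine (prb_leq _ _)
    | |- prb (fun e => @eq_op _ _ _) => refine (prb_eq _ _)
    | |- prs (fun e => csize _) => refine (prs_csize _)
    | |- prs (fun e => cnth _ _) => refine (prs_cnth _ _)
    | |- prs (fun e => chead _) => refine (prs_chead _)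
    | |- prs (fun e => ctail _) => refine (prs_ctail _)
    | |- prs (fun e => S _) => refine (prs_succ _)
    | |- prs (fun e => addn _ _) => refine (prs_add _ _)
    | |- prs (fun e => muln _ _) => refine (prs_mul _ _)
    | |- prs (fun e => expn _ _) => refine (prs_exp _ _)
    | |- prs (fun e => nat_of_bool (@?P e)) => change (prb P)
    | |- prs (fun e => if _ then _ else _) => refine (prs_if _ _ _)
    end ].
Ltac prs_auto := repeat (cbv beta; prs_step).

(** * Checking operations on coded lists *)

(** Operations on lists are verified rather than computed: the bounded search guesses the result,
    and testing a guess takes bounded quantifiers only. *)
Definition isCat a b x :=
  [&& csize x == csize a + csize b, allb (csize a) (fun u => cnth x u == cnth a u) &
      allb (csize b) (fun u => cnth x (csize a + u) == cnth b u)].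

Lemma prb_isCat f g h : prs f -> prs g -> prs h -> prb (fun e => isCat (f e) (g e) (h e)).
Proof.
apply: (prs_comp3 (g := fun a b x => nat_of_bool (isCat a b x))).
rewrite /isCat; prs_auto.
Qed.

Lemma isCatE a b x : isCat a b x = (CodeSeq.decode x == CodeSeq.decode a ++ CodeSeq.decode b).
Proof.
rewrite /isCat /csize /cnth.
move: (CodeSeq.decode a) (CodeSeq.decode b) (CodeSeq.decode x) => a' b' x'; apply/idP/eqP => [/and3P[/eqP sx /allbP xa /allbP xb]|->].
  apply: (@eq_from_nth _ 0) => [|i]; first by rewrite size_cat.
  rewrite sx nth_cat => lt_i; case: ltnP => [/xa/eqP //|le_i].
  have lt_ib : i - size a' < size b' by rewrite ltn_subLR.
  by have /eqP := xb _ lt_ib; rewrite subnKC.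
rewrite size_cat eqxx andTb; apply/andP; split; apply/allbP => u lt_u; rewrite nth_cat.
  by rewrite lt_u.
by rewrite ltnNge leq_addr /= addKn.
Qed.

Definition isMap (P : nat -> nat -> bool) a x :=
  (csize x == csize a) && allb (csize a) (fun u => P (cnth a u) (cnth x u)).

Lemma prb_isMap P f g : prb (fun e => P (nth 0 e 0) (nth 0 e 1)) -> prs f -> prs g ->
  prb (fun e => isMap P (f e) (g e)).
Proof.
move=> pP; apply: (prs_comp2 (g := fun a x => nat_of_bool (isMap P a x))).
rewrite /isMap; prs_auto.
apply: (prs_comp2 (g := fun a x => nat_of_bool (P a x))); prs_auto.
exact: pP.
Qed.

Lemma isMapP (T : Type) (P : nat -> nat -> bool) (f g : T -> nat) s x :
  (forall u r, P (f u) r <-> r = g u) ->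
  isMap P (CodeSeq.code (map f s)) x <-> x = CodeSeq.code (map g s).
Proof.
move=> H; rewrite /isMap /csize /cnth -{3}[x]CodeSeq.decodeK CodeSeq.codeK.
suff E w : (size w == size (map f s)) &&
    allb (size (map f s)) (fun u => P (nth 0 (map f s) u) (nth 0 w u)) <-> w = map g s.
  by rewrite E; split=> [->//|/(can_inj CodeSeq.codeK)].
elim: s w => [|u s IH] [|r w] /=; [by split | by split | by split | ].
rewrite eqSS /allb /= (iotaDl 1 0) all_map /=; split.
  case/and3P=> sz /H -> Hw; congr cons; apply/IH; rewrite sz /=.
  by apply: sub_all Hw => i.
case=> -> /IH/andP[-> Hw]; rewrite andTb; apply/andP; split; first exact/H.
by apply: sub_all Hw => i.
Qed.

Lemma all_decode Q x : allb (csize x) (fun u => Q (cnth x u)) = all Q (CodeSeq.decode x).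
Proof.
rewrite /csize /cnth; apply/allbP/(all_nthP 0) => H i lt_i; exact: H.
Qed.

Lemma all_mapP (T : Type) (f : T -> nat) (Q : nat -> bool) w :
  (forall r, Q r <-> exists u, r = f u) -> all Q w <-> exists s, w = map f s.
Proof.
move=> H; elim: w => [|r w IH]; first by split=> // _; exists [::].
rewrite /=; split=> [/andP[/H[u ->] /IH[s ->]]|[[|u s] //= [-> E]]]; first by exists (u :: s).
by apply/andP; split; [apply/H; exists u | apply/IH; exists s].
Qed.

Lemma nth_allpairs (S T R : Type) (f : S -> T -> R) s t x0 y0 z0 i j :
  i < size s -> j < size t ->
  nth z0 [seq f x y | x <- s, y <- t] (i * size t + j) = f (nth x0 s i) (nth y0 t j).
Proof.
move=> lt_i lt_j; elim: s i lt_i => // x s IH [|i] /= lt_i.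
  by rewrite mul0n add0n nth_cat size_map lt_j (nth_map y0).
rewrite mulSn -addnA nth_cat size_map ltnNge leq_addr /= addKn.
exact: IH.
Qed.

(** Position [u * csize a + v] is that of the pair [(u, v)] in the order of [allpairs]. *)
Definition isProd (P : nat -> nat -> nat -> bool) b a x :=
  (csize x == csize b * csize a) && allb (csize b) (fun u => allb (csize a) (fun v =>
     P (cnth b u) (cnth a v) (cnth x (u * csize a + v)))).

Lemma prb_isProd P f g h : prb (fun e => P (nth 0 e 0) (nth 0 e 1) (nth 0 e 2)) ->
  prs f -> prs g -> prs h -> prb (fun e => isProd P (f e) (g e) (h e)).
Proof.
move=> pP; apply: (prs_comp3 (g := fun b a x => nat_of_bool (isProd P b a x))).
rewrite /isProd; prs_auto.
apply: (prs_comp3 (g := fun b a x => nat_of_bool (P b a x))); prs_auto.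
exact: pP.
Qed.

Lemma isProdP (S T : Type) (P : nat -> nat -> nat -> bool) (f : S -> nat) (g : T -> nat)
    (h : S -> T -> nat) s t x :
  (forall u v r, P (f u) (g v) r <-> r = h u v) ->
  isProd P (CodeSeq.code (map f s)) (CodeSeq.code (map g t)) x <->
  x = CodeSeq.code [seq h u v | u <- s, v <- t].
Proof.
move=> H; rewrite /isProd /csize /cnth -{3}[x]CodeSeq.decodeK !CodeSeq.codeK !size_map.
case: s => [|u0 s'].
  by rewrite mul0n size_eq0; split=> [/andP[/eqP->]|/(can_inj CodeSeq.codeK)->].
case: t => [|v0 t'].
  have E : [seq h u v | u <- u0 :: s', v <- [::]] = [::].
    by elim: (u0 :: s').
  rewrite E muln0 size_eq0; split=> [/andP[/eqP->]//|/(can_inj CodeSeq.codeK)->].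
  by apply/allbP.
move: (u0 :: s') (v0 :: t') => {s' t'} s t; split.
  case/andP=> /eqP sx /allbP xP; congr CodeSeq.code.
  apply: (@eq_from_nth _ 0) => [|i lt_i]; first by rewrite sx size_allpairs.
  rewrite sx in lt_i; have t_gt0 : 0 < size t by move: lt_i; case: (size t) => //; rewrite muln0.
  have lt1 : i %/ size t < size s by rewrite ltn_divLR.
  have lt2 : i %% size t < size t by rewrite ltn_mod.
  rewrite (divn_eq i (size t)) (nth_allpairs _ u0 v0) //.
  have /allbP/(_ _ lt2) := xP _ lt1.
  by rewrite (nth_map u0) // (nth_map v0) // => /H.
move/(can_inj CodeSeq.codeK) => ->; rewrite size_allpairs eqxx; apply/allbP => i lt_i.
apply/allbP => j lt_j; rewrite (nth_allpairs _ u0 v0) // (nth_map u0) // (nth_map v0) //.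
exact/H.
Qed.

Arguments isMapP {T P f g} s x.
Arguments isProdP {S T P f g h} s t x.

Definition countc l x := \sum_(i < csize l) (cnth l i == x).

Lemma prs_countc f g : prs f -> prs g -> prs (fun e => countc (f e) (g e)).
Proof.
apply: prs_comp2; rewrite /countc; apply: (prs_sum2 (g := fun i e => (cnth (nth 0 e 0) i == nth 0 e 1))); prs_auto.
Qed.

Lemma countcE l x : countc l x = count_mem x (CodeSeq.decode l).
Proof.
rewrite /countc /csize /cnth -sum1_count [RHS]big_mkcond /= (big_nth 0) big_mkord.
by apply: eq_bigr => i _; case: eqP.
Qed.

Definition sameMon l l' :=
  allb (csize l) (fun u => countc l (cnth l u) == countc l' (cnth l u)) &&
  allb (csize l') (fun u => countc l (cnth l' u) == countc l' (cnth l' u)).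

Lemma prb_sameMon f g : prs f -> prs g -> prb (fun e => sameMon (f e) (g e)).
Proof.
apply: (prs_comp2 (g := fun a b => nat_of_bool (sameMon a b))).
rewrite /sameMon; prs_auto; apply: prs_countc; prs_auto.
Qed.

Lemma sameMonE l l' : sameMon l l' = perm_eq (CodeSeq.decode l) (CodeSeq.decode l').
Proof.
rewrite /sameMon /perm_eq all_cat; congr andb.
  by rewrite -all_decode; apply: eq_all => u /=; rewrite !countcE.
by rewrite -all_decode; apply: eq_all => u /=; rewrite !countcE.
Qed.

Import GRing.Theory.
Local Open Scope ring_scope.

(** * Iterated polynomial rings *)

(** One variable at a time with the last one outermost: facts about [{poly R}], bounds included,
    then lift by induction on [n]. *)
Fixpoint MP (R : idomainType) (n : nat) : idomainType :=
  if n is n'.+1 then ({poly (MP R n')} : idomainType) else R.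

Section Eval.
Variables (R S : comNzRingType).

Definition pev (g : {rmorphism R -> S}) (z : S) : {poly R} -> S :=
  horner_eval z \o map_poly g.
Arguments pev : simpl never.
HB.instance Definition _ g z := GRing.RMorphism.on (pev g z).

Lemma pevE g z p : pev g z p = (map_poly g p).[z].
Proof. by []. Qed.

Lemma pevC g z c : pev g z c%:P = g c.
Proof. by rewrite pevE map_polyC hornerC. Qed.

Lemma pevX g z : pev g z 'X = z.
Proof. by rewrite pevE map_polyX hornerX. Qed.

Lemma pev_sum g z p : pev g z p = \sum_(i < size p) g p`_i * z ^+ i.
Proof.
rewrite pevE (@horner_coef_wide _ (size p)) ?size_poly //.
by apply: eq_bigr => i _; rewrite coef_map.
Qed.
End Eval.

Section Ev.
Variables (R : idomainType) (S : comNzRingType) (f : {rmorphism R -> S})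
  (x : nat -> S).

Fixpoint ev n : {rmorphism MP R n -> S} :=
  if n is n'.+1 return {rmorphism MP R n -> S}
  then (pev (ev n') (x n') : {rmorphism {poly MP R n'} -> S}) else f.
End Ev.

Fixpoint cst (R : idomainType) n : {rmorphism R -> MP R n} :=
  if n is n'.+1 return {rmorphism R -> MP R n}
  then (polyC \o cst R n' : {rmorphism R -> {poly MP R n'}})
  else (idfun : {rmorphism R -> R}).
Arguments cst {R} n.

(** An index out of range gives 0, which every level contains. *)
Fixpoint var (R : idomainType) n (i : nat) : MP R n :=
  if n is n'.+1 return MP R n
  then (if i == n' then 'X else (var R n' i)%:P : {poly MP R n'}) else 0.
Arguments var {R} n i.

Fixpoint MPmap (R S : idomainType) (f : {rmorphism R -> S}) n :
    {rmorphism MP R n -> MP S n} :=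
  if n is n'.+1 return {rmorphism MP R n -> MP S n}
  then (map_poly (MPmap f n') : {rmorphism {poly MP R n'} -> {poly MP S n'}})
  else f.

Section MPTheory.
Variables (R : idomainType).

Lemma MP_ind n (P : MP R n -> Prop) :
  (forall c, P (cst n c)) -> (forall i, (i < n)%N -> P (var n i)) ->
  (forall p q, P p -> P q -> P (p + q)) ->
  (forall p q, P p -> P q -> P (p * q)) -> forall p, P p.
Proof.
elim: n P => [|n IH] P Pc Pv PD PM; first exact: Pc.
have PC c : P (c%:P : {poly MP R n}).
  apply: (IH (fun c => P (c%:P : {poly MP R n}))) => {c} [c|i lt_in|p q Pp Pq|p q Pp Pq].
  - exact: Pc.
  - have := Pv i (ltnW lt_in); rewrite /= ifN //.
    by rewrite neq_ltn lt_in.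
  - by rewrite rmorphD; apply: PD.
  - by rewrite rmorphM; apply: PM.
have PX : P ('X : {poly MP R n}) by have := Pv n (ltnSn n); rewrite /= eqxx.
elim/poly_ind => [|p c Pp]; first by rewrite -polyC0; apply: PC.
by apply: PD (PC c); apply: PM.
Qed.

Lemma MP_eq (S : nzRingType) n (g h : {rmorphism MP R n -> S}) :
  (forall c, g (cst n c) = h (cst n c)) ->
  (forall i, (i < n)%N -> g (var n i) = h (var n i)) -> g =1 h.
Proof.
move=> Hc Hv p; elim/MP_ind: p => // p q Hp Hq.
- by rewrite !rmorphD Hp Hq.
- by rewrite !rmorphM Hp Hq.
Qed.

Section EvTheory.
Variables (S : comNzRingType) (f : {rmorphism R -> S}) (x : nat -> S).

Lemma ev_cst n c : ev f x n (cst n c) = f c.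
Proof. by elim: n => //= n IH; rewrite pevC. Qed.

Lemma ev_var n i : (i < n)%N -> ev f x n (var n i) = x i.
Proof.
elim: n => //= n IH; rewrite ltnS leq_eqVlt; case: eqP => [->|_] /= lt_in.
  by rewrite pevX.
by rewrite pevC IH.
Qed.

Lemma ev_uniq n (h : {rmorphism MP R n -> S}) :
  (forall c, h (cst n c) = f c) ->
  (forall i, (i < n)%N -> h (var n i) = x i) -> h =1 ev f x n.
Proof.
move=> Hc Hv; apply: MP_eq => [c|i lt_in]; first by rewrite Hc ev_cst.
by rewrite Hv // ev_var.
Qed.
End EvTheory.

Lemma eq_ev (S : comNzRingType) (f g : {rmorphism R -> S}) x y n :
  f =1 g -> (forall i, (i < n)%N -> x i = y i) -> ev f x n =1 ev g y n.
Proof.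
move=> fg xy; apply: MP_eq => [c|i lt_in]; first by rewrite !ev_cst.
by rewrite !ev_var // xy.
Qed.

Lemma ev_comp (S T : comNzRingType) (f : {rmorphism R -> S}) x
    (h : {rmorphism S -> T}) (g : {rmorphism R -> T}) y n :
  (forall c, h (f c) = g c) -> (forall i, (i < n)%N -> h (x i) = y i) ->
  forall p, h (ev f x n p) = ev g y n p.
Proof.
move=> Hc Hv; pose h' : {rmorphism MP R n -> T} := (h \o ev f x n : {rmorphism _ -> _}).
apply: (ev_uniq (h := h')) => [c|i lt_in]; rewrite /h' /=; first by rewrite ev_cst.
by rewrite ev_var // Hv.
Qed.

Lemma MPmap_cst (S : idomainType) (f : {rmorphism R -> S}) n c :
  MPmap f n (cst n c) = cst n (f c).
Proof. by elim: n => //= n IH; rewrite map_polyC /= IH. Qed.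

Lemma MPmap_var (S : idomainType) (f : {rmorphism R -> S}) n i :
  MPmap f n (var n i) = var n i.
Proof.
elim: n => /= [|n IH]; first by rewrite rmorph0.
by case: eqP => _; rewrite ?map_polyX // map_polyC /= IH.
Qed.

End MPTheory.

Lemma ev_MPmap (R S : idomainType) (T : comNzRingType) (f : {rmorphism R -> S})
    (g : {rmorphism S -> T}) (h : {rmorphism R -> T}) x n :
  (forall c, g (f c) = h c) -> forall p, ev g x n (MPmap f n p) = ev h x n p.
Proof.
move=> E; pose h' : {rmorphism MP R n -> T} := (ev g x n \o MPmap f n : {rmorphism _ -> _}).
apply: (ev_uniq (h := h')) => [c|i lt_in]; rewrite /h' /=.
  by rewrite MPmap_cst ev_cst.
by rewrite MPmap_var ev_var.
Qed.

Lemma MPmap_inj (R S : idomainType) (f : {rmorphism R -> S}) n :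
  injective f -> injective (MPmap f n).
Proof. by move=> inj_f; elim: n => //= n IH; apply: map_inj_poly; rewrite ?rmorph0. Qed.

Lemma cst_inj (R : idomainType) n : injective (@cst R n).
Proof. by elim: n => [|n IH] //= x y /polyC_inj /IH. Qed.

(** * Levels: bounds on degrees and coefficients *)

Definition bP (R : idomainType) (b : nat -> R -> Prop) (N : nat) (p : {poly R}) : Prop :=
  (size p <= N.+1)%N /\ forall i, b N p`_i.

Fixpoint bMP (R : idomainType) (b : nat -> R -> Prop) (n : nat) {struct n} : nat -> MP R n -> Prop :=
  if n is n'.+1 return nat -> MP R n -> Prop then @bP (MP R n') (@bMP R b n') else b.

Arguments bMP {R} b n N p.

Section Bounds.
Variable G : nat -> nat.
Hypothesis gG : growth G.

(** A product of polynomials of degree at most [x] has degree at most [x + x], and its coefficients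
    are sums of at most [(x + x).+1] products. [finf] dominates the number of choices of [x.+1]
    coefficients. *)
Definition mulf x := (iter (x + x).+2 G x + (x + x))%N.
Definition finf x := (x.+2 ^ x.+1)%N.

(* [mulf] and [finf] bound one variable more: the number of additions grows with
   the rank, but an addition costs only [G] in every rank.  This is what keeps
   the bounds primitive recursive in the number of variables. *)
Record bok (R : idomainType) (b : nat -> R -> Prop) (r : nat) : Prop := Bok {
  bok_mono : forall N M x, (N <= M)%N -> b N x -> b M x;
  bok0 : forall N, b N 0;
  bok1 : forall N, b N 1;
  bokD : forall N x y, b N x -> b N y -> b (G N) (x + y);
  bokN : forall N x, b N x -> b (G N) (- x);
  bokM : forall N x y, b N x -> b N y -> b (iter r mulf (G N)) (x * y);
  bokF : forall N, exists2 s : seq R, (size s <= iter r finf (G N))%N &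
    forall x, b N x -> x \in s
}.

Lemma growth_mulf : growth mulf.
Proof.
have g2 : growth (fun x => x + x)%N := growth_add growth_id growth_id.
apply: growth_add => //; apply: (growth_iter (g := fun x => (x + x).+2)) gG _ growth_id.
by apply: (growth_comp (f := fun x => x.+2)) g2; split=> // [|N];
   [do 2!apply: prs_succ; exact: prs_nth | exact: leq_trans (leqnSn _) (leqnSn _)].
Qed.

Lemma growth_finf : growth finf.
Proof. exact: growth_expS growth_id growth_id. Qed.

(** Diagonal over the rank: iterating [N] times covers every rank at most [N], so one function
    serves all polynomial rings whose rank is below the level. *)
Definition Phi N := (iter N mulf (G N) + iter N finf (G N))%N.

Lemma growth_Phi : growth Phi.
Proof.
apply: growth_add; apply: growth_iter => //;
  by [exact: growth_mulf | exact: growth_finf | exact: growth_id].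
Qed.

Lemma G_Phi N : (G N <= Phi N)%N.
Proof.
apply: leq_trans (leq_addr _ _).
exact: (@iter_mono mulf 0 N (G N) (G N) growth_mulf).
Qed.

Section Ring.
Variables (R : idomainType) (b : nat -> R -> Prop) (r : nat).
Hypothesis Rok : bok b r.
Let mono := bok_mono Rok.

Lemma bsumG M n (F : 'I_n -> R) :
  (forall i, b M (F i)) -> b (iter n G M) (\sum_(i < n) F i).
Proof.
move=> bF; elim: n F bF => [|n IH] F bF.
  by rewrite big_ord0; apply: (bok0 Rok).
rewrite big_ord_recr /=; apply: (bokD Rok); first exact: IH.
by apply: mono (bF _); apply: (@iter_mono G 0 n M M gG).
Qed.

Lemma bD N x y : b N x -> b N y -> b (Phi N) (x + y).
Proof. by move=> bx by_; apply: mono (G_Phi N) (bokD Rok bx by_). Qed.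

Lemma bN N x : b N x -> b (Phi N) (- x).
Proof. by move=> bx; apply: mono (G_Phi N) (bokN Rok bx). Qed.

Lemma bB N x y : b N x -> b N y -> b (Phi (Phi N)) (x - y).
Proof.
move=> bx by_; apply: bD (bN by_).
by apply: mono bx; apply: growth_infl growth_Phi N.
Qed.

Lemma bM N x y : (r <= N)%N -> b N x -> b N y -> b (Phi N) (x * y).
Proof.
move=> le_rN bx by_; apply: mono (bokM Rok bx by_).
by apply: leq_trans (leq_addr _ _); apply: iter_mono => //; exact: growth_mulf.
Qed.

Lemma bF N : (r <= N)%N -> exists2 s : seq R, (size s <= Phi N)%N &
  forall x, b N x -> x \in s.
Proof.
move=> le_rN; have [s le_s sP] := bokF Rok N; exists s => //.
apply: leq_trans le_s _; apply: leq_trans (leq_addl _ _).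
by apply: iter_mono => //; exact: growth_finf.
Qed.

Lemma bX N i x : (r <= N)%N -> b N x -> b (iter i Phi N) (x ^+ i).
Proof.
move=> le_rN bx; elim: i => [|i IH]; first by rewrite expr0; apply: (bok1 Rok).
have le := @iter_mono Phi 0 i N N growth_Phi isT (leqnn N).
by rewrite exprS /=; apply: bM => //; [apply: leq_trans le_rN le | apply: mono bx].
Qed.

Lemma bprod (I : Type) N (s : seq I) (F : I -> R) : (r <= N)%N ->
  (forall i, b N (F i)) -> b (iter (size s) Phi N) (\prod_(i <- s) F i).
Proof.
move=> le_rN bF; elim: s => [|i s IH]; first by rewrite big_nil; apply: (bok1 Rok).
have le := @iter_mono Phi 0 (size s) N N growth_Phi isT (leqnn N).
by rewrite big_cons /=; apply: bM => //; [apply: leq_trans le_rN le | apply: mono (bF i)].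
Qed.

Lemma bsum M n (F : 'I_n -> R) :
  (forall i, b M (F i)) -> b (iter n Phi M) (\sum_(i < n) F i).
Proof.
move=> bF; apply: mono (bsumG bF); elim: n {F bF} => //= n IH.
by apply: leq_trans (G_Phi _); apply: growth_mono gG _ _ IH.
Qed.

Lemma bok_poly : bok (bP b) r.+1.
Proof.
split.
- move=> N M p le_NM [sp bp]; split; first exact: leq_trans sp _.
  by move=> i; apply: mono (bp i).
- by move=> N; split=> [|i]; rewrite ?size_poly0 // coef0; apply: (bok0 Rok).
- move=> N; split=> [|i]; first by rewrite size_poly1.
  by rewrite coef1; case: eqP => _; [apply: (bok1 Rok) | apply: (bok0 Rok)].
- move=> N p q [sp bp] [sq bq]; split.
    apply: leq_trans (size_polyD _ _) _; rewrite geq_max.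
    have le : (N.+1 <= (G N).+1)%N by rewrite ltnS; apply: growth_infl gG N.
    by rewrite (leq_trans sp le) (leq_trans sq le).
  by move=> i; rewrite coefD; apply: (bokD Rok).
- move=> N p [sp bp]; split.
    by rewrite size_polyN (leq_trans sp) // ltnS; apply: growth_infl gG N.
  by move=> i; rewrite coefN; apply: (bokN Rok).
- move=> N p q [sp bp] [sq bq]; set M := iter r mulf (G N).
  have le_NM : (N <= M)%N.
    apply: leq_trans (growth_infl gG N) _.
    exact: (@iter_mono mulf 0 r (G N) (G N) growth_mulf).
  have sz : (size (p * q)%R <= (N + N).+1)%N.
    apply: leq_trans (size_polyMleq _ _) _; rewrite -subn1 leq_subLR.
    by apply: leq_trans (leq_add sp sq) _; rewrite addnS.
  split=> [|i].
    apply: leq_trans sz _; rewrite /= /mulf ltnS -/M.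
    by apply: leq_trans (leq_addl _ _); rewrite leq_add.
  have [lt_i|le_i] := ltnP i (size (p * q)); last first.
    by rewrite nth_default //; apply: (bok0 Rok).
  rewrite coefM; set S := \sum_(j < _) _.
  have : b (iter i.+1 G M) S by apply: bsumG => j; apply: (bokM Rok).
  apply: mono; rewrite -/M [iter r.+1 _ _]/= -/M.
  apply: (@leq_trans (iter (M + M).+2 G M)); last exact: leq_addr.
  apply: iter_mono => //; apply: leq_trans (leq_trans lt_i sz) _.
  by rewrite ltnS; apply: leqW; rewrite leq_add.
- move=> N; have [s les sP] := bokF Rok N.
  pose fix L n : seq (seq R) :=
    if n is n'.+1 then [seq c :: t | c <- s, t <- L n'] else [:: [::]].
  have szL n : size (L n) = (size s ^ n)%N.
    by elim: n => //= n IH; rewrite size_allpairs IH expnS.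
  exists (map Poly (L N.+1)).
    rewrite size_map szL /finf [iter r.+1 _ _]/=; set M := iter r finf (G N) in les *.
    have le_NM : (N <= M)%N.
      apply: leq_trans (growth_infl gG N) _.
      exact: (@iter_mono finf 0 r (G N) (G N) growth_finf).
    rewrite -/M; apply: (@leq_trans (M.+2 ^ N.+1)%N).
      by rewrite leq_exp2r // (leq_trans les) //; apply: leq_trans (leqnSn _) (leqnSn _).
    by rewrite leq_exp2l.
  move=> p [sp bp]; apply/mapP; exists (mkseq (fun i => p`_i) N.+1); last first.
    apply/polyP => i; rewrite coef_Poly; have [lt_i|le_i] := ltnP i N.+1.
      by rewrite nth_mkseq.
    by rewrite !nth_default ?size_mkseq // (leq_trans sp).
  rewrite /mkseq; move: (N.+1) (0%N) => n; elim: n => [|n IH] m; first by rewrite inE.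
  apply/allpairsP; exists (p`_m, [seq p`_i | i <- iota m.+1 n]).
  by split=> //=; apply: sP.
Qed.

Lemma bpolyC N c : b N c -> bP b N c%:P.
Proof.
move=> bc; split=> [|i]; first by rewrite (leq_trans (size_polyC_leq1 _)).
by rewrite coefC; case: eqP => // _; apply: (bok0 Rok).
Qed.

Lemma bpolyX N : (0 < N)%N -> bP b N 'X.
Proof.
move=> N_gt0; split=> [|i]; first by rewrite size_polyX.
by rewrite coefX; case: eqP => _; [apply: (bok1 Rok) | apply: (bok0 Rok)].
Qed.
End Ring.

Lemma bok_MP (R : idomainType) (b : nat -> R -> Prop) r n :
  bok b r -> bok (bMP b n) (n + r).
Proof. by move=> Rok; elim: n => //= n IH; apply: bok_poly. Qed.

Lemma bcst (R : idomainType) (b : nat -> R -> Prop) r n N c :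
  bok b r -> b N c -> bMP b n N (cst n c).
Proof.
by move=> Rok bc; elim: n => //= n IH; apply: bpolyC (bok_MP n Rok) _ _ IH.
Qed.

Lemma bvar (R : idomainType) (b : nat -> R -> Prop) r n N i :
  bok b r -> (0 < N)%N -> bMP b n N (var n i).
Proof.
move=> Rok N_gt0; elim: n => /= [|n IH]; first exact: (bok0 Rok).
case: eqP => _; first exact: bpolyX (bok_MP n Rok) _ _.
exact: bpolyC (bok_MP n Rok) _ _ IH.
Qed.

Lemma bMPmap (R S : idomainType) (b : nat -> R -> Prop) (b' : nat -> S -> Prop)
    (f : {rmorphism R -> S}) n N M p : (N <= M)%N ->
  (forall c, b N c -> b' M (f c)) -> bMP b n N p -> bMP b' n M (MPmap f n p).
Proof.
move=> le_NM bf; elim: n p => [|n IH] p /=; first exact: bf.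
move=> [sp bp]; split=> [|i].
  by apply: leq_trans (size_poly _ _) _; apply: leq_trans sp _.
by rewrite coef_map; apply: IH.
Qed.

(** [N.+2] iterations for a term [c * z ^+ i] of a polynomial of level [N], and at most [N.+1] more
    for the sum of these terms. *)
Definition Psi N := iter (N + N + 3) Phi N.

Lemma growth_Psi : growth Psi.
Proof.
apply: growth_iter growth_Phi _ growth_id.
by apply: growth_addn; apply: growth_add; exact: growth_id.
Qed.

Lemma bpev (R S : idomainType) (b : nat -> R -> Prop) (b' : nat -> S -> Prop) r'
    (g : {rmorphism R -> S}) z N M p :
  bok b' r' -> (r' <= M)%N -> (N <= M)%N -> (forall c, b N c -> b' M (g c)) ->
  b' M z -> bP b N p -> b' (Psi M) (pev g z p).
Proof.
move=> Sok le_rM le_NM bg bz [sp bp]; rewrite pev_sum.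
apply: (bok_mono Sok) (bsum Sok (M := iter M.+2 Phi M) _).
  rewrite -iterD; apply: iter_mono => //; first exact: growth_Phi.
  by move: (leq_trans sp (le_NM : N.+1 <= M.+1)%N); move: (size p) => sz ?; lia.
move=> i; have le1 : (M <= iter M.+1 Phi M)%N.
  exact: (@iter_mono Phi 0 M.+1 M M growth_Phi).
apply: (bM Sok); first exact: leq_trans le_rM le1.
  by apply: (bok_mono Sok) (bg _ (bp _)).
apply: (bok_mono Sok) (bX Sok i le_rM bz).
apply: (@iter_mono Phi i M.+1 M M growth_Phi _ (leqnn M)).
by apply: leq_trans (ltnW (ltn_ord i)) _; apply: leq_trans sp _.
Qed.

Lemma bev (R S : idomainType) (b : nat -> R -> Prop) (b' : nat -> S -> Prop) r'
    (f : {rmorphism R -> S}) x n N M p :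
  bok b' r' -> (r' <= M)%N -> (N <= M)%N -> (forall c, b N c -> b' M (f c)) ->
  (forall i, (i < n)%N -> b' M (x i)) -> bMP b n N p ->
  b' (iter n Psi M) (ev f x n p).
Proof.
move=> Sok le_rM le_NM bf; elim: n p => [|n IH] p bx /=; first exact: bf.
have le1 : (M <= iter n Psi M)%N := @iter_mono Psi 0 n M M growth_Psi isT (leqnn M).
move=> bp; apply: (bpev Sok _ _ _ _ bp).
- exact: leq_trans le1.
- exact: leq_trans le1.
- by move=> c bc; apply: IH => // i lt_i; apply: bx; apply: ltnW.
- by apply: (bok_mono Sok le1); apply: bx.
Qed.

End Bounds.

(** * Bounded ideals and pseudo-division *)

Lemma irredp_factor (L : fieldType) (p : {poly L}) : (1 < size p)%N ->
  exists2 q, irreducible_poly q & q %| p.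
Proof.
move: {2}(size p) (leqnn (size p)) => n; elim: n p => [|n IH] p le_pn p_gt1.
  by move: le_pn; rewrite leqNgt (ltn_trans _ p_gt1).
case: (classic (irreducible_poly p)) => [irr_p|red_p]; first by exists p.
have [q [q_dv q_n1 q_ne]] : exists q, [/\ q %| p, size q != 1%N & ~~ (q %= p)].
  apply: NNPP => nex; apply: red_p; split=> // q q_n1 q_dv.
  by apply: contraT => q_ne; case: nex; exists q.
have p_n0 : p != 0 by rewrite -size_poly_gt0 (ltn_trans _ p_gt1).
have q_n0 : q != 0 by apply: contraNneq p_n0 => q0; rewrite q0 dvd0p in q_dv.
have q_gt1 : (1 < size q)%N by rewrite ltn_neqAle eq_sym q_n1 size_poly_gt0.
have q_lt : (size q < size p)%N.
  rewrite ltn_neqAle dvdp_leq // andbT; apply: contraNneq q_ne => szE.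
  by rewrite -dvdp_size_eqp // szE.
have [t irr_t t_dv] := IH q (leq_trans q_lt le_pn) q_gt1.
by exists t => //; apply: dvdp_trans t_dv q_dv.
Qed.

Lemma root_ext (L : fieldType) (q : {poly L}) : irreducible_poly q ->
  exists (L' : fieldType) (iota : {rmorphism L -> L'}) (z : L'),
    root (map_poly iota q) z.
Proof.
move=> irr_q; have [L' _ [z rz _]] := irredp_FAdjoin irr_q.
by exists L', (in_alg L' : {rmorphism L -> L'}), z.
Qed.

(** Some irreducible factor of [g] does not divide [s], and a root of it can be adjoined: if all of
    them divided [s], then [g], having fewer than [size g] factors, would divide [s ^+ size g]. *)
Lemma root_avoid_ext (L : fieldType) (g s : {poly L}) : (1 < size g)%N ->
  ~~ (g %| s ^+ size g) ->
  exists (L' : fieldType) (iota : {rmorphism L -> L'}) (z : L'),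
    root (map_poly iota g) z /\ ~~ root (map_poly iota s) z.
Proof.
move: {2}(size g) (leqnn (size g)) => n; elim: n g => [|n IH] g le_gn g_gt1 ndv.
  by move: le_gn; rewrite leqNgt (ltn_trans _ g_gt1).
have [q irr_q q_dv] := irredp_factor g_gt1.
have [q_s|q_ns] := boolP (q %| s); last first.
  have [L' [iota [z rz]]] := root_ext irr_q; exists L', iota, z.
  rewrite -irreducible_poly_coprime // in q_ns.
  split; first by apply: root_dvdp rz; rewrite dvdp_map.
  apply/negP => rs; have := q_ns; rewrite -(coprimep_map iota).
  by move/coprimep_root => /(_ z rz); rewrite (rootP rs) eqxx.
have /dvdpP[g1 gE] := q_dv; have q_gt1 := irr_q.1.
have g_n0 : g != 0 by rewrite -size_poly_gt0 (ltn_trans _ g_gt1).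
have g1_n0 : g1 != 0 by apply: contraNneq g_n0 => E; rewrite gE E mul0r.
have q_n0 : q != 0 by rewrite -size_poly_gt0 (ltn_trans _ q_gt1).
have szg : (size g).+1 = (size g1 + size q)%N.
  rewrite gE size_mul // prednK // addn_gt0; apply/orP; left.
  by rewrite size_poly_gt0.
have lt_g1 : (size g1 < size g)%N by lia.
have ndv1 : ~~ (g1 %| s ^+ size g1).
  apply: contra ndv => g1_dv; rewrite gE.
  apply: dvdp_trans (dvdp_mul g1_dv q_s) _; rewrite -exprSr; apply: dvdp_exp2l.
  by rewrite -gE.
have g1_gt1 : (1 < size g1)%N.
  rewrite ltn_neqAle size_poly_gt0 g1_n0 andbT eq_sym; apply: contra ndv1.
  by rewrite size_poly_eq1 => /eqp_dvdl ->; apply: dvd1p.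
have [|L' [iota [z [rz sz]]]] := IH g1 _ g1_gt1 ndv1; first by lia.
by exists L', iota, z; split=> //; rewrite gE rmorphM rootM rz.
Qed.

Lemma growth_iterk k f : growth f -> growth (iter k f).
Proof. by move=> gf; elim: k => [|k IH]; [exact: growth_id | exact: (growth_comp gf IH)]. Qed.

Lemma iter_infl f k N : growth f -> (N <= iter k f N)%N.
Proof. by move=> gf; apply: growth_infl (growth_iterk k gf) N. Qed.

Section NIdeal.
Variables (R : idomainType) (b : nat -> R -> Prop).

(** Radical ideals as seen from level [N]: the rules take arguments of that level only, so the
    polynomials derivable within a much larger bound qualify. *)
Record nideal (N : nat) (J : R -> Prop) : Prop := NIdeal {
  nideal0 : J 0;
  nidealD : forall x y, b N x -> b N y -> J x -> J y -> J (x + y);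
  nidealM : forall x y, b N x -> b N y -> J y -> J (x * y);
  nidealR : forall x, b N x -> J (x * x) -> J x
}.
End NIdeal.

Section Elim.
Variable G : nat -> nat.
Hypothesis gG : growth G.
Notation Phi := (Phi G).
Notation bok := (bok G).
Let gPhi := growth_Phi gG.

(** Room for a fixed number of operations; the chains of operations below stay well under twelve. *)
Definition Om := iter 12 Phi.

Lemma growth_Om : growth Om.
Proof. exact: growth_iterk. Qed.

Lemma iter_Phi_Om k N : (k <= 12)%N -> (iter k Phi N <= Om N)%N.
Proof. by move=> le_k; apply: iter_mono. Qed.

Definition Ex N := iter (finf N) Phi N.

Lemma growth_Ex : growth Ex.
Proof. exact: growth_iter gPhi growth_finf growth_id. Qed.

Section Ring.
Variables (R : idomainType) (b : nat -> R -> Prop) (r : nat).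
Hypothesis Rok : bok b r.

Lemma nideal_mono N M J : (N <= M)%N -> nideal b M J -> nideal b N J.
Proof.
move=> le [J0 JD JM JR]; have mono := bok_mono Rok le.
by split=> // [x y /mono bx /mono by_|x y /mono bx /mono by_|x /mono bx];
  [apply: JD | apply: JM | apply: JR].
Qed.

Lemma blift k N x : b N x -> b (iter k Phi N) x.
Proof. by move=> bx; apply: (bok_mono Rok) bx; apply: (@iter_mono Phi 0). Qed.

Lemma bSi k N x : b (iter k Phi N) x -> b (iter k.+1 Phi N) x.
Proof. by apply: (bok_mono Rok); apply: (growth_infl gPhi). Qed.

Lemma bMi k N x y : (r <= N)%N -> b (iter k Phi N) x -> b (iter k Phi N) y ->
  b (iter k.+1 Phi N) (x * y).
Proof.
move=> le_r; apply: (bM gG Rok); apply: leq_trans le_r _.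
exact: (@iter_mono Phi 0).
Qed.

Lemma bDi k N x y : b (iter k Phi N) x -> b (iter k Phi N) y ->
  b (iter k.+1 Phi N) (x + y).
Proof. exact: (bD gG Rok). Qed.

Lemma bNi k N x : b (iter k Phi N) x -> b (iter k.+1 Phi N) (- x).
Proof. exact: (bN gG Rok). Qed.

Lemma bOm k N x : (k <= 12)%N -> b (iter k Phi N) x -> b (Om N) x.
Proof. by move=> le_k; apply: (bok_mono Rok); apply: iter_Phi_Om. Qed.

Lemma bXe N i x : (r <= N)%N -> (i <= finf N)%N -> b N x -> b (Ex N) (x ^+ i).
Proof.
move=> le_r le_i bx; apply: (bok_mono Rok) (bX gG Rok i le_r bx).
exact: iter_mono.
Qed.

Lemma finf_exp2 N i : (i <= N)%N -> (2 ^ i <= finf N)%N.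
Proof.
move=> le_i; apply: (@leq_trans (2 ^ N.+1)); first by rewrite leq_exp2l // leqW.
by rewrite leq_exp2r.
Qed.

(** The radical rule extracts square roots only, so the exponent is first raised to [2 ^ e]; [Ex] is
    the level of such powers. *)
Lemma nideal_exp N e x J : (r <= N)%N -> (e <= N)%N -> b N x ->
  nideal b (Ex N) J -> J (x ^+ e) -> J x.
Proof.
move=> le_r le_e bx iJ Jx.
have lt2 i : (i < 2 ^ i)%N by exact: ltn_expl.
have {Jx} : J (x ^+ (2 ^ e)).
  rewrite -(subnK (ltnW (lt2 e))) exprD; apply: (nidealM iJ) => //.
    apply: bXe => //; apply: leq_trans (leq_subr _ _) _; exact: finf_exp2.
  by apply: bXe => //; apply: leq_trans (ltnW (lt2 e)) _; exact: finf_exp2.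
elim: e le_e => [|e IH] le_e; first by rewrite expn0 expr1.
rewrite expnS mul2n -addnn exprD => /(nidealR iJ) Jx.
by apply: IH; [apply: ltnW | apply: Jx; apply: bXe => //; apply/finf_exp2/ltnW].
Qed.

Lemma nideal_colon N c J : (r <= N)%N -> b N c -> nideal b (Om N) J ->
  nideal b N (fun x => J (x * c)).
Proof.
move=> le_r bc iJ; have bl x k := @blift k N x.
split=> [|x y bx by_ Jx Jy|x y bx by_ Jy|x bx Jx].
- by rewrite mul0r; apply: (nideal0 iJ).
- rewrite mulrDl; apply: (nidealD iJ) => //;
    by apply: (bOm (k := 1)) => //; apply: bMi => //.
- rewrite -mulrA; apply: (nidealM iJ) => //.
    by apply: (bOm (k := 0)).
  by apply: (bOm (k := 1)) => //; apply: bMi.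
(* The square of [x * c] is a multiple of [x * x * c]. *)
apply: (nidealR iJ).
  by apply: (bOm (k := 1)) => //; apply: bMi.
rewrite mulrACA mulrA; rewrite [X in J X]mulrC; apply: (nidealM iJ) => //.
  by apply: (bOm (k := 0)).
apply: (bOm (k := 2)) => //; apply: (@bMi 1) => //; [exact: (@bMi 0) | exact: blift].
Qed.

Lemma bpolyXn N i : (i <= N)%N -> bP b N 'X^i.
Proof.
move=> le_i; split=> [|j]; first by rewrite size_polyXn ltnS.
by rewrite coefXn; case: eqP => _; [apply: (bok1 Rok) | apply: (bok0 Rok)].
Qed.

Lemma nideal_poly N p (J : {poly R} -> Prop) : nideal (bP b) N J -> bP b N p ->
  (forall i, J (p`_i *: 'X^i)) -> J p.
Proof.
move=> iJ [sp bp] Jp.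
(* Truncations of [p] obey the bound of [p], so the monomials can be added one by one without
   raising the level. *)
have {}Jp i : (i <= size p)%N -> J (take_poly i p).
  elim: i => [|i IH] le_i; first by rewrite take_poly0l; apply: (nideal0 iJ).
  have -> : take_poly i.+1 p = take_poly i p + p`_i *: 'X^i.
    apply/polyP => j; rewrite coefD !coef_take_poly coefZ coefXn ltnS leq_eqVlt.
    by case: eqP => [->|_] /=; rewrite ?ltnn ?add0r ?mulr1 // mulr0 addr0.
  have le_iN : (i <= N)%N by rewrite -ltnS (leq_trans le_i).
  apply: (nidealD iJ) => //; last by apply: IH; apply: ltnW.
    split=> [|j]; first by apply: leq_trans (size_take_poly _ _) _; apply: leqW.
    by rewrite coef_take_poly; case: ifP => // _; apply: (bok0 Rok).
  split=> [|j]; first by apply: leq_trans (size_scale_leq _ _) _; rewrite size_polyXn.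
  rewrite coefZ coefXn; case: eqP => _; rewrite ?mulr1 ?mulr0 //.
  exact: (bok0 Rok).
by have := Jp (size p) (leqnn _); rewrite take_poly_id.
Qed.
End Ring.

Definition theta N := Om (Ex (Om N)).

Lemma growth_theta : growth theta.
Proof. by apply: growth_comp growth_Om (growth_comp growth_Ex growth_Om). Qed.

(** * Pseudo-division with bounds *)

Section PseudoDivision.
Variables (A : idomainType) (b : nat -> A -> Prop) (r : nat).
Hypothesis Aok : bok b r.
Let Pok := bok_poly gG Aok.

Lemma bMC k N c p : (r < N)%N -> b (iter k Phi N) c -> bP b (iter k Phi N) p ->
  bP b (iter k.+1 Phi N) (c%:P * p).
Proof. by move=> lt_r bc bp; apply: (bMi Pok) => //; apply: (bpolyC Aok). Qed.

Lemma blead N p : bP b N p -> b N (lead_coef p).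
Proof. by move=> [_ bp]; apply: bp. Qed.

Lemma reduce_leading (g p : {poly A}) : g != 0 -> (size g <= size p)%N ->
  (size ((lead_coef g)%:P * p -
     (lead_coef p)%:P * 'X^(size p - size g) * g)%R < size p)%N.
Proof.
move=> g_n0 le_gp; have p_n0 : p != 0.
  by rewrite -size_poly_gt0 (leq_trans _ le_gp) // size_poly_gt0.
have l_n0 : lead_coef g != 0 by rewrite lead_coef_eq0.
have m_n0 : lead_coef p != 0 by rewrite lead_coef_eq0.
set u := _%:P * p; set v := _ * g.
have su : size u = size p by rewrite /u mul_polyC size_scale.
have sv : size v = size p.
  rewrite /v -mulrA mul_polyC size_scale // mulrC size_mulXn //.
  by rewrite subnK.
have E : lead_coef u = lead_coef v.
  rewrite /u /v !lead_coefM !lead_coefC lead_coefXn mulr1 mulrC.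
  by [].
apply: (@leq_trans (maxn (size u) (size (- v)))); last first.
  by rewrite size_polyN su sv maxnn.
rewrite ltn_neqAle size_polyD andbT.
rewrite size_polyN su sv maxnn; apply/eqP => sE.
have: (u - v)`_(size p).-1 != 0.
  by rewrite -[in (size p).-1]sE -/(lead_coef _) lead_coef_eq0 -size_poly_gt0 sE size_poly_gt0.
by rewrite coefB -{1}su -sv -!/(lead_coef _) E subrr eqxx.
Qed.

(** Each cancellation of a leading term costs two [theta]: one for the level of the reduced
    dividend, one for assembling the quotient. *)
Lemma pdiv_bounded N (g p : {poly A}) d : (r < N)%N -> (d <= N)%N -> g != 0 ->
  bP b N g -> bP b N p -> (size p <= d)%N ->
  exists j (q t : {poly A}), [/\ (j <= d)%N, (lead_coef g ^+ j)%:P * p = q * g + t,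
    (size t < size g)%N & bP b (iter (d + d) theta N) q /\ bP b (iter (d + d) theta N) t].
Proof.
elim: d N p => [|d IH] N p lt_rN le_dN g_n0 bg bp sp.
  have -> : p = 0 by apply/eqP; rewrite -size_poly_leq0.
  exists 0%N, 0, 0; rewrite mulr0 mul0r addr0 size_poly0 size_poly_gt0 g_n0.
  by split=> //; split; apply: (bok0 Pok).
have le_it := iter_infl (d.+1 + d.+1) N growth_theta.
have [lt_pg|le_gp] := ltnP (size p) (size g).
  exists 0%N, 0, p; rewrite expr0 mul1r mul0r add0r; split=> //.
  by split; [apply: (bok0 Pok) | apply: (bok_mono Pok) bp].
have lt_size := reduce_leading g_n0 le_gp.
set u := _ - _ in lt_size; set e := (size p - size g)%N in u lt_size.
have le_eN : (e <= N)%N.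
  rewrite /e leq_subLR; apply: leq_trans bp.1 _.
  by rewrite -[X in (X <= _)%N]add1n leq_add2r size_poly_gt0.
have bu : bP b (theta N) u.
  apply: (bok_mono Pok (N := Om N)).
    rewrite /theta; apply: leq_trans (growth_infl growth_Ex _) (growth_infl growth_Om _).
  apply: (bOm Pok (k := 4)) => //; apply: (bDi Pok).
    apply: (blift Pok 2); apply: (bMC (k := 0)) => //; exact: blead.
  apply: (bNi Pok (k := 2)); apply: (bMi Pok) => //; last exact: (blift Pok 1).
  by apply: (bMC (k := 0)) => //; [exact: blead | exact: (bpolyXn Aok)].
have le_N : (N <= theta N)%N := growth_infl growth_theta N.
have [j [q [t [le_j E st [bq bt]]]]] := IH (theta N) u (leq_trans lt_rN le_N)
  (leq_trans (ltnW le_dN) le_N) g_n0 (bok_mono Pok le_N bg) bu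
  (leq_trans lt_size sp).
set X := iter (d + d) theta (theta N) in bq bt.
have le_NX : (N <= X)%N.
  exact: (leq_trans le_N (iter_infl _ _ growth_theta)).
have XE : iter (d.+1 + d.+1) theta N = theta X.
  by rewrite addSn addnS iterS iterSr.
have le_X : (X <= theta X)%N := growth_infl growth_theta X.
exists j.+1, (q + (lead_coef g ^+ j)%:P * ((lead_coef p)%:P * 'X^e)), t; split => //.
- rewrite exprSr rmorphM /= -mulrA.
  have -> : (lead_coef g)%:P * p = u + (lead_coef p)%:P * 'X^e * g by rewrite subrK.
  by rewrite mulrDr E !mulrDl !mulrA addrAC.
rewrite XE; split; last exact: (bok_mono Pok le_X).
have le_ExX : (X <= Ex X)%N := growth_infl growth_Ex X.
apply: (bok_mono Pok (N := Om (Ex X))).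
  by apply: (growth_mono growth_Om); apply: (growth_mono growth_Ex); apply: (growth_infl growth_Om).
have le_rE : (r < Ex X)%N by rewrite (leq_trans lt_rN) // (leq_trans le_NX).
apply: (bOm Pok (k := 3)) => //; apply: (bDi Pok).
  by apply: (blift Pok 2); apply: (bok_mono Pok le_ExX).
apply: (bMC (k := 1)) => //.
  apply: (blift Aok 1); apply: (bXe Aok) => //.
  - exact: leq_trans (ltnW lt_rN) le_NX.
  - apply: leq_trans le_j _; apply: leq_trans (ltnW le_dN) _.
    by apply: leq_trans le_NX _; exact: (growth_infl growth_finf).
  - by apply: (bok_mono Aok le_NX); exact: blead.
apply: (bMC (k := 0)) => //.
  by apply: (bok_mono Aok (leq_trans le_NX le_ExX)); exact: blead.
by apply: (bpolyXn Aok); apply: leq_trans le_eN _; apply: leq_trans le_ExX.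
Qed.
End PseudoDivision.

End Elim.

(** * Elimination *)

Lemma tofrac_inj (R : idomainType) : injective (@tofrac R).
Proof.
move=> x y /eqP; rewrite -subr_eq0 -rmorphB tofrac_eq0 subr_eq0.
by move/eqP.
Qed.

Section Elim.
Local Opaque Phi Om Ex theta.
Variable G : nat -> nat.
Hypothesis gG : growth G.
Notation Phi := (Phi G).
Notation bok := (bok G).
Notation Om := (Om G).
Notation Ex := (Ex G).
Notation theta := (theta G).
Let gPhi := growth_Phi gG.
Let gOm := growth_Om gG.
Let gEx := growth_Ex gG.
Let gth := growth_theta gG.

Variables (B : idomainType) (bB : nat -> B -> Prop) (rB : nat).
Hypothesis Bok : bok bB rB.

(** This and [eliminant] are the two sides of a Nullstellensatz over the fraction field of [B]:
    points lie in fields into which [B] embeds, and the factor [rho] clears denominators. *)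
Definition no_points (A : idomainType) (kap : {rmorphism B -> A}) (E : seq A) (s : A) :=
  forall (L : fieldType) (h : {rmorphism A -> L}),
    injective (fun c => h (kap c)) -> (forall e, e \in E -> h e = 0) -> h s = 0.

Definition eliminant (A : idomainType) (b : nat -> A -> Prop)
    (kap : {rmorphism B -> A}) (E : seq A) (s : A) (M : nat) :=
  exists rho : B, [/\ rho != 0, bB M rho & forall J, nideal b M J ->
    (forall e, e \in E -> J e) -> J (kap rho * s)].

Definition eliminable (A : idomainType) (b : nat -> A -> Prop)
    (kap : {rmorphism B -> A}) (N M : nat) :=
  forall (E : seq A) (s : A), (size E <= N)%N -> (forall e, e \in E -> b N e) ->
    b N s -> no_points kap E s -> eliminant b kap E s M.

Lemma eliminable_base N : (rB <= N)%N -> eliminable bB idfun N (Phi N).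
Proof.
move=> le_r E s _ bE bs np.
have le_N := growth_infl gPhi N.
have [->|s_n0] := eqVneq s 0.
  exists 1; rewrite oner_eq0; split=> //; first exact: (bok1 Bok).
  by move=> J iJ _; rewrite mulr0; apply: (nideal0 iJ).
(* If all equations were 0, the fraction field of [B] would be a point where [s] does not vanish. *)
have [e Ee e_n0] : exists2 e, e \in E & e != 0.
  apply: NNPP => nE; case/eqP: s_n0; apply: (@tofrac_inj B); rewrite rmorph0.
  apply: (np {fraction B} (@tofrac B : {rmorphism B -> _})) => [|e Ee].
    exact: tofrac_inj.
  have [->|e_n0] := eqVneq e 0; first exact: rmorph0.
  by case: nE; exists e.
exists e; split=> //; first exact: (bok_mono Bok le_N (bE e Ee)).
move=> J iJ JE /=; rewrite mulrC; apply: (nidealM iJ) (JE e Ee).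
  exact: (bok_mono Bok le_N).
exact: (bok_mono Bok le_N (bE e Ee)).
Qed.

Lemma growth_S : growth succn.
Proof. by split=> //; apply: prs_succ; exact: prs_nth. Qed.

Lemma Phi_double N : (0 < N)%N -> (N + N + 3 <= Phi N)%N.
Proof.
move=> N_gt0; apply: (@leq_trans (iter N finf (G N))); last exact: leq_addl.
apply: (@leq_trans (finf N)).
  rewrite /finf; apply: (@leq_trans (N.+2 ^ 2)); last by rewrite leq_exp2l.
  by rewrite expnS expn1; nia.
case: N N_gt0 => // N _; rewrite iterS; apply: (growth_mono growth_finf).
by apply: leq_trans (growth_infl gG _) (iter_infl _ _ growth_finf).
Qed.

(** One [Om] for each coefficient of a polynomial of level [M], when the eliminants of all its
    coefficients are multiplied. *)
Definition wid M := iter M.+2 Om M.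

Lemma widE M : wid M = iter M.+2 Om M.
Proof. by []. Qed.

Lemma growth_wid : growth wid.
Proof.
apply: growth_iter => //; last exact: growth_id.
exact: (growth_comp growth_S growth_S).
Qed.

Local Opaque wid.

Section Divide.
Variables (A : idomainType) (b : nat -> A -> Prop) (r : nat).
Hypothesis Aok : bok b r.

(** The power of [c * (l * s)] with exponent [j + e + 1] is a multiple of
    [c * (l * (l ^+ j * s ^+ e))], that is, of [c * (l * q) * g + c * (l * t)], which lies in
    [J]. *)
Lemma nideal_divide W c l s q g t j e J : (r <= W)%N ->
  b W c -> b W l -> b W s -> b W q -> b W g -> b W t ->
  (j + e + 1 <= Om W)%N -> l ^+ j * s ^+ e = q * g + t ->
  nideal b (Om (Ex (Om (Om W)))) J -> J g -> J (c * (l * t)) ->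
  J (c * (l * s)).
Proof.
move=> r_W bc bl bs bq bg bt le_T0 Et iJ Jg Jt.
have bOmP := @bOm _ gG _ _ _ Aok; have bMP := @bMi _ gG _ _ _ Aok.
have blP := @blift _ gG _ _ _ Aok.
have bls : b (iter 2 Phi W) (c * (l * s)).
  exact: (bMP 1%N W _ _ r_W (blP 1%N W _ bc) (bMP 0%N W _ _ r_W bl bs)).
have {}bls : b (Om W) (c * (l * s)) := bOmP 2%N W _ isT bls.
have le_WX := growth_infl gOm W; have le_XX := growth_infl gOm (Om W).
have le_XY := growth_infl gEx (Om (Om W)).
have le_chi := growth_infl gOm (Ex (Om (Om W))).
have le_WXX := leq_trans le_WX le_XX.
have le_WY := leq_trans le_WXX le_XY.
have r_X := leq_trans r_W le_WXX; have r_Y := leq_trans r_W le_WY.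
apply: (nideal_exp gG Aok (N := Om (Om W)) (e := j + e + 1) r_X).
- exact: leq_trans le_T0 le_XX.
- exact: (bok_mono Aok le_XX bls).
- exact: (nideal_mono Aok le_chi iJ).
have -> : (c * (l * s)) ^+ (j + e + 1) =
    (c ^+ (j + e) * (l ^+ e * s ^+ (j + 1))) * (c * (l * (l ^+ j * s ^+ e))).
  by rewrite !exprMn !exprD expr1; ring.
have -> : c * (l * (l ^+ j * s ^+ e)) = c * (l * q) * g + c * (l * t).
  by rewrite Et; ring.
have bXY p i : (i <= j + e + 1)%N -> b W p -> b (Ex (Om (Om W))) (p ^+ i).
  move=> le_i bp; apply: (bXe gG Aok r_X _ (bok_mono Aok le_WXX bp)).
  apply: leq_trans le_i _; apply: leq_trans le_T0 _; apply: leq_trans le_XX _.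
  exact: (growth_infl growth_finf).
have bY p (bp : b W p) := bok_mono Aok le_WY bp.
move: (bY _ bq) (bY _ bg) (bY _ bt) (bY _ bc) (bY _ bl) => {}bq {}bg {}bt bcY blY.
have b1 : b (Ex (Om (Om W))) (c ^+ (j + e)) by apply: (bXY _) bc; apply: leq_addr.
have b2 : b (Ex (Om (Om W))) (l ^+ e) by apply: (bXY _) bl; clear; lia.
have b3 : b (Ex (Om (Om W))) (s ^+ (j + 1)) by apply: (bXY _) bs; clear; lia.
move: (Ex (Om (Om W))) r_Y iJ bq bg bt bcY blY b1 b2 b3 => Y r_Y iJ bq bg bt bcY blY b1 b2 b3.
have bM3 x y z : b Y x -> b Y y -> b Y z -> b (iter 2 Phi Y) (x * (y * z)).
  move=> bx by_ bz.
  exact: (bMP 1%N Y _ _ r_Y (blP 1%N Y _ bx) (bMP 0%N Y _ _ r_Y by_ bz)).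
have bclq := bM3 _ _ _ bcY blY bq; have bclt := bM3 _ _ _ bcY blY bt.
have bterm := bMP 2%N Y _ _ r_Y bclq (blP 2%N Y _ bg).
have bsum := bDi gG Aok bterm (bSi gG Aok bclt).
apply: (nidealM iJ).
- exact: (bOmP 2%N Y _ isT (bM3 _ _ _ b1 b2 b3)).
- exact: (bOmP 4%N Y _ isT bsum).
apply: (nidealD iJ); last exact: Jt.
- exact: (bOmP 3%N Y _ isT bterm).
- exact: (bOmP 2%N Y _ isT bclt).
apply: (nidealM iJ) Jg; first exact: (bOmP 2%N Y _ isT bclq).
exact: (bOmP 0%N Y _ isT bg).
Qed.
End Divide.

(** * Elimination of one variable *)

Section Step.
Variables (A : idomainType) (b : nat -> A -> Prop) (r : nat).
Hypothesis Aok : bok b r.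
Variable kap : {rmorphism B -> A}.
Hypothesis bkap : forall N c, bB N c -> b N (kap c).
Variables N1 M1 : nat.
Hypothesis IH : eliminable b kap N1 M1.
Hypothesis le_NM1 : (N1 <= M1)%N.
Hypothesis r_M1 : (r < M1)%N.
Hypothesis rB_M1 : (rB <= M1)%N.
Let Pok := bok_poly gG Aok.
Let kapP : {rmorphism B -> {poly A}} := (polyC \o kap : {rmorphism B -> {poly A}}).

Lemma elim_many (E cs : seq A) :
  (size E <= N1)%N -> (forall e, e \in E -> b N1 e) ->
  (forall c, c \in cs -> b N1 c /\ no_points kap E c) ->
  exists rho : B, [/\ rho != 0, bB (iter (size cs) Om M1) rho &
    forall J, nideal b (iter (size cs) Om M1) J ->
      (forall e, e \in E -> J e) -> forall c, c \in cs -> J (kap rho * c)].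
Proof.
move=> sE bE; elim: cs => [|c cs IHcs] Hcs.
  by exists 1; rewrite oner_eq0; split=> //; apply: (bok1 Bok).
have [bc npc] := Hcs c (mem_head _ _).
have [rho1 [n01 b1 J1]] := IH sE bE bc npc.
have {}Hcs c' : c' \in cs -> b N1 c' /\ no_points kap E c'.
  by move=> cs_c'; apply: Hcs; rewrite inE cs_c' orbT.
have [rho2 [n02 b2 J2]] := IHcs Hcs.
set X := iter (size cs) Om M1 in b2 J2.
have -> : iter (size (c :: cs)) Om M1 = Om X by [].
have le_M1X : (M1 <= X)%N := iter_infl _ _ gOm.
have le_X : (X <= Om X)%N := growth_infl gOm X.
have rB_X : (rB <= X)%N by apply: leq_trans le_M1X.
have r_X : (r <= X)%N by apply: leq_trans le_M1X; apply: ltnW.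
have b1X := bok_mono Bok le_M1X b1.
exists (rho1 * rho2); split; first by rewrite mulf_neq0.
  apply: (bOm gG Bok (k := 1)) => //; exact: (bMi gG Bok).
move=> J iJ JE.
have bOmA := @bOm _ gG _ _ _ Aok; have bMA := @bMi _ gG _ _ _ Aok.
have bliftA := @blift _ gG _ _ _ Aok.
have H x y z : bB X x -> bB X y -> b X z -> J (kap x * z) ->
    J (kap (x * y) * z).
  move=> bx by_ bz Jz; rewrite rmorphM [kap x * _]mulrC -mulrA.
  apply: (nidealM iJ) => //.
    by apply: (bOmA 0%N) => //; apply: bkap.
  by apply: (bOmA 1%N) => //; apply: bMA => //; apply: bkap.
have le_N1X := leq_trans le_NM1 le_M1X.
move=> c'; rewrite inE => /orP[/eqP->|cs_c'].
  apply: H => //; first exact: (bok_mono Aok le_N1X).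
  by apply: J1 => //; apply: (nideal_mono Aok (leq_trans le_M1X le_X) iJ).
rewrite [rho1 * _]mulrC; apply: H => //; first exact: (bok_mono Aok le_N1X (Hcs _ cs_c').1).
by apply: J2 => //; apply: (nideal_mono Aok le_X iJ).
Qed.

Lemma M1_wid : (M1 <= wid M1)%N.
Proof. by rewrite widE; apply: iter_infl. Qed.

Lemma elim_coefs (E : seq {poly A}) (p : {poly A}) N :
  (size E <= N)%N -> (N <= N1)%N -> (forall e, e \in E -> bP b N e) ->
  bP b N p -> (forall e, e \in E -> (size e <= 1)%N) ->
  (forall i, no_points kap [seq e`_0 | e : {poly A} <- E] p`_i) ->
  exists rho : B, [/\ rho != 0, bB (wid M1) rho &
    forall J, nideal (bP b) (Om (Om (wid M1))) J -> (forall e, e \in E -> J e) ->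
      J (kapP rho * p)].
Proof.
move=> sE le_NN1 bE bp E1 np.
have [|e /mapP[f Ef ->]|c /(nthP 0)[i _ <-]|rho [n0 br Jr]] :=
    @elim_many [seq e`_0 | e : {poly A} <- E] p.
- by rewrite size_map (leq_trans sE).
- by apply: (bok_mono Aok le_NN1); apply: (bE f Ef).2.
- by split; [apply: (bok_mono Aok le_NN1); apply: bp.2 | exact: np].
have le_w : (iter (size p) Om M1 <= wid M1)%N.
  rewrite widE.
  apply: iter_mono => //; apply: leq_trans bp.1 _; rewrite ltnS.
  by apply: leq_trans le_NN1 _; apply: leq_trans le_NM1 _; apply: leqnSn.
exists rho; split=> //; first exact: (bok_mono Bok le_w).
(* The constants in [J] form a bounded ideal of [A], to which the elimination over [A] applies. *)
move=> J iJ JE; pose JA c := J (c%:P).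
have le_wO : (wid M1 <= Om (Om (wid M1)))%N.
  by apply: leq_trans (growth_infl gOm _) (growth_infl gOm _).
have iJA : nideal b (iter (size p) Om M1) JA.
  have le := leq_trans le_w le_wO.
  have bC c : b (iter (size p) Om M1) c -> bP b (Om (Om (wid M1))) c%:P.
    by move=> bc; apply: (bpolyC Aok); apply: (bok_mono Aok le).
  split; rewrite /JA.
  - by rewrite polyC0; apply: (nideal0 iJ).
  - by move=> x y /bC bx /bC by_; rewrite polyCD; apply: (nidealD iJ).
  - by move=> x y /bC bx /bC by_; rewrite polyCM; apply: (nidealM iJ).
  - by move=> x /bC bx; rewrite polyCM; apply: (nidealR iJ).
have {}Jr := Jr JA iJA.
have Jc i : J ((kap rho * p`_i)%:P).
  have [lt_i|le_i] := ltnP i (size p); last first.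
    by rewrite nth_default // mulr0 polyC0; apply: (nideal0 iJ).
  apply: Jr; last exact: mem_nth.
  move=> e /mapP[f Ef ->]; rewrite /JA -size1_polyC; first exact: JE.
  exact: E1.
have le_Nw : (N <= wid M1)%N.
  by apply: leq_trans le_NN1 _; apply: leq_trans le_NM1 _; exact: M1_wid.
have r_w : (r < wid M1)%N by apply: leq_trans M1_wid.
have bkr : b (wid M1) (kap rho) by apply: bkap; apply: (bok_mono Bok le_w).
have bkp : bP b (Phi (wid M1)) (kapP rho * p).
  by apply: (bMC gG Aok (k := 0)) => //; apply: (bok_mono Pok le_Nw).
have le1 : (Phi (wid M1) <= Om (wid M1))%N by apply: (iter_Phi_Om gG (k := 1)).
apply: (nideal_poly Aok (N := Om (wid M1))).
- by apply: (nideal_mono Pok _ iJ); apply: (growth_infl gOm).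
- by apply: (bok_mono Pok le1).
move=> i; have [lt_i|le_i] := ltnP i (size p); last first.
  rewrite nth_default ?scale0r; first exact: (nideal0 iJ).
  by apply: leq_trans le_i; rewrite /kapP /= mul_polyC size_scale_leq.
rewrite -mul_polyC mulrC; apply: (nidealM iJ).
- apply: (bpolyXn Aok); apply: leq_trans le_wO; apply: leq_trans le_Nw.
  by rewrite -ltnS (leq_trans lt_i bp.1).
- apply: (bpolyC Aok); apply: (bok_mono Aok _ (bkp.2 i)).
  by apply: leq_trans le1 (growth_infl gOm _).
by rewrite /kapP /= coefCM; apply: Jc.
Qed.

(** The variable is sent to an element transcendental over [L]. The equations are constants and
    still hold, so the image of [p] is zero as a polynomial over [L]. *)
Lemma no_points_coef (E : seq {poly A}) (p : {poly A}) :
  (forall e, e \in E -> (size e <= 1)%N) -> no_points kapP E p ->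
  forall i, no_points kap [seq e`_0 | e : {poly A} <- E] p`_i.
Proof.
move=> E1 np i L h inj_h hE.
pose F := {fraction {poly L}}.
pose io : {rmorphism L -> F} := (@tofrac {poly L} \o polyC : {rmorphism L -> F}).
pose ioh : {rmorphism A -> F} := (io \o h : {rmorphism A -> F}).
pose h' : {rmorphism {poly A} -> F} := pev ioh (tofrac 'X).
have h'E p' : h' p' = tofrac (map_poly h p').
  rewrite -[h' p']/(pev ioh (tofrac 'X) p') pev_sum.
  have sz : (size (map_poly h p') <= size p')%N by exact: size_poly.
  rewrite -[in RHS](take_poly_id sz) /take_poly poly_def rmorph_sum /=.
  by apply: eq_bigr => j _; rewrite -mul_polyC rmorphM rmorphXn coef_map.
have : map_poly h p = 0.
  apply: (@tofrac_inj {poly L}); rewrite rmorph0 -h'E.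
  apply: np => [c c' /= | e Ee].
    by rewrite !h'E !map_polyC => /tofrac_inj/polyC_inj/inj_h.
  rewrite h'E (size1_polyC (E1 e Ee)) map_polyC /= hE ?polyC0 ?rmorph0 //.
  by apply/mapP; exists e.
move/polyP/(_ i).
by rewrite coef_map coef0.
Qed.

(** [pdl] bounds the pseudo-division of a power of [s] by [g]. One reduction raises the level of the
    system by [psi] and the level asked of the ideal by [chi]. *)
Definition pdl N := (iter ((Ex N).+1 + (Ex N).+1) theta (Ex N).+1)%N.
Definition psi N := Om (pdl N).
Definition chi M := Om (Ex (Om (Om (wid M)))).

Lemma growth_psi : growth psi.
Proof.
have gS : growth (fun N => (Ex N).+1) by apply: (growth_comp growth_S gEx).
by apply: (growth_comp gOm); apply: growth_iter => //; apply: growth_add.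
Qed.

Lemma psiE N : psi N = Om (iter ((Ex N).+1 + (Ex N).+1) theta (Ex N).+1).
Proof. by []. Qed.

Lemma chiE M : chi M = Om (Ex (Om (Om (wid M)))).
Proof. by []. Qed.

Lemma growth_chi : growth chi.
Proof.
apply: (growth_comp gOm); apply: (growth_comp gEx); do 2!apply: (growth_comp gOm).
exact: growth_wid.
Qed.

Local Opaque chi psi.

(** At a zero of the constants in [E] where neither [lead_coef g] nor some coefficient of [t]
    vanishes, the image of [g] does not divide that of [s ^+ size g]: the remainder would be a
    nonzero shorter multiple of it. By [root_avoid_ext], [g] then has a root where [s] does not
    vanish. *)
Lemma no_points_rem (E : seq {poly A}) (g s q t : {poly A}) j :
  g \in E -> (1 < size g)%N -> (forall e, e \in rem g E -> (size e <= 1)%N) ->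
  (lead_coef g ^+ j)%:P * s ^+ size g = q * g + t -> (size t < size g)%N ->
  no_points kapP E s -> forall i,
  no_points kap [seq f`_0 | f : {poly A} <- rem g E] ((lead_coef g)%:P * t)`_i.
Proof.
move=> Eg g_gt1 rem1 Et st np i; set l := lead_coef g in Et *.
move=> L h inj_h hE; rewrite coefCM; apply/eqP; apply: contraT => hn0.
  move: hn0; rewrite rmorphM mulf_eq0 negb_or => /andP[hl hti].
  set gh := map_poly h g; set sh := map_poly h s.
  have sgh : size gh = size g by rewrite size_map_poly_id0.
  have ndv : ~~ (gh %| sh ^+ size gh).
    apply/negP => dv; have: gh %| map_poly h t.
      have -> : map_poly h t = map_poly h (l ^+ j)%:P * sh ^+ size gh - map_poly h q * gh.
        by rewrite sgh -rmorphXn -!rmorphM Et rmorphD rmorphM addrAC subrr add0r.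
      by apply: dvdp_sub; [apply: dvdp_mull | apply: dvdp_mull; apply: dvdpp].
    have th_n0 : map_poly h t != 0.
      by apply: contraNneq hti => /polyP/(_ i); rewrite coef_map coef0 => ->.
    move/(dvdp_leq th_n0); rewrite leqNgt sgh => /negP; apply.
    by apply: leq_ltn_trans st; exact: size_poly.
  have [|L' [io [z [rz sz]]]] := root_avoid_ext _ ndv; first by rewrite sgh.
  pose ioh : {rmorphism A -> L'} := (io \o h : {rmorphism A -> L'}).
  pose h' : {rmorphism {poly A} -> L'} := pev ioh z.
  have h'E p : h' p = (map_poly io (map_poly h p)).[z].
    by rewrite -[h' p]/(pev ioh z p) pevE (map_poly_comp io h).
  have h'C c : h' c%:P = io (h c).
    by rewrite -[h' _]/(pev ioh z c%:P) pevC.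
  move: sz; rewrite /root -h'E; case/eqP; apply: np => [c c'|f Ef].
    by rewrite !h'C => /fmorph_inj/inj_h.
  have [->|f_ng] := eqVneq f g; first by rewrite h'E; apply/eqP.
  have f_rem : f \in rem g E.
    by move: Ef; rewrite (perm_mem (perm_to_rem Eg)) inE (negPf f_ng).
  rewrite (size1_polyC (rem1 f f_rem)) h'C hE ?rmorph0 //.
  by apply/mapP; exists f.
Qed.

Lemma elim_terminal_at (E : seq {poly A}) (g s q t : {poly A}) N T j :
  (r < T)%N -> (N <= T)%N -> (Om T <= N1)%N -> (j <= T)%N -> (size E <= N)%N ->
  (forall e, e \in E -> bP b N e) -> bP b N s -> g \in E -> (1 < size g)%N ->
  (forall e, e \in rem g E -> (size e <= 1)%N) -> no_points kapP E s ->
  (lead_coef g ^+ j)%:P * s ^+ size g = q * g + t -> (size t < size g)%N ->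
  bP b T q -> bP b T t ->
  exists rho : B, [/\ rho != 0, bB (wid M1) rho &
    forall J, nideal (bP b) (chi M1) J -> (forall e, e \in E -> J e) ->
      J (kapP rho * ((lead_coef g)%:P * s))].
Proof.
move=> r_T le_NT le_TN1 le_j sE bE bs Eg g_gt1 rem1 np Et st bq bt.
have npl := no_points_rem Eg g_gt1 rem1 Et st np.
have bg := bE g Eg; set l := lead_coef g in Et npl *.
set e := size g in Et; have le_e : (e <= N.+1)%N := bg.1.
have le_TN : (T <= N1)%N := leq_trans (growth_infl gOm T) le_TN1.
have le_NN1 := leq_trans le_NT le_TN.
have blt := @bMC _ gG _ _ _ Aok 0 T _ _ r_T (blead (bok_mono Pok le_NT bg)) bt.
have {}blt := bok_mono Pok le_TN1 (@bOm _ gG _ _ _ Pok 1 T _ isT blt).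
have sub_rem f : f \in rem g E -> f \in E by apply: mem_rem.
have srem : (size (rem g E) <= N1)%N.
  exact: leq_trans (leq_trans (size_subseq (rem_subseq g E)) sE) le_NN1.
have brem f : f \in rem g E -> bP b N1 f.
  by move=> /sub_rem Ef; apply: (bok_mono Pok le_NN1 (bE f Ef)).
have [rho [n0 br Jr]] := elim_coefs srem (leqnn N1) brem blt rem1 npl.
exists rho; split=> // J iJ JE.
have le_M1W : (M1 <= wid M1)%N by exact: M1_wid.
rewrite chiE in iJ; move: (wid M1) le_M1W br Jr iJ => W le_M1W br Jr iJ.
have r_W : (r < W)%N by apply: leq_trans le_M1W.
have {}Jr : J (kapP rho * (l%:P * t)).
  apply: Jr => [|f /sub_rem]; last exact: JE.
  apply: (nideal_mono Pok _ iJ).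
  by apply: leq_trans (growth_infl gEx _) (growth_infl gOm _).
have le_TW := leq_trans le_TN (leq_trans le_NM1 le_M1W).
have le_NW := leq_trans le_NT le_TW.
have bl : bP b W l%:P.
  by apply: (bpolyC Aok); apply: (bok_mono Aok le_NW); apply: blead.
have bc : bP b W (kapP rho) by apply: (bpolyC Aok); apply: bkap.
have le_T0 : (j + e + 1 <= Om W)%N.
  apply: (@leq_trans (W + W + 3)); last first.
    apply: (leq_trans (Phi_double _)); first exact: leq_trans r_W.
    exact: (iter_Phi_Om gG (k := 1)).
  have H1 : (j <= W)%N by apply: leq_trans le_j _.
  have H2 : (e <= W.+1)%N by apply: leq_trans le_e _.
  by move: H1 H2; clear; move: e => e; lia.
rewrite rmorphXn /= in Et.
exact: (nideal_divide Pok r_W bc bl (bok_mono Pok le_NW bs) (bok_mono Pok le_TW bq)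
  (bok_mono Pok le_NW bg) (bok_mono Pok le_TW bt) le_T0 Et iJ (JE g Eg) Jr).
Qed.

Lemma elim_terminal (E : seq {poly A}) (g s : {poly A}) N :
  (r < N)%N -> (psi N <= N1)%N -> (size E <= N)%N ->
  (forall e, e \in E -> bP b N e) -> bP b N s -> g \in E -> (1 < size g)%N ->
  (forall e, e \in rem g E -> (size e <= 1)%N) -> no_points kapP E s ->
  exists rho : B, [/\ rho != 0, bB (wid M1) rho &
    forall J, nideal (bP b) (chi M1) J -> (forall e, e \in E -> J e) ->
      J (kapP rho * ((lead_coef g)%:P * s))].
Proof.
move=> r_N le_psi sE bE bs Eg g_gt1 rem1 np.
have g_n0 : g != 0 by rewrite -size_poly_gt0 (ltn_trans _ g_gt1).
have bg := bE g Eg; have le_N : (N <= (Ex N).+1)%N.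
  by apply: leq_trans (growth_infl gEx N) _.
have bse : bP b (Ex N) (s ^+ size g).
  apply: (bXe gG Pok) => //; apply: leq_trans bg.1 _.
  apply: leq_trans (_ : N.+2 <= _)%N; first exact: leqnSn.
  by rewrite /finf expnS leq_pmulr // expn_gt0.
have [j [q [t [le_j Et st [bq bt]]]]] := @pdiv_bounded _ gG _ _ _ Aok _ g _ _
  (leq_trans r_N le_N) (leqnn _) g_n0 (bok_mono Pok le_N bg)
  (bok_mono Pok (leqnSn _) bse) bse.1.
rewrite psiE in le_psi.
have le_T := iter_infl ((Ex N).+1 + (Ex N).+1) (Ex N).+1 gth.
exact: (elim_terminal_at (leq_trans r_N (leq_trans le_N le_T)) (leq_trans le_N le_T)
  le_psi (leq_trans le_j le_T) sE bE bs Eg g_gt1 rem1 np Et st bq bt).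
Qed.

Lemma chi_ge M : [/\ (wid M <= chi M)%N, (Om (Om M) <= chi M)%N &
  (Om (Om (wid M)) <= chi M)%N].
Proof.
have H : (Om (Om (wid M)) <= chi M)%N.
  by rewrite chiE; apply: leq_trans (growth_infl gEx _) (growth_infl gOm _).
split=> //; apply: leq_trans H.
  by apply: leq_trans (growth_infl gOm _) (growth_infl gOm _).
do 2!apply: (growth_mono gOm); exact: (growth_infl growth_wid).
Qed.

Lemma psi_ge N : (Om N <= psi N)%N.
Proof.
rewrite psiE; apply: (growth_mono gOm).
by apply: leq_trans (growth_infl gEx N) _; apply: leq_trans (iter_infl _ _ gth).
Qed.

(** The case distinction on the leading coefficient, carried out in ideals: the colon ideal of [J]
    by [rho2 * s] contains that coefficient and [E], hence [rho1 * s]. So [J] contains a divisor of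
    the square of [rho1 * rho2 * s]. *)
Lemma elim_combine (E : seq {poly A}) (g s : {poly A}) rho1 rho2 X :
  (r < X)%N -> bB X rho1 -> bB X rho2 -> bP b X s -> g \in E ->
  (forall e, e \in E -> bP b X e) ->
  (forall J, nideal (bP b) X J -> (forall e,
    e \in [:: (lead_coef g)%:P, g - (lead_coef g)%:P * 'X^((size g).-1) & rem g E] ->
    J e) -> J (kapP rho1 * s)) ->
  (forall J, nideal (bP b) X J -> (forall e, e \in E -> J e) ->
    J (kapP rho2 * ((lead_coef g)%:P * s))) ->
  forall J, nideal (bP b) (Om (Om X)) J -> (forall e, e \in E -> J e) ->
    J (kapP (rho1 * rho2) * s).
Proof.
move=> r_X b1 b2 bs Eg bE HA HB J iJ JE.
have bOmP := @bOm _ gG _ _ _ Pok; have bMP := @bMi _ gG _ _ _ Pok.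
have blP := @blift _ gG _ _ _ Pok.
set l := (lead_coef g)%:P in HA HB.
have bl : bP b X l by apply: (bpolyC Aok); apply: blead (bE g Eg).
have bk1 : bP b X (kapP rho1) by apply: (bpolyC Aok); apply: bkap.
have bk2 : bP b X (kapP rho2) by apply: (bpolyC Aok); apply: bkap.
set k1 := kapP rho1 in HA bk1 *; set k2 := kapP rho2 in HB bk2 *.
rewrite rmorphM -/k1 -/k2; move: k1 k2 l bk1 bk2 bl HA HB => k1 k2 l bk1 bk2 bl HA HB.
have bc := bMP 0%N X _ _ r_X bk2 bs.
have bcO := bOmP 1%N X _ isT bc.
have le_X := growth_infl gOm X; have le_XX := growth_infl gOm (Om X).
have r_O := leq_trans r_X le_X.
have iJO := nideal_mono Pok le_XX iJ.
have Jl : J (l * (k2 * s)).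
  rewrite mulrCA; apply: HB => //; apply: (nideal_mono Pok _ iJ).
  exact: leq_trans le_X le_XX.
have bXe : bP b X 'X^((size g).-1).
  apply: (bpolyXn Aok); have := (bE g Eg).1.
  by case: (size g) => // n; rewrite ltnS.
have iJ' := nideal_mono Pok le_X (nideal_colon gG Pok r_O bcO iJ).
have Jk1 : J (k1 * s * (k2 * s)).
  apply: (HA (fun x => J (x * (k2 * s))) iJ') => e.
  rewrite !inE => /or3P[/eqP->|/eqP->|Ee] //.
    rewrite mulrBl [l * _]mulrC -mulrA -mulNr.
    have bl2 := bMP 1%N X _ _ r_X (blP 1%N X _ bl) bc.
    have bg2 := bMP 1%N X _ _ r_X (blP 1%N X _ (bE g Eg)) bc.
    have bNX := bNi gG Pok (k := 0) bXe.
    have bt := bMP 2%N X _ _ r_X (bSi gG Pok bNX) bl2.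
    apply: (nidealD iJO); [exact: (bOmP 2%N X _ isT bg2) | exact: (bOmP 3%N X _ isT bt)| |].
      rewrite mulrC; apply: (nidealM iJO) (JE g Eg); first exact: bcO.
      exact: (bOmP 0%N X _ isT (bE g Eg)).
    apply: (nidealM iJO) Jl; first exact: (bOmP 1%N X _ isT bNX).
    exact: (bOmP 2%N X _ isT bl2).
  have {}Ee := mem_rem Ee.
  rewrite mulrC; apply: (nidealM iJO) (JE e Ee); first exact: bcO.
  exact: (bOmP 0%N X _ isT (bE e Ee)).
have b12 := bMP 0%N X _ _ r_X bk1 bk2.
have b12s := bMP 1%N X _ _ r_X b12 (blP 1%N X _ bs).
apply: (nidealR iJO); first exact: (bOmP 2%N X _ isT b12s).
have -> : k1 * k2 * s * (k1 * k2 * s) = (k1 * k2) * (k1 * s * (k2 * s)) by ring.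
apply: (nidealM iJO) Jk1; first exact: (bOmP 1%N X _ isT b12).
by apply: (bOmP 2%N X _ isT); apply: (bMP 1%N X _ _ r_X) => //; exact: (bMP 0%N X _ _ r_X bk1 bs).
Qed.

Lemma size_drop_lead (g : {poly A}) : g != 0 ->
  (size (g - (lead_coef g)%:P * 'X^((size g).-1))%R < size g)%N.
Proof.
move=> g_n0; have g_gt0 : (0 < size g)%N by rewrite size_poly_gt0.
rewrite -{2}(prednK g_gt0) ltnS; apply/leq_sizeP => i le_i.
rewrite coefB coefCM coefXn; case: eqP => [->|ne]; first by rewrite mulr1 subrr.
rewrite mulr0 subr0 nth_default // -(prednK g_gt0) ltn_neqAle le_i andbT.
by apply/eqP => E; apply: ne.
Qed.

(** Induction on the sum of the degrees. Let [g] be nonconstant of least degree, with leading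
    coefficient [l]. Where [l] vanishes, [g] loses its leading term; elsewhere [g] shortens another
    nonconstant polynomial, or there is none and [elim_terminal] applies. *)
Lemma elim_inner K N (E : seq {poly A}) (s : {poly A}) :
  (r < N)%N -> (iter K.+1 psi N <= N1)%N -> (size E <= N)%N ->
  (forall e, e \in E -> bP b N e) -> bP b N s ->
  (\sum_(e <- E) (size e).-1 <= K)%N -> no_points kapP E s ->
  eliminant (bP b) kapP E s (iter K.+1 chi M1).
Proof.
elim: K N E s => [|K IHK] N E s r_N le_N1 sE bE bs meas np.
all: have [/allP E1|] := boolP (all (fun e : {poly A} => (size e <= 1)%N) E).
1,3: have le_N : (N <= N1)%N := leq_trans (iter_infl _ _ growth_psi) le_N1.
1,2: have [rho [n0 br Jr]] := elim_coefs sE le_N bE bs E1 (no_points_coef E1 np).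
1,2: have [le1 _ le3] := chi_ge M1.
1,2: exists rho; split=> //.
1: exact: (bok_mono Bok le1 br).
1: by move=> J iJ JE; apply: Jr => //; apply: (nideal_mono Pok le3 iJ).
1: apply: (bok_mono Bok _ br); rewrite iterSr.
1: by apply: leq_trans le1 (iter_infl _ _ growth_chi).
1: move=> J iJ JE; apply: Jr => //; apply: (nideal_mono Pok _ iJ).
1: by rewrite iterSr; apply: leq_trans le3 (iter_infl _ _ growth_chi).
  case/allPn => e Ee; rewrite -ltnNge => e_gt1; move: meas.
  rewrite (big_rem e) //= leqn0 addn_eq0 => /andP[].
  by rewrite -subn1 subn_eq0 leqNgt e_gt1.
move=> E_n1; have exE : exists n, has (fun e : {poly A} => (1 < size e)%N && (size e == n)) E.
  case/allPn: E_n1 => e Ee; rewrite -ltnNge => e_gt1; exists (size e).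
  by apply/hasP; exists e; rewrite // e_gt1 eqxx.
have [n /hasP[g Eg /andP[g_gt1 /eqP gn]] min_n] := ex_minnP exE.
have {min_n gn} min_g e : e \in E -> (1 < size e)%N -> (size g <= size e)%N.
  by move=> Ee e_gt1; rewrite gn; apply: min_n; apply/hasP; exists e; rewrite // e_gt1 eqxx.
have bg := bE g Eg; set l := lead_coef g.
have g_n0 : g != 0 by rewrite -size_poly_gt0 (ltn_trans _ g_gt1).
have bOmP := @bOm _ gG _ _ _ Pok; have bMP := @bMi _ gG _ _ _ Pok.
have blP := @blift _ gG _ _ _ Pok.
have le_NO := growth_infl gOm N; have le_Op := psi_ge N.
have le_Np := leq_trans le_NO le_Op.
have N_gt0 : (0 < N)%N by apply: leq_trans r_N.
(* The case of a vanishing leading coefficient has one equation more, so the level has to grow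
   strictly. *)
have lt_Np : (N < psi N)%N.
  apply: leq_trans le_Op; apply: leq_trans (iter_Phi_Om gG (k := 1) N isT).
  apply: leq_trans (Phi_double N_gt0); rewrite -addnA; clear; lia.
have r_p := leq_trans r_N le_Np.
rewrite iterSr in le_N1.
have bl : bP b N l%:P by apply: (bpolyC Aok); apply: blead.
have bE' e : e \in E -> bP b (psi N) e by move=> Ee; apply: (bok_mono Pok le_Np (bE e Ee)).
have bs' := bok_mono Pok le_Np bs.
have le_cX : (chi M1 <= iter K.+1 chi M1)%N by rewrite iterSr; apply: iter_infl growth_chi.
have le_M1X : (M1 <= iter K.+1 chi M1)%N by apply: iter_infl growth_chi.
have le_pN1 : (psi N <= N1)%N := leq_trans (iter_infl _ _ growth_psi) le_N1.
rewrite iterS; move: (iter K.+1 chi M1) le_cX le_M1X IHK => X le_cX le_M1X IHK.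
have le_pX : (psi N <= X)%N := leq_trans le_pN1 (leq_trans le_NM1 le_M1X).
have le_NX : (N <= X)%N := leq_trans le_Np le_pX.
set e := (size g).-1; have le_eN : (e <= N)%N.
  by rewrite /e; have := bg.1; case: (size g) => // n; rewrite ltnS.
have remE := perm_mem (perm_to_rem Eg).
have sub_rem f : f \in rem g E -> f \in E by apply: mem_rem.
set g0 := g - l%:P * 'X^e.
have sg0 : (size g0 < size g)%N.
  exact: size_drop_lead.
have bg0 : bP b (psi N) g0.
  apply: (bok_mono Pok le_Op).
  have bXe := bpolyXn Aok le_eN.
  have bn := bNi gG Pok (bMP 0%N N _ _ r_N bl bXe).
  exact: (bOmP 3%N N _ isT (bDi gG Pok (blP 2%N N _ bg) bn)).
set EA := [:: l%:P, g0 & rem g E].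
have [rho1 [n01 br1 J1]] : eliminant (bP b) kapP EA s X.
  apply: (IHK (psi N)) => //.
  - by rewrite /= size_rem // prednK ?(leq_ltn_trans sE) //; case: (E) Eg.
  - move=> f; rewrite !inE => /or3P[/eqP->|/eqP->|/sub_rem] //; last exact: bE'.
    exact: (bok_mono Pok le_Np bl).
  - rewrite !big_cons size_polyC; move: meas; rewrite (big_rem g) //=.
    have -> : ((l != 0) : nat).-1 = 0%N by case: (_ != _).
    by move: sg0 g_gt1; move: (\sum_(_ <- _) _)%N (size g) (size g0); clear; lia.
  move=> L h inj_h hE; apply: np => // f; rewrite remE inE => /orP[/eqP->|f_rem].
    rewrite -[g](subrK (l%:P * 'X^e)) -/g0 rmorphD rmorphM.
    have -> : h g0 = 0 by apply: hE; rewrite !inE eqxx orbT.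
    have -> : h l%:P = 0 by apply: hE; rewrite !inE eqxx.
    by rewrite mul0r addr0.
  by apply: hE; rewrite !inE f_rem !orbT.
have [rho2 [n02 br2 J2]] : exists rho : B, [/\ rho != 0, bB X rho &
    forall J, nideal (bP b) X J -> (forall e, e \in E -> J e) ->
      J (kapP rho * (l%:P * s))].
  have [/allP rem1|] := boolP (all (fun e : {poly A} => (size e <= 1)%N) (rem g E)).
    have [rho [n0 br Jr]] := elim_terminal r_N le_pN1 sE bE bs Eg g_gt1 rem1 np.
    have [le1 _ _] := chi_ge M1.
    exists rho; split=> //; first exact: (bok_mono Bok (leq_trans le1 le_cX) br).
    by move=> J iJ JE; apply: Jr => //; apply: (nideal_mono Pok le_cX iJ).
  case/allPn => g' g'_rem; rewrite -ltnNge => g'_gt1.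
  have Eg' := sub_rem _ g'_rem; have le_gg' := min_g g' Eg' g'_gt1.
  have lt_u := reduce_leading g_n0 le_gg'.
  set u := _ - _ in lt_u.
  have le_e' : (size g' - size g <= N)%N.
    rewrite leq_subLR; apply: leq_trans (bE g' Eg').1 _.
    by rewrite -[X in (X <= _)%N]add1n leq_add2r; apply: ltnW.
  have bu : bP b (Om N) u.
    have bl' : bP b N (lead_coef g')%:P.
      by apply: (bpolyC Aok); apply: blead; apply: bE.
    have t1 := bMP 0%N N _ _ r_N bl (bE g' Eg').
    have t2 := bMP 1%N N _ _ r_N (bMP 0%N N _ _ r_N bl' (bpolyXn Aok le_e')) (blP 1%N N _ bg).
    exact: (bOmP 4%N N _ isT (bDi gG Pok (blP 2%N _ _ t1) (bNi gG Pok t2))).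
  have bls : bP b (psi N) (l%:P * s).
    exact: (bok_mono Pok le_Op (bOmP 1%N N _ isT (bMP 0%N N _ _ r_N bl bs))).
  have remE' := perm_mem (perm_to_rem Eg').
  have Eg_rem : g \in rem g' E.
    have [gg'|ng] := eqVneq g g'; last by move: Eg; rewrite remE' inE (negPf ng).
    by move: g'_rem; rewrite gg'.
  have [rho [n0 br Jr]] : eliminant (bP b) kapP (u :: rem g' E) (l%:P * s) X.
    apply: (IHK (psi N)) => //.
    - by rewrite /= size_rem // prednK ?(leq_trans sE) //; case: (E) Eg.
    - move=> f; rewrite inE => /orP[/eqP->|/mem_rem]; last exact: bE'.
      exact: (bok_mono Pok le_Op bu).
    - rewrite big_cons; move: meas; rewrite (big_rem g') //=.
      by move: lt_u g'_gt1; move: (\sum_(_ <- _) _)%N (size g') (size u); clear; lia.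
    move=> L h inj_h hE; rewrite rmorphM; apply/eqP; rewrite mulf_eq0.
    have [//|hl] := eqVneq (h l%:P) 0; rewrite /=; apply/eqP; apply: np => // f.
    rewrite remE' inE => /orP[/eqP->|f_rem]; last by apply: hE; rewrite inE f_rem orbT.
    have hu : h u = 0 by apply: hE; rewrite inE eqxx.
    have hg : h g = 0 by apply: hE; rewrite inE Eg_rem orbT.
    move/eqP: hu; rewrite /u rmorphB !rmorphM hg mulr0 subr0 mulf_eq0 (negPf hl).
    by move/eqP.
  exists rho; split=> // J iJ JE; apply: Jr => // f.
  rewrite inE => /orP[/eqP->|/mem_rem]; last exact: JE.
  have le_NOX : (Om N <= X)%N := leq_trans le_Op le_pX.
  have iJO := nideal_mono Pok le_NOX iJ.
  have bl' : bP b N (lead_coef g')%:P.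
    by apply: (bpolyC Aok); apply: blead; apply: bE.
  have t1 := bMP 0%N N _ _ r_N bl (bE g' Eg').
  have t2 := bMP 0%N N _ _ r_N bl' (bpolyXn Aok le_e').
  have t3 := bMP 1%N N _ _ r_N (bNi gG Pok (k := 0) (bpolyXn Aok le_e')) (blP 1%N _ _ bl').
  have t4 := bMP 2%N N _ _ r_N t3 (blP 2%N N _ bg).
  have -> : u = l%:P * g' + (- 'X^(size g' - size g) * (lead_coef g')%:P) * g.
    by rewrite /u -/l mulNr [_ * 'X^_]mulrC mulNr.
  apply: (nidealD iJO).
  - exact: (bOmP 1%N N _ isT t1).
  - exact: (bOmP 3%N N _ isT t4).
  - apply: (nidealM iJO) (JE g' Eg'); first exact: (bOmP 0%N N _ isT bl).
    exact: (bOmP 0%N N _ isT (bE g' Eg')).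
  apply: (nidealM iJO) (JE g Eg); first exact: (bOmP 2%N N _ isT t3).
  exact: (bOmP 0%N N _ isT bg).
have [_ le_chi _] := chi_ge X.
exists (rho1 * rho2); split; first by rewrite mulf_neq0.
  have rB_X := leq_trans rB_M1 le_M1X.
  have := @bOm _ gG _ _ _ Bok 1 X _ isT (@bMi _ gG _ _ _ Bok 0 X _ _ rB_X br1 br2).
  by apply: (bok_mono Bok); apply: leq_trans (growth_infl gOm _) le_chi.
move=> J iJ; apply: (elim_combine _ br1 br2 (bok_mono Pok le_NX bs) Eg _ J1 J2).
- exact: leq_trans r_N le_NX.
- by move=> f Ef; apply: (bok_mono Pok le_NX (bE f Ef)).
exact: (nideal_mono Pok le_chi iJ).
Qed.

Lemma eliminable_poly N : (r < N)%N -> (iter (N * N.+1).+1 psi N <= N1)%N ->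
  eliminable (bP b) kapP N (iter (N * N.+1).+1 chi M1).
Proof.
move=> r_N le_N1 E s sE bE bs np; apply: (elim_inner r_N le_N1 sE bE bs _ np).
have {bE} : forall e, e \in E -> ((size e).-1 <= N)%N.
  by move=> e /bE[se _]; case: (size e) se => // n; rewrite ltnS.
move=> bE; apply: (@leq_trans (size E * N)%N); last by rewrite leq_mul.
elim: E {sE np} bE => [|e E IHE] le_E; first by rewrite big_nil.
rewrite big_cons mulSn leq_add //; first by rewrite le_E // mem_head.
by apply: IHE => f Ef; apply: le_E; rewrite inE Ef orbT.
Qed.

End Step.

(** * Elimination of all variables *)

(** [hh] passes the level of the system down to the ring with one variable less, [cc] passes the
    level of the ideal back up. The iteration counts dominate the degree sum of [N] polynomials of
    degree at most [N]. *)
Definition hh N := iter (N * N.+1).+1 psi N.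
Definition cc N := iter (N * N.+1).+1 chi N.

Lemma growth_hh : growth hh.
Proof.
apply: growth_iter growth_psi _ growth_id.
by apply: (growth_comp growth_S); apply: growth_mulS; exact: growth_id.
Qed.

Lemma growth_cc : growth cc.
Proof.
apply: growth_iter growth_chi _ growth_id.
by apply: (growth_comp growth_S); apply: growth_mulS; exact: growth_id.
Qed.

Definition elim_bound N := iter N cc (Phi (iter N hh N)).

Lemma growth_elim_bound : growth elim_bound.
Proof.
apply: growth_iter growth_cc growth_id _; apply: (growth_comp gPhi).
by apply: growth_iter growth_hh growth_id growth_id.
Qed.

Lemma eliminable_MP n N : (n + rB < N)%N ->
  eliminable (bMP bB n) (cst n) N (iter n cc (Phi (iter n hh N))).
Proof.
elim: n N => [|n IHn] N le_N; first exact: eliminable_base (ltnW le_N).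
have le_Nh := growth_infl growth_hh N.
have lt_h : (n + rB < hh N)%N by apply: leq_trans le_Nh; apply: ltnW.
have := IHn (hh N) lt_h; rewrite iterS [iter n.+1 hh N]iterSr.
have : (hh N <= iter n cc (Phi (iter n hh (hh N))))%N.
  apply: leq_trans (iter_infl n _ growth_cc); apply: leq_trans (growth_infl gPhi _).
  exact: iter_infl growth_hh.
move: (iter n cc _) => M1 le_hM1 elimn E s sE bE bs np.
have lt_M1 := leq_trans lt_h le_hM1.
have rB_M1 : (rB <= M1)%N by apply: leq_trans (ltnW lt_M1); apply: leq_addl.
have bk N' c : bB N' c -> bMP bB n N' (cst n c) by apply: (bcst gG n Bok).
have [rho [n0 br Jr]] := eliminable_poly (bok_MP gG n Bok) bk elimn le_hM1 lt_M1
  rB_M1 (ltnW le_N) (leqnn _) sE bE bs np.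
have le : (iter (N * N.+1).+1 chi M1 <= cc M1)%N.
  have le_NM := leq_trans le_Nh le_hM1.
  by apply: iter_mono growth_chi _ _; rewrite // ltnS leq_mul.
exists rho; split=> //; first exact: (bok_mono Bok le br).
move=> J iJ JE; apply: Jr => //.
exact: (nideal_mono (bok_MP gG n.+1 Bok) le iJ).
Qed.

Lemma elimination n N : (n + rB < N)%N ->
  eliminable (bMP bB n) (cst n) N (elim_bound N).
Proof.
move=> le_N E s sE bE bs np; have le_nN : (n <= N)%N.
  by apply: leq_trans (leq_addr rB n) (ltnW le_N).
have [rho [n0 br Jr]] := eliminable_MP le_N sE bE bs np.
have le : (iter n cc (Phi (iter n hh N)) <= elim_bound N)%N.
  apply: iter_mono => //; first exact: growth_cc.
  by apply: (growth_mono gPhi); apply: iter_mono growth_hh _ _.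
exists rho; split=> //; first exact: (bok_mono Bok le br).
move=> J iJ JE; apply: Jr => //.
exact: (nideal_mono (bok_MP gG n Bok) le iJ).
Qed.

End Elim.

(** * Bounded prime factors *)

Section Divisibility.
Variable R : idomainType.
Implicit Types x y p : R.

Definition divides x y := exists c, y = c * x.

Definition prime_elt p := [/\ p != 0, p \isn't a GRing.unit &
  forall x y, divides p (x * y) -> divides p x \/ divides p y].

Definition has_factorization x := exists (s : seq R) (u : R),
  [/\ forall p, p \in s -> prime_elt p, u \is a GRing.unit & x = u * \prod_(p <- s) p].

Lemma has_factorizationM x y :
  has_factorization x -> has_factorization y -> has_factorization (x * y).
Proof.
move=> [s [u [sP uu ->]]] [t [w [tP wu ->]]]; exists (s ++ t), (u * w); split.
- by move=> p; rewrite mem_cat => /orP[/sP|/tP].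
- by rewrite unitrM uu.
by rewrite big_cat /= mulrACA.
Qed.

Lemma has_factorization_prime p : prime_elt p -> has_factorization p.
Proof.
move=> Pp; exists [:: p], 1; split; rewrite ?unitr1 ?big_seq1 ?mul1r //.
by move=> q; rewrite inE => /eqP->.
Qed.

Lemma dividesM p x y : divides p x -> divides p (y * x).
Proof. by move=> [c ->]; exists (y * c); rewrite mulrA. Qed.

Lemma dividesD p x y : divides p x -> divides p y -> divides p (x + y).
Proof. by move=> [c ->] [d ->]; exists (c + d); rewrite mulrDl. Qed.

Lemma dividesB p x y : divides p x -> divides p y -> divides p (x - y).
Proof. by move=> [c ->] [d ->]; exists (c - d); rewrite mulrBl. Qed.

Lemma divides_sum p I (s : seq I) (P : pred I) F :
  (forall i, P i -> divides p (F i)) -> divides p (\sum_(i <- s | P i) F i).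
Proof.
move=> H; elim/big_rec: _ => [|i x Pi]; first by exists 0; rewrite mul0r.
by apply: dividesD; apply: H.
Qed.

Lemma prime_divides_prod p (s : seq R) : prime_elt p ->
  divides p (\prod_(q <- s) q) -> exists2 q, q \in s & divides p q.
Proof.
move=> [p0 pU pP]; elim: s => [|q s IH]; first rewrite big_nil => -[c E].
  by case/negP: pU; apply/unitrPr; exists c; rewrite mulrC -E.
rewrite big_cons => /pP[pq|/IH[t st pt]]; first by exists q; rewrite ?mem_head.
by exists t; rewrite // inE st orbT.
Qed.
End Divisibility.

(** * Gauss's lemma and unique factorization *)

Definition ufd (R : idomainType) := forall x : R, x != 0 -> has_factorization x.

Lemma ufd_field (k : fieldType) : ufd k.
Proof.
move=> x x0; exists [::], x; split=> //; first by rewrite unitfE.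
by rewrite big_nil mulr1.
Qed.

Section PolyUFD.
Variable R : idomainType.
Implicit Types f g h a b : {poly R}.

Lemma divides_polyC (p : R) f :
  divides p%:P f <-> forall i, divides p f`_i.
Proof.
split=> [[c ->] i|H]; first by rewrite coefMC; exists c`_i.
rewrite -(coefK f) poly_def; apply: divides_sum => i _.
by have [c ->] := H i; exists (c *: 'X^i); rewrite -!mul_polyC polyCM -!mulrA [_ * 'X^_]mulrC.
Qed.

Lemma first_not_divides (p : R) f : ~ divides p%:P f ->
  exists i, ~ divides p f`_i /\ forall j, (j < i)%N -> divides p f`_j.
Proof.
move=> ndv; apply: NNPP => nex; apply: ndv; apply/divides_polyC => i.
elim/ltn_ind: i => i IH; apply: NNPP => ndv; apply: nex; exists i.
by split.
Qed.

Lemma prime_polyC (p : R) : prime_elt p -> prime_elt p%:P.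
Proof.
move=> [p0 pU pP]; split; first by rewrite polyC_eq0.
  by rewrite poly_unitE coefC eqxx negb_and pU orbT.
move=> f g dv; apply: NNPP => /not_or_and[nf ng].
have [i [ni Hi]] := first_not_divides nf; have [j [nj Hj]] := first_not_divides ng.
have /(divides_polyC p)/(_ (i + j)%N) := dv; rewrite coefM.
have lt_i : (i < (i + j).+1)%N by rewrite ltnS leq_addr.
rewrite (bigD1 (Ordinal lt_i)) //= addKn => dvs.
have : divides p (f`_i * g`_j).
  rewrite -[_ * _](addrK (\sum_(l < (i + j).+1 | l != Ordinal lt_i) f`_l * g`_(i + j - l))).
  apply: dividesB => //; apply: divides_sum => l; rewrite -val_eqE /= neq_ltn.
  case/orP => lt_l; first by rewrite mulrC; apply: dividesM; apply: Hi.
  by apply: dividesM; apply: Hj; have := ltn_ord l; lia.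
by case/pP.
Qed.

Hypothesis R_ufd : ufd R.

(** A prime factor of [c] stays prime as a constant polynomial, so it divides [g] or [h] and is
    cancelled there without changing sizes. *)
Lemma strip_constant c f g h : c != 0 -> c%:P * f = g * h ->
  exists g' h', [/\ f = g' * h', size g' = size g & size h' = size h].
Proof.
move=> c0; have [s [u [sP uU ->]]] := R_ufd c0.
elim: s g h {c0 c} sP => [|p s IH] g h sP.
  rewrite big_nil mulr1 => E; exists (u^-1%:P * g), h; split=> //.
    by rewrite -mulrA -E mulrA -polyCM mulVr // mul1r.
  by rewrite mul_polyC size_scale // invr_eq0; apply: contraTneq uU => ->; rewrite unitr0.
rewrite big_cons mulrCA polyCM -mulrA => E.
have pP : prime_elt p by apply: sP; rewrite mem_head.
have p0 : p%:P != 0 by rewrite polyC_eq0; case: pP.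
have {}IH := fun g h => IH g h (fun q sq => sP q (mem_behead (s := p :: s) sq)).
have sz a : size (a * p%:P) = size a.
  by rewrite mulrC mul_polyC size_scale //; case: pP.
have [_ _ /(_ g h)[]] := prime_polyC pP.
- by rewrite -E; exists ((u * \prod_(q <- s) q)%:P * f); rewrite mulrC.
- move=> [g1 g1E]; have /IH : (u * \prod_(q <- s) q)%:P * f = g1 * h.
    by apply: (mulfI p0); rewrite E g1E; ring.
  by rewrite g1E sz.
- move=> [h1 h1E]; have /IH : (u * \prod_(q <- s) q)%:P * f = g * h1.
    by apply: (mulfI p0); rewrite E h1E; ring.
  by rewrite h1E sz.
Qed.

Definition primitive f := forall p : R, prime_elt p -> ~ divides p%:P f.

Lemma strip_primitive c f a b : c != 0 -> primitive f -> c%:P * a = b * f ->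
  divides f a.
Proof.
move=> c0 prf; have [s [u [sP uU ->]]] := R_ufd c0.
elim: s b {c0 c} sP => [|p s IH] b sP.
  rewrite big_nil mulr1 => E; exists (u^-1%:P * b).
  by rewrite -mulrA -E mulrA -polyCM mulVr // mul1r.
rewrite big_cons mulrCA polyCM -mulrA => E.
have pP : prime_elt p by apply: sP; rewrite mem_head.
have p0 : p%:P != 0 by rewrite polyC_eq0; case: pP.
have {}IH := fun b => IH b (fun q sq => sP q (mem_behead (s := p :: s) sq)).
have [_ _ /(_ b f)[]] := prime_polyC pP.
- by rewrite -E; exists ((u * \prod_(q <- s) q)%:P * a); rewrite mulrC.
- move=> [b1 b1E]; apply: (IH b1).
  by apply: (mulfI p0); rewrite E b1E; ring.
by move/prf; case.
Qed.

(** The last hypothesis is irreducibility over the fraction field with denominators cleared. There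
    the gcd of [f] and [a] is constant or associated to [f]; [strip_primitive] brings the resulting
    divisibility back to polynomials over [R]. *)
Lemma primitive_irreducible_prime f : (1 < size f)%N -> primitive f ->
  (forall c g h, c != 0 -> c%:P * f = g * h -> (size g <= 1)%N || (size h <= 1)%N) ->
  prime_elt f.
Proof.
move=> f_gt1 prf irr; have f0 : f != 0 by rewrite -size_poly_gt0 (ltn_trans _ f_gt1).
split=> //; first by rewrite poly_unitE negb_and neq_ltn f_gt1 orbT.
move=> a b [q E].
have pdv x : Pdiv.Idomain.dvdp f x -> divides f x.
  move/Pdiv.Idomain.dvdpP => [[c r] /= c0]; rewrite -mul_polyC.
  exact: strip_primitive.
have f_ab : Pdiv.Idomain.dvdp f (a * b).
  by apply/Pdiv.Idomain.dvdpP; exists (1, q); rewrite ?oner_eq0 // scale1r.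
set d := Pdiv.Idomain.gcdp f a.
have /Pdiv.Idomain.dvdpP[[c e] /= c0] : Pdiv.Idomain.dvdp d f by apply: dvdp_gcdl.
rewrite -mul_polyC => cE; case/orP: (irr _ _ _ c0 cE) => [se|sd].
  left; apply: pdv.
  have e0 : e != 0.
    apply: contraNneq f0 => e0; move/eqP: cE; rewrite e0 mul0r mulf_eq0 polyC_eq0.
    by rewrite (negPf c0).
  have /dvdp_trans : Pdiv.Idomain.dvdp f d.
    apply/Pdiv.Idomain.dvdpP; exists (e`_0, c%:P).
      by move: e0; rewrite (size1_polyC se) polyC_eq0 coefC eqxx.
    by rewrite /= -mul_polyC -(size1_polyC se).
  by apply; apply: dvdp_gcdr.
right; apply: pdv.
have cop : Pdiv.Idomain.coprimep f a.
  rewrite /Pdiv.Idomain.coprimep eqn_leq sd size_poly_gt0.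
  by rewrite gcdp_eq0 (negPf f0).
by rewrite -(Gauss_dvdpr _ cop).
Qed.

Lemma has_factorizationC (c : R) : c != 0 -> has_factorization c%:P.
Proof.
move=> c0; have [s [u [sP uU ->]]] := R_ufd c0.
exists (map polyC s), u%:P; split.
- by move=> p /mapP[q sq ->]; apply/prime_polyC/sP.
- have u0 : u != 0 by apply: contraTneq uU => ->; rewrite unitr0.
  by rewrite poly_unitE coefC eqxx uU size_polyC u0.
by rewrite polyCM rmorph_prod big_map.
Qed.

(** Induction on the size, then on the number of prime factors of the leading coefficient, for
    splitting off prime constants. When none divides [f], it is primitive, and it is either prime
    or, by [strip_constant], a product of shorter polynomials. *)
Lemma ufd_poly : ufd ({poly R} : idomainType).
Proof.
move=> f; move: {2}(size f) (leqnn (size f)) => n.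
elim: n f => [|n IH] f le_n f0; first by rewrite leqn0 size_poly_eq0 (negPf f0) in le_n.
have [s1|f_gt1] := leqP (size f) 1.
  rewrite (size1_polyC s1); apply: has_factorizationC.
  by rewrite (size1_polyC s1) polyC_eq0 in f0.
have l0 : lead_coef f != 0 by rewrite lead_coef_eq0.
have [t [u [tP uU lE]]] := R_ufd l0; move: {2}(size t) (erefl (size t)) => m.
elim: m t u f le_n f0 f_gt1 {l0} tP uU lE => [|m IHm] t u f le_n f0 f_gt1 tP uU lE szt.
all: case: (classic (exists2 p, p \in t & divides p%:P f)) => [[p tp [g fE]]|nt].
- by move: szt tp => /size0nil->.
2: {
  have Pp := tP p tp; have p0 : p != 0 by case: Pp.
  have szg : size g = size f by rewrite fE mulrC mul_polyC size_scale.
  rewrite fE; apply: has_factorizationM; last first.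
    exact/has_factorization_prime/prime_polyC.
  apply: (IHm (rem p t) u); rewrite ?szg //.
  - by apply: contraNneq f0 => g0; rewrite fE g0 mul0r.
  - by move=> q /mem_rem; apply: tP.
  - apply: (mulIf p0); have := lE; rewrite {1}fE lead_coefM lead_coefC => ->.
    by rewrite (perm_big _ (perm_to_rem tp)) big_cons mulrCA mulrC.
  by rewrite size_rem // szt.
}
(* A prime constant dividing [f] divides its leading coefficient and is thus associated to some [q]
   in [t], which would divide [f] too. *)
all: have prf : primitive f.
1,3: move=> p Pp dv; have [p0 pU _] := Pp.
1,2: have : divides p (lead_coef f) by move/divides_polyC: dv; apply.
1,2: rewrite lE; case: (Pp) => _ _ /[apply] -[[c uE]|/(prime_divides_prod Pp)[q tq [c qE]]].
1,3: by case/negP: pU; move: uU; rewrite uE unitrM => /andP[].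
1,2: have [q0 qU /(_ c p)] := tP q tq.
1,2: case; first by exists 1; rewrite mul1r -qE.
1,3: move=> [d cE]; case/negP: pU; apply/unitrPr; exists d.
1,2: by apply: (mulfI q0); rewrite mulr1 {2}qE cE; ring.
1,2: move=> [d pE]; apply: nt; exists q => //; have [e fE] := dv.
1,2: by exists (e * d%:P); rewrite -mulrA -polyCM -pE.
all: case: (classic (forall c g h, c != 0 -> c%:P * f = g * h ->
  (size g <= 1)%N || (size h <= 1)%N)) => [irr|red].
1,3: by apply: has_factorization_prime; apply: primitive_irreducible_prime.
all: have [c [g [h [c0 E sg sh]]]] : exists c g h,
  [/\ c != 0, c%:P * f = g * h, (1 < size g)%N & (1 < size h)%N].
1,3: apply: NNPP => nex; apply: red => c g h c0 E; apply: contraT.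
1,2: by rewrite negb_or -!ltnNge => /andP[sg sh]; case: nex; exists c, g, h.
all: have [g' [h' [fE sg' sh']]] := strip_constant c0 E.
all: have g'0 : g' != 0 by rewrite -size_poly_gt0 sg' ltnW.
all: have h'0 : h' != 0 by rewrite -size_poly_gt0 sh' ltnW.
all: have szf : size f = (size g' + size h').-1 by rewrite fE size_mul.
all: by rewrite fE; apply: has_factorizationM; apply: IH => //; lia.
Qed.
End PolyUFD.

Lemma ufd_MP (R : idomainType) n : ufd R -> ufd (MP R n).
Proof. by move=> Ru; elim: n => //= n IH; apply: ufd_poly. Qed.

(* The value at 0 is junk, normalised to 0. *)
Record isdeg (R : idomainType) (v : R -> nat) : Prop := IsDeg {
  deg0 : v 0 = 0%N;
  degD : forall x y, (v (x + y)%R <= maxn (v x) (v y))%N;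
  degM : forall x y, x != 0 -> y != 0 -> v (x * y) = (v x + v y)%N
}.

(** * Total degree *)

Section Degree.
Variables (R : idomainType) (v : R -> nat).
Hypothesis vdeg : isdeg v.

Lemma degN x : v (- x) = v x.
Proof.
have [->|x0] := eqVneq x 0; first by rewrite oppr0.
have n1 : (- 1 : R) != 0 by rewrite oppr_eq0 oner_eq0.
have v1 : v 1 = 0%N.
  by have := degM vdeg (oner_neq0 R) (oner_neq0 R); rewrite mulr1; move: (v 1) => a; lia.
have vn1 : v (- 1) = 0%N.
  by have := degM vdeg n1 n1; rewrite mulrNN mulr1 v1; move: (v (- 1)) => a; lia.
by rewrite -mulN1r (degM vdeg) // vn1.
Qed.

Definition tdeg (p : {poly R}) := \max_(i < size p | p`_i != 0) (v p`_i + i).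

Lemma tdeg_leq (p : {poly R}) m :
  (tdeg p <= m)%N <-> forall i, p`_i != 0 -> (v p`_i + i <= m)%N.
Proof.
split=> [/bigmax_leqP H i pi0|H]; last by apply/bigmax_leqP => i; apply: H.
have lt_i : (i < size p)%N.
  by rewrite ltnNge; apply: contra pi0 => le_i; rewrite nth_default.
exact: (H (Ordinal lt_i)).
Qed.

Lemma tdeg_coef (p : {poly R}) i : p`_i != 0 -> (v p`_i + i <= tdeg p)%N.
Proof. by have /tdeg_leq H := leqnn (tdeg p); apply: H. Qed.

Lemma tdeg_attained (p : {poly R}) : p != 0 -> exists i, [/\ p`_i != 0, (v p`_i + i = tdeg p)%N
  & forall j, (i < j)%N -> p`_j != 0 -> (v p`_j + j < tdeg p)%N].
Proof.
move=> p0; pose P i := (p`_i != 0) && (v p`_i + i == tdeg p)%N.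
have exP : exists i, P i.
  have : (0 < #|[pred i : 'I_(size p) | (p`_i != 0)%R]|)%N.
    have lt : ((size p).-1 < size p)%N by rewrite prednK // size_poly_gt0.
    apply/card_gt0P; exists (Ordinal lt); rewrite inE /= -/(lead_coef p).
    by rewrite lead_coef_eq0.
  move/(eq_bigmax_cond (fun i : 'I_(size p) => (v p`_i + i)%N)) => [i pi0 E].
  by exists i; rewrite /P; move: pi0; rewrite inE => -> /=; rewrite /tdeg E.
have ubP i : P i -> (i <= size p)%N.
  by case/andP => pi0 _; apply: contraR pi0; rewrite -ltnNge => /ltnW/(nth_default 0)->.
have [i /andP[pi0 /eqP Ei] max_i] := ex_maxnP exP ubP.
exists i; split=> // j lt_ij pj0; rewrite ltn_neqAle tdeg_coef // andbT.
by apply/negP => Ej; have := max_i j; rewrite /P pj0 Ej leqNgt lt_ij => /(_ isT).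
Qed.

Definition vsmall m x := (x == 0) || (v x < m)%N.

Lemma vsmallD m x y : vsmall m x -> vsmall m y -> vsmall m (x + y).
Proof.
rewrite /vsmall; case: eqVneq => [->|_] /=; first by rewrite add0r.
move=> vx; case: eqVneq => [->|_] /= vy; first by rewrite addr0 vx orbT.
by apply/orP; right; apply: leq_ltn_trans (degD vdeg _ _) _; rewrite gtn_max vx.
Qed.

Lemma vsmall_sum m I (s : seq I) (P : pred I) F :
  (forall i, P i -> vsmall m (F i)) -> vsmall m (\sum_(i <- s | P i) F i).
Proof.
move=> H; elim/big_rec: _ => [|i x Pi]; first by rewrite /vsmall eqxx.
by apply: vsmallD; apply: H.
Qed.

Lemma vsmallM m x y :
  (x != 0 -> y != 0 -> (v x + v y < m)%N) -> vsmall m (x * y).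
Proof.
move=> H; rewrite /vsmall mulf_eq0; case: eqVneq H => //= x0 H.
by case: eqVneq H => //= y0 H; rewrite (degM vdeg) // H.
Qed.

(** For multiplicativity, let [i] and [j] be the largest exponents at which the total degrees of [p]
    and [q] are attained. Among the products that make up the coefficient [i + j] of [p * q], the
    one of the coefficients [i] and [j] has strictly larger degree than the others. *)
Lemma isdeg_tdeg : isdeg tdeg.
Proof.
split=> [|p q|p q p0 q0].
- by apply/eqP; rewrite -leqn0; apply/tdeg_leq => i; rewrite coef0 eqxx.
- apply/tdeg_leq => i; rewrite coefD => pq0.
  have [pi0|pi0] := eqVneq p`_i 0.
    by rewrite pi0 add0r in pq0 *; apply: leq_trans (tdeg_coef pq0) (leq_maxr _ _).
  have [qi0|qi0] := eqVneq q`_i 0.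
    by rewrite qi0 addr0; apply: leq_trans (tdeg_coef pi0) (leq_maxl _ _).
  apply: leq_trans (leq_add (degD vdeg _ _) (leqnn i)) _.
  rewrite addn_maxl geq_max.
  by rewrite (leq_trans (tdeg_coef pi0) (leq_maxl _ _)) (leq_trans (tdeg_coef qi0) (leq_maxr _ _)).
apply/eqP; rewrite eqn_leq; apply/andP; split.
  apply/tdeg_leq => n; set m := (tdeg p + tdeg q)%N.
  have : vsmall (m.+1 - n)%N (p * q)`_n.
    rewrite coefM; apply: vsmall_sum => i _; apply: vsmallM => /tdeg_coef pi /tdeg_coef qi.
    have lt_i := ltn_ord i; move: pi qi lt_i; rewrite /m.
    move: (v p`_i) (v q`_(n - i)) (tdeg p) (tdeg q) => a b c d.
    by move: (nat_of_ord i) => i'; lia.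
  rewrite /vsmall => /orP[/eqP->|]; first by rewrite eqxx.
  by move: (v _) => a; lia.
have [i [pi0 Ei Hi]] := tdeg_attained p0; have [j [qj0 Ej Hj]] := tdeg_attained q0.
set m := (v p`_i + v q`_j)%N.
have lt_i : (i < (i + j).+1)%N by rewrite ltnS leq_addr.
pose o := \sum_(l < (i + j).+1 | l != Ordinal lt_i) p`_l * q`_(i + j - l).
have so : vsmall m o.
  apply: vsmall_sum => l; rewrite -val_eqE /= neq_ltn => lt_l.
  apply: vsmallM => pl0 ql0; rewrite /m.
  have H1 := tdeg_coef pl0; have H2 := tdeg_coef ql0; have H3 := ltn_ord l.
  case/orP: lt_l => lt_l.
    have lt_j : (j < i + j - l)%N by lia.
    have H4 := Hj _ lt_j ql0; move: Ei Ej H1 H3 H4 lt_l; clear.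
    move: (v p`_i) (v q`_j) (v p`_l) (v q`_(i + j - l)) (tdeg p) (tdeg q).
    by move: (nat_of_ord l) => l' a b c d e f; lia.
  have H4 := Hi _ lt_l pl0; move: Ei Ej H2 H3 H4 lt_l; clear.
  move: (v p`_i) (v q`_j) (v p`_l) (v q`_(i + j - l)) (tdeg p) (tdeg q).
  by move: (nat_of_ord l) => l' a b c d e f; lia.
have E : (p * q)`_(i + j) = p`_i * q`_j + o.
  by rewrite coefM (bigD1 (Ordinal lt_i)) //= addKn.
have nt : ~~ vsmall m (p * q)`_(i + j).
  apply/negP => st; have : vsmall m (p`_i * q`_j).
    rewrite -[_ * _](addrK o) -E; apply: vsmallD => //.
    by rewrite /vsmall oppr_eq0 degN.
  by rewrite /vsmall mulf_eq0 (negPf pi0) (negPf qj0) /= (degM vdeg) // ltnn.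
move: nt; rewrite /vsmall negb_or -leqNgt => /andP[n0 le_m].
have := tdeg_coef n0; rewrite -Ei -Ej; move: le_m; rewrite /m.
by move: (v _) (v p`_i) (v q`_j) (tdeg _) => a b c d; lia.
Qed.
End Degree.

(** * Kronecker substitution and the size of factors *)

Section Factor.
Variables (G : nat -> nat) (gG : growth G).
Variables (k : fieldType) (kb : nat -> k -> Prop).
Notation bok := (bok G).
Notation Phi := (Phi G).
Hypothesis kok : bok kb 0.
Hypothesis k_factor : forall N (p : {poly k}), p != 0 -> bP kb N p ->
  exists s : seq {poly k}, [/\ (size s <= G N)%N,
    forall q, q \in s -> irreducible_poly q /\ bP kb (G N) q & p %= \prod_(q <- s) q].

(* [kron D] is Kronecker's substitution on elements of degree less than [D]. *)
Record kronecker (R : idomainType) (b : nat -> R -> Prop) (r : nat)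
    (cR : k -> R) (v : R -> nat) (D : nat) : Prop := Kronecker {
  kron : exists kap : {rmorphism R -> {poly k}},
   [/\ forall x, (v x < D)%N -> (size (kap x) <= D ^ r)%N,
       forall x N, (v x < D)%N -> b N x -> forall i, kb N (kap x)`_i,
       forall x N, (v x < D)%N -> (D <= N.+1)%N -> (forall i, kb N (kap x)`_i) -> b N x,
       forall c, kap (cR c) = c%:P &
       forall x, (v x < D)%N -> kap x = 0 -> x = 0]
}.

Record tower (R : idomainType) (b : nat -> R -> Prop) (r : nat)
    (cR : k -> R) : Prop := Tower {
  tower_ok : bok b r;
  tower_cst : forall N c, kb N c -> b N (cR c);
  tower_kron : exists v : R -> nat,
    [/\ isdeg v, forall c, v (cR c) = 0%N, forall N x, b N x -> (v x <= r * N)%N &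
        forall D, (0 < D)%N -> kronecker b r cR v D]
}.

Lemma tower_base : tower kb 0 idfun.
Proof.
split=> //; exists (fun=> 0%N); split=> // D D_gt0; split.
exists (@polyC k : {rmorphism k -> {poly k}}); split=> //.
- by move=> x _; rewrite expn0 size_polyC_leq1.
- by move=> x N _ bx i; rewrite coefC; case: eqP => // _; apply: (bok0 kok).
- by move=> x N _ _ /(_ 0%N); rewrite coefC eqxx.
- by move=> x _ /eqP; rewrite polyC_eq0 => /eqP.
Qed.

(** Blocks of width [w] do not overlap, so an index splits into the number of its block and the
    position within it. *)
Lemma coef_digits (w m : nat) (F : nat -> {poly k}) : (0 < w)%N ->
  (forall i, (i < m)%N -> (size (F i) <= w)%N) ->
  forall n, (\sum_(i < m) F i * ('X^w) ^+ i)`_n =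
    if (n %/ w < m)%N then (F (n %/ w)%N)`_(n %% w) else 0.
Proof.
move=> w_gt0 sF n; rewrite coef_sum.
have H (i : 'I_m) : (F i * ('X^w) ^+ i)`_n =
    if (i == n %/ w :> nat)%N then (F (n %/ w)%N)`_(n %% w) else 0.
  rewrite -exprM coefMXn; have nE := divn_eq n w.
  have lt_m := ltn_pmod n w_gt0.
  case: eqP => [iE|ne].
    rewrite iE ifN; last by rewrite -leqNgt {2}nE mulnC leq_addr.
    by rewrite {2}nE mulnC addKn.
  case: ltnP => // le_n; rewrite nth_default //; apply: leq_trans (sF i (ltn_ord i)) _.
  have : (i < n %/ w)%N.
    by rewrite ltn_neqAle; apply/andP; split; [apply/eqP | rewrite leq_divRL // mulnC].
  move=> lt_i; rewrite leq_subRL // -mulnSr mulnC.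
  by rewrite -leq_divRL.
case: ifP => [lt_nm|ge_nm].
  rewrite (bigD1 (Ordinal lt_nm)) //= [X in X + _](H (Ordinal lt_nm)) eqxx big1 ?addr0 // => i.
  by rewrite H -val_eqE /= => /negPf->.
by rewrite big1 // => i _; rewrite H; case: eqP => // E; rewrite -E ltn_ord in ge_nm.
Qed.

Lemma tower_poly (R : idomainType) b r (cR : k -> R) :
  tower b r cR -> tower (bP b) r.+1 (fun c => (cR c)%:P).
Proof.
case=> Rok Rcst [v [vdeg vC vb vK]]; split; first exact: bok_poly.
  by move=> N c /Rcst bc; apply: (bpolyC Rok bc).
exists (tdeg v); split; first exact: isdeg_tdeg.
- move=> c; apply/eqP; rewrite -leqn0; apply/tdeg_leq => i /=.
  by rewrite coefC; case: (i =P 0%N) => [->|_]; [rewrite vC | rewrite eqxx].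
- move=> N p [sp bp]; apply/tdeg_leq => i pi0; rewrite mulSn addnC leq_add //.
    rewrite -ltnS; apply: leq_trans sp; rewrite ltnNge.
    by apply: contra pi0 => le_i; rewrite nth_default.
  exact: vb.
move=> D D_gt0; have [[kap [k1 k2 k3 k4 k5]]] := vK D D_gt0; split.
set w := (D ^ r)%N in k1; have w_gt0 : (0 < w)%N by rewrite expn_gt0 D_gt0.
pose kap' : {rmorphism {poly R} -> {poly k}} := pev kap 'X^w.
have vcoef (p : {poly R}) i : (tdeg v p < D)%N -> (v (p`_i)%R < D)%N.
  move=> lt_D; have [->|pi0] := eqVneq p`_i 0; first by rewrite (deg0 vdeg).
  by apply: leq_ltn_trans lt_D; apply: leq_trans (tdeg_coef v pi0); apply: leq_addr.
have szD (p : {poly R}) : (tdeg v p < D)%N -> (size p <= D)%N.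
  move=> lt_D; have [->|p0] := eqVneq p 0; first by rewrite size_poly0.
  have p_gt0 : (0 < size p)%N by rewrite size_poly_gt0.
  rewrite -(prednK p_gt0); apply: leq_ltn_trans lt_D.
  have l0 : p`_(size p).-1 != 0 by rewrite -/(lead_coef p) lead_coef_eq0.
  by apply: leq_trans (tdeg_coef v l0); apply: leq_addl.
have kapE (p : {poly R}) n : (tdeg v p < D)%N -> (kap' p)`_n = (kap p`_(n %/ w))`_(n %% w).
  move=> lt_D; rewrite -[kap' p]/(pev kap 'X^w p) pev_sum.
  rewrite (coef_digits (F := fun i => kap p`_i)) //; last by move=> i _; apply/k1/vcoef.
  case: ltnP => // le_n.
  by rewrite [p`_(n %/ w)]nth_default // rmorph0 coef0.
exists kap'; split.
- move=> p lt_D; apply/leq_sizeP => n le_n; rewrite kapE //.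
  rewrite (_ : p`_(n %/ w) = 0) ?rmorph0 ?coef0 //; apply: nth_default.
  by apply: leq_trans (szD _ lt_D) _; rewrite leq_divRL // -expnS.
- by move=> p N lt_D [sp bp] n; rewrite kapE //; apply: k2 => //; apply: vcoef.
- move=> p N lt_D le_N H; split; first exact: leq_trans (szD _ lt_D) le_N.
  move=> i; apply: k3 => //; first exact: vcoef.
  move=> j; have [lt_j|le_j] := ltnP j w; last first.
    by rewrite nth_default; [apply: (bok0 kok) | apply: leq_trans le_j; apply/k1/vcoef].
  by have := H (i * w + j)%N; rewrite kapE // divnMDl // divn_small // addn0 modnMDl modn_small.
- by move=> c; rewrite -[kap' _]/(pev kap 'X^w (cR c)%:P) pevC k4.
- move=> p lt_D kp0; apply/polyP => i; rewrite coef0; apply: k5; first exact: vcoef.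
  apply/polyP => j; rewrite coef0; have [lt_j|le_j] := ltnP j w; last first.
    by rewrite nth_default //; apply: leq_trans le_j; apply/k1/vcoef.
  have := kapE p (i * w + j)%N lt_D.
  by rewrite kp0 coef0 divnMDl // divn_small // addn0 modnMDl modn_small.
Qed.

Lemma dvdp_prod_irreducible (s : seq {poly k}) (p : {poly k}) :
  (forall q, q \in s -> irreducible_poly q) -> p %| \prod_(q <- s) q ->
  exists2 t, subseq t s & p %= \prod_(q <- t) q.
Proof.
elim: s p => [|q s IH] p irr.
  by rewrite big_nil => p1; exists [::]; rewrite ?big_nil // -size_poly_eq1 -dvdp1.
rewrite big_cons => dv; have irr_q := irr q (mem_head _ _).
have q0 := irredp_neq0 irr_q.
have {}IH := fun p => IH p (fun t st => irr t (mem_behead (s := q :: s) st)).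
have [q_p|q_np] := boolP (q %| p).
  have /dvdpP[p' pE] := q_p.
  have /IH[t ts pt] : p' %| \prod_(q <- s) q.
    by rewrite pE [p' * q]mulrC dvdp_mul2l in dv.
  exists (q :: t); first by rewrite /= eqxx.
  by rewrite big_cons pE [p' * q]mulrC eqp_mul2l.
rewrite -irreducible_poly_coprime // coprimep_sym in q_np.
rewrite Gauss_dvdpr // in dv; have [t ts pt] := IH _ dv.
by exists t => //; apply: subseq_trans ts (subseq_cons s q).
Qed.

(** Dominates [D ^ r], the size after substitution, for [D = r * N + 1] and [r <= N]. *)
Definition kbound N := finf (N * N.+1)%N.
Definition factor_bound N := iter (G (kbound N)) Phi (G (kbound N)).

Lemma growth_kbound : growth kbound.
Proof.
apply: (growth_comp growth_finf).
by apply: growth_mulS; exact: growth_id.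
Qed.

Lemma growth_factor_bound : growth factor_bound.
Proof.
have g1 := growth_comp gG growth_kbound.
exact: (growth_iter (growth_Phi gG) g1 g1).
Qed.

(** The substitution turns [y] into a constant times a product of some of the irreducible factors
    that the splitting algorithm finds, and it preserves coefficients in both directions. The factor
    [c] removes the constant. *)
Lemma factor_bounded (R : idomainType) b r (cR : k -> R) N x y z :
  tower b r cR -> (r <= N)%N -> (0 < N)%N -> x != 0 -> b N x -> x = z * y ->
  exists2 c, c != 0 & b (factor_bound N) (cR c * y).
Proof.
case=> Rok Rcst [v [vdeg vC vb vK]] le_r N_gt0 x0 bx xE.
have y0 : y != 0 by apply: contraNneq x0 => y0; rewrite xE y0 mulr0.
have z0 : z != 0 by apply: contraNneq x0 => z0; rewrite xE z0 mul0r.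
set D := (r * N).+1; have vx : (v x < D)%N by rewrite ltnS vb.
have vy : (v y < D)%N.
  by apply: leq_ltn_trans vx; rewrite xE (degM vdeg) // leq_addl.
have [[kap [k1 k2 k3 k4 k5]]] := vK D isT.
set M := kbound N.
have le_DM : (D ^ r <= M)%N.
  rewrite /M /kbound /finf; apply: (@leq_trans ((N * N.+1).+2 ^ r)).
    case: (r) => // r'; rewrite leq_exp2r // /D.
    apply: leqW; rewrite ltnS; apply: leq_mul => //; exact: leqW.
  rewrite leq_exp2l //; apply: leq_trans le_r _; apply: leqW.
  by apply: leq_pmulr.
have le_NM : (N <= M)%N := growth_infl growth_kbound N.
have kx0 : kap x != 0 by apply: contraNneq x0 => /k5->.
have bkx : bP kb M (kap x).
  split; first by apply: leq_trans (k1 x vx) _; apply: leqW.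
  by move=> i; apply: (bok_mono kok le_NM); apply: k2.
have [s [ss irr xs]] := k_factor kx0 bkx.
have dv : kap y %| \prod_(q <- s) q.
  by rewrite -(eqp_dvdr _ xs) xE rmorphM dvdp_mull.
have [t ts yt] := dvdp_prod_irreducible (fun q sq => (irr q sq).1) dv.
have [[c1 c2] /= /andP[c10 c20] E] : exists2 c : k * k, (c.1 != 0) && (c.2 != 0) &
    c.1 *: kap y = c.2 *: \prod_(q <- t) q.
  by case/eqpP: yt => c cP E; exists c.
exists (c1 / c2); first by rewrite mulf_neq0 ?invr_eq0.
have kE : kap (cR (c1 / c2) * y) = \prod_(q <- t) q.
  rewrite rmorphM k4 mul_polyC mulrC -scalerA E scalerA mulVf // scale1r.
  by [].
have cRn0 c : c != 0 -> cR c != 0.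
  by move=> c0; apply: contraNneq c0 => E0; have := k4 c; rewrite E0 rmorph0 => /esym/eqP; rewrite polyC_eq0.
have vcy : (v (cR (c1 / c2) * y)%R < D)%N.
  by rewrite (degM vdeg) ?vC //; apply: cRn0; rewrite mulf_neq0 ?invr_eq0.
have le_G : (M <= factor_bound N)%N.
  apply: leq_trans (growth_infl gG M) _; apply: iter_infl; exact: growth_Phi.
apply: k3 => //.
  apply: leq_trans (_ : M.+1 <= _)%N; last by rewrite ltnS.
  rewrite ltnS; apply: leq_trans (growth_infl growth_finf _).
  by apply: leq_mul => //; apply: leqW.
have Pok := bok_poly gG kok.
have b_all q : q \in t -> bP kb (G M) q.
  by move=> tq; case: (irr q (mem_subseq ts tq)).
have st : (size t <= G M)%N by apply: leq_trans ss; apply: size_subseq.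
rewrite kE; have : bP kb (iter (size t) Phi (G M)) (\prod_(q <- t) q).
  elim: (t) b_all => [|q u IHu] bu; first by rewrite big_nil; apply: (bok1 Pok).
  rewrite big_cons iterS; apply: (bM gG Pok).
  - apply: leq_trans (iter_infl _ _ (growth_Phi gG)).
    apply: leq_trans (growth_infl gG M); apply: leq_trans le_NM; exact: N_gt0.
  - apply: (bok_mono Pok (iter_infl _ _ (growth_Phi gG))); apply: bu; exact: mem_head.
  by apply: IHu => p up; apply: bu; rewrite inE up orbT.
case=> _ bt i; apply: (bok_mono kok _ (bt i)).
by apply: iter_mono => //; exact: growth_Phi.
Qed.

Lemma tower_MP (R : idomainType) b r (cR : k -> R) n :
  tower b r cR -> tower (bMP b n) (n + r) (fun c => cst n (cR c)).
Proof.
move=> tR; elim: n => [|n IH]; first exact: tR.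
exact: (tower_poly IH).
Qed.
End Factor.

(** * Generic linear projections *)

Section PevTheory.
Variables (R S : comNzRingType).

Lemma pev_comp (g : {rmorphism R -> S}) z (p q : {poly R}) :
  pev g z (p \Po q) = pev g (pev g z q) p.
Proof. by rewrite !pevE map_comp_poly horner_comp. Qed.

Lemma pev_uniq (h : {rmorphism {poly R} -> S}) (g : {rmorphism R -> S}) z :
  (forall c, h c%:P = g c) -> h 'X = z -> h =1 pev g z.
Proof.
move=> hC hX p; elim/poly_ind: p => [|p c IH]; first by rewrite !rmorph0.
by rewrite !rmorphD !rmorphM /= IH hC hX pevC pevX.
Qed.

Lemma eq_pev (g g' : {rmorphism R -> S}) z p : g =1 g' -> pev g z p = pev g' z p.
Proof. by move=> E; rewrite !pevE; congr (_.[_]); apply: eq_map_poly. Qed.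

Lemma pev_deriv (g : {rmorphism R -> S}) z p :
  pev g z p^`() = \sum_(i < size p) g p`_i * z ^+ i.-1 *+ i.
Proof.
have [->|p0] := eqVneq p 0; first by rewrite deriv0 rmorph0 size_poly0 big_ord0.
have p_gt0 : (0 < size p)%N by rewrite size_poly_gt0.
rewrite -(prednK p_gt0) big_ord_recl /= mulr0n add0r pevE.
rewrite (@horner_coef_wide _ (size p).-1); last first.
  apply: leq_trans (size_poly _ _) _; exact: (leq_trans (size_poly _ _)).
apply: eq_bigr => i _; rewrite coef_map /= coef_deriv raddfMn /=.
by rewrite mulrnAl.
Qed.
End PevTheory.

Lemma rmorph_pev (R S T : comNzRingType) (h : {rmorphism S -> T})
    (g : {rmorphism R -> S}) (g' : {rmorphism R -> T}) z z' p :
  (forall c, h (g c) = g' c) -> h z = z' -> h (pev g z p) = pev g' z' p.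
Proof.
move=> hC hz; pose h' : {rmorphism {poly R} -> T} := (h \o pev g z : {rmorphism _ -> _}).
by apply: (pev_uniq (h := h')) => [c|]; rewrite /h' /= ?pevC ?pevX.
Qed.

Section Coefs.

Fixpoint mcoefs (R : idomainType) n : MP R n -> seq R :=
  if n is n'.+1 return MP R n -> seq R
  then fun p => flatten [seq @mcoefs R n' c | c <- polyseq (p : {poly MP R n'})]
  else fun p => [:: p].
Arguments mcoefs {R} n p.

Lemma mcoefs_eq0 (R S : idomainType) (f : {rmorphism R -> S}) n p :
  MPmap f n p = 0 <-> forall c, c \in mcoefs n p -> f c = 0.
Proof.
elim: n p => [|n IH] p /=.
  by split=> [fp0 c|H]; [rewrite inE => /eqP-> | apply: H; rewrite mem_head].
split=> [fp0 c /flattenP[s /mapP[q /(nthP 0)[i _ <-] ->]]|H].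
  by apply: (IH _).1; have /polyP/(_ i) := fp0; rewrite coef_map coef0.
apply/polyP => i; rewrite coef_map coef0 /=.
have [le_i|lt_i] := leqP (size (p : {poly _})) i; first by rewrite nth_default ?rmorph0.
apply/IH => c cp; apply: H; apply/flattenP; exists (mcoefs n p`_i) => //.
by apply: map_f; apply: mem_nth.
Qed.

Lemma bmcoefs (R : idomainType) (b : nat -> R -> Prop) n N p : bMP b n N p ->
  (size (mcoefs n p) <= N.+1 ^ n)%N /\ forall c, c \in mcoefs n p -> b N c.
Proof.
elim: n p => [|n IH] p /=.
  by move=> bp; split=> // c; rewrite inE => /eqP->.
move=> [sp bp]; split=> [|c /flattenP[s /mapP[q /(nthP 0)[i _ <-] ->]]]; last first.
  by apply: (IH _ _).2.
rewrite size_flatten /shape -map_comp expnS.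
apply: leq_trans (_ : size (p : {poly _}) * N.+1 ^ n <= _)%N; last by rewrite leq_mul2r sp orbT.
have : forall q, q \in polyseq (p : {poly MP R n}) -> (size (mcoefs n q) <= N.+1 ^ n)%N.
  by move=> q /(nthP 0)[i _ <-]; apply: (IH _ _).1.
elim: (polyseq _) => [|q s IHs] H; first by rewrite mul0n.
rewrite /= mulSn leq_add ?H ?mem_head //; apply: IHs => t ts.
by apply: H; rewrite inE ts orbT.
Qed.
End Coefs.
Arguments mcoefs {R} n p.

(** * Integrality up to denominators *)

Section Integral.
Variables (R : idomainType) (K : fieldType) (f : {rmorphism R -> K}).
Hypothesis f_inj : injective f.

Lemma integral_lead (p : {poly R}) y : p != 0 -> pev f y p = 0 ->
  integralOver f (f (lead_coef p) * y).
Proof.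
move=> p0 py0; set c := lead_coef p.
have c0 : c != 0 by rewrite lead_coef_eq0.
have fc0 : f c != 0 by apply: contraNneq c0 => E; apply/eqP/f_inj; rewrite rmorph0.
have p_gt0 : (0 < size p)%N by rewrite size_poly_gt0.
set e := (size p).-1; have szE : size p = e.+1 by rewrite prednK.
have e_gt0 : (0 < e)%N.
  rewrite lt0n; apply/eqP => e0; move: py0; rewrite pev_sum szE e0 big_ord1 expr0 mulr1.
  by move/eqP; rewrite -[p`_0](_ : c = _) ?(negPf fc0) // /c lead_coefE -/e e0.
(* The equation of [y] times [c ^+ e.-1], rewritten as a monic equation for [c * y]. *)
pose q := 'X^e + \poly_(i < e) (p`_i * c ^+ (e.-1 - i)).
exists q; first by rewrite monicE lead_coefDl ?lead_coefXn // size_polyXn ltnS size_poly.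
rewrite /root -pevE /q rmorphD /= rmorphXn /= pevX poly_def rmorph_sum /=.
have -> : (f c * y) ^+ e + \sum_(i < e) pev f (f c * y) (p`_i * c ^+ (e.-1 - i) *: 'X^i) =
    f c ^+ e.-1 * pev f y p.
  rewrite pev_sum szE big_ord_recr /= mulrDr addrC; congr (_ + _); last first.
    by rewrite exprMn -{1}(prednK e_gt0) exprSr -/c mulrA.
  rewrite mulr_sumr; apply: eq_bigr => i _.
  rewrite -mul_polyC rmorphM /= pevC rmorphXn /= pevX rmorphM rmorphXn exprMn.
  have -> : f c ^+ e.-1 = f c ^+ (e.-1 - i) * f c ^+ i.
    by rewrite -exprD subnK // -ltnS prednK.
  by ring.
by rewrite py0 mulr0.
Qed.

Lemma integral_unscale c y : c != 0 -> integralOver f (f c * y) ->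
  exists2 p : {poly R}, p != 0 & pev f y p = 0.
Proof.
move=> c0 [p mp rp]; exists (p \Po (c *: 'X)).
  by rewrite comp_poly_eq0 ?monic_neq0 // size_scale // size_polyX.
rewrite pev_comp -mul_polyC rmorphM /= pevC pevX.
by apply/eqP; apply: rp.
Qed.

Lemma integral_sum_scaled n (u : 'I_n -> R) (y : 'I_n -> K) :
  (forall i, exists2 c, c != 0 & integralOver f (f c * y i)) ->
  exists2 c, c != 0 & integralOver f (f c * \sum_(i < n) f (u i) * y i).
Proof.
elim: n u y => [|n IH] u y H.
  by exists 1; rewrite ?oner_eq0 // big_ord0 mulr0; apply: integral0.
have [c c0 Hc] := IH (fun i => u (widen_ord (leqnSn n) i)) _
  (fun i => H (widen_ord (leqnSn n) i)).
have [c' c'0 Hc'] := H ord_max.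
exists (c * c'); first by rewrite mulf_neq0.
rewrite big_ord_recr /=; set sm := \sum_(i < n) _ in Hc *.
have -> : f (c * c') * (sm + f (u ord_max) * y ord_max) =
   f c' * (f c * sm) + f (c * u ord_max) * (f c' * y ord_max).
  by rewrite !rmorphM; ring.
by apply: integral_add; apply: integral_mul => //; exact: integral_id.
Qed.
End Integral.

(** * Inseparability *)

Section Frobenius.
Variables (k : fieldType) (A : idomainType) (cA : {rmorphism k -> A}).

(** When the derivative vanishes, the characteristic is a prime dividing all exponents of [C], and
    [C] is a shorter polynomial in that power of the variable. The accumulated [q] is 1 or a power
    of the characteristic, so raising to it is additive. *)
Lemma frobenius_decomposition (C : {poly A}) : (1 < size C)%N ->
  exists (q : nat) (H : {poly A}), [/\ (0 < q)%N, C = H \Po 'X^q, H^`() != 0 &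
    forall (S : comNzRingType) (f : {rmorphism k -> S}) (x y : S),
      (x + y) ^+ q = x ^+ q + y ^+ q].
Proof.
move: {2}(size C) (leqnn (size C)) => n; elim: n C => [|n IH] C le_n C_gt1.
  by move: le_n; rewrite leqNgt (ltn_trans _ C_gt1).
have [d0|d0] := eqVneq C^`() 0; last first.
  by exists 1%N, C; split=> //; rewrite expr1 comp_polyXr.
have coef0 i : C`_i != 0 -> i%:R = 0 :> A.
  case: i => // i Ci0; have /polyP/(_ i) := d0; rewrite coef_deriv coef0 -[C`_i.+1 *+ _]mulr_natr.
  by move/eqP; rewrite mulf_eq0 (negPf Ci0) => /eqP.
have C0 : C != 0 by rewrite -size_poly_gt0 (ltn_trans _ C_gt1).
have l0 : C`_(size C).-1 != 0 by rewrite -/(lead_coef C) lead_coef_eq0.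
have m_gt0 : (0 < (size C).-1)%N by rewrite -subn1 subn_gt0.
have [p pA] : exists p, p \in [pchar A].
  by apply: (natf0_pchar m_gt0); apply/eqP/coef0.
have p_pr := pcharf_prime pA; have p_gt0 := prime_gt0 p_pr.
have p_dv i : C`_i != 0 -> (p %| i)%N by move/coef0/eqP; rewrite -(dvdn_pcharf pA).
pose C1 := \poly_(i < size C) C`_(i * p).
have CE : C = C1 \Po 'X^p.
  apply/polyP => i; rewrite coef_comp_poly_Xn // coef_poly.
  have [p_i|p_ni] := boolP (p %| i)%N; last first.
    by apply/eqP; apply: contraNT p_ni; apply: p_dv.
  rewrite divnK //; case: ltnP => // le_i; rewrite nth_default //.
  by apply: leq_trans le_i _; apply: leq_div.
have szE : (size C).-1 = ((size C1).-1 * p)%N.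
  by rewrite {1}CE size_comp_poly size_polyXn.
have C1_gt1 : (1 < size C1)%N.
  by rewrite -subn_gt0 subn1; move: m_gt0; rewrite szE muln_gt0 => /andP[].
have lt_C1 : (size C1 < size C)%N.
  have p_gt1 := prime_gt1 p_pr; move: szE m_gt0 C1_gt1.
  by move: (size C) (size C1) => a b; nia.
have [q [H [q_gt0 C1E H0 frob]]] := IH C1 (leq_trans lt_C1 le_n) C1_gt1.
exists (q * p)%N, H; split=> //; first by rewrite muln_gt0 q_gt0.
  by rewrite CE C1E -comp_polyA comp_Xn_poly -exprM mulnC.
move=> S f x y; rewrite !exprM (frob S f) exprDn_pchar //.
have pk : p \in [pchar k].
  rewrite inE p_pr /=; have /andP[_] := pA.
  by rewrite -(rmorph_nat cA) fmorph_eq0.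
by rewrite pnatE // (rmorph_pchar f).
Qed.
End Frobenius.

Section Shift.
Variable n : nat.

Definition shift_var (R : idomainType) (j i : nat) : {poly MP R n} :=
  (var n i)%:P + (if i == j then 'X else 0).

(** Taylor expansion in the variable [j]; the outer polynomial variable is the increment. *)
Definition shift (R : idomainType) j : {rmorphism MP R n -> {poly MP R n}} :=
  ev (polyC \o cst n : {rmorphism R -> {poly MP R n}}) (shift_var R j) n.

Lemma shift_map (R S : idomainType) (f : {rmorphism R -> S}) j c :
  shift S j (MPmap f n c) = map_poly (MPmap f n) (shift R j c).
Proof.
pose g1 : {rmorphism MP R n -> {poly MP S n}} := (shift S j \o MPmap f n : {rmorphism _ -> _}).
pose g2 : {rmorphism MP R n -> {poly MP S n}} :=
  (map_poly (MPmap f n) \o shift R j : {rmorphism _ -> _}).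
apply: (MP_eq (g := g1) (h := g2)) => [x|i lt_i]; rewrite /g1 /g2 /=.
  by rewrite MPmap_cst /shift !ev_cst /= map_polyC /= MPmap_cst.
rewrite MPmap_var /shift !ev_var // /shift_var rmorphD /= map_polyC /= MPmap_var.
by case: eqP => _; rewrite ?map_polyX ?rmorph0.
Qed.

Lemma shift_coef0 (R : idomainType) j c : (shift R j c)`_0 = c.
Proof.
pose g1 : {rmorphism MP R n -> MP R n} := (horner_eval 0 \o shift R j : {rmorphism _ -> _}).
rewrite -horner_coef0; apply: (MP_eq (g := g1) (h := idfun)) => [x|i lt_i]; rewrite /g1 /=.
  by rewrite /shift ev_cst /horner_eval /= hornerC.
rewrite /shift ev_var // /shift_var /horner_eval hornerD hornerC.
by case: eqP => _; rewrite ?hornerX ?horner0 addr0.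
Qed.

Lemma coef_shift_power (U : comNzRingType) (c : {poly U}) (W B : U) q i : (0 < q)%N ->
  (c * (W%:P + B%:P * 'X^q) ^+ i)`_q = c`_q * W ^+ i + c`_0 * (W ^+ i.-1 *+ i) * B.
Proof.
move=> q_gt0.
(* Terms from ['X^(q + q)] on cannot contribute and are collected in [Z]. *)
have [Z ->] : exists Z, (W%:P + B%:P * 'X^q) ^+ i =
    (W ^+ i)%:P + (W ^+ i.-1 * B *+ i)%:P * 'X^q + Z * 'X^(q + q).
  elim: i => [|i [Z IH]]; first by exists 0; rewrite !expr0 mulr0n !mul0r !addr0.
  exists (Z * (W%:P + B%:P * 'X^q) + (W ^+ i.-1 * B *+ i)%:P * B%:P).
  rewrite exprSr IH exprD; case: i {IH} => [|i].
    by rewrite /= mulr0n expr1 expr0 mulr1n mul1r; ring.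
  rewrite !exprSr /= [in RHS]mulrSr !polyCD !polyCM; ring.
rewrite mulrDr mulrDr !coefD coefMC mulrA coefMXn ltnn subnn coefMC mulrA coefMXn.
rewrite -[X in (X < _)%N]addn0 ltn_add2l q_gt0 addr0 -!mulrA; congr (_ + _ * _).
by rewrite mulrnAl.
Qed.
End Shift.

(** * Parametrisation by a generic linear form *)

Section Generic.
Variables (k : fieldType) (n d : nat) (tau : nat -> nat).
Hypothesis tau_lt : forall i, (i < d)%N -> (tau i < n)%N.

(* [Yring] is [k[t][u][y]], with [t_i] standing for the coordinate
   [x_(tau i)] and [y] for the generic linear form [sum_j u_j x_j]. *)
Notation Tring := (MP k d).
Notation Aring := (MP Tring n).
Definition Yring : idomainType := {poly Aring}.
Notation Xring := (MP k n).

Definition cY : {rmorphism k -> Yring} :=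
  (polyC \o (cst n \o cst d) : {rmorphism k -> {poly Aring}}).

Definition tau_subst : {rmorphism Tring -> Xring} :=
  ev (cst n) (fun i => var n (tau i)) d.

Definition generic_form : MP Xring n := \sum_(j < n) var n j * cst n (var n j).

Definition generic_subst : {rmorphism Yring -> MP Xring n} :=
  pev (MPmap tau_subst n) generic_form.

Section Point.
Variables (L : fieldType) (iota : {rmorphism k -> L}) (x : nat -> L).

Definition tau_ev : {rmorphism Tring -> L} := ev iota (fun i => x (tau i)) d.

Definition form_at : MP L n := \sum_(j < n) var n j * cst n (x j).

Definition generic_ev : {rmorphism Yring -> MP L n} := pev (MPmap tau_ev n) form_at.

Lemma generic_evE p : generic_ev p = MPmap (ev iota x n) n (generic_subst p).
Proof.
symmetry; apply: rmorph_pev => [c|].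
  pose g1 : {rmorphism Aring -> MP L n} :=
    (MPmap (ev iota x n) n \o MPmap tau_subst n : {rmorphism _ -> _}).
  apply: (MP_eq (g := g1) (h := MPmap tau_ev n)) => [t|i lt_i]; rewrite /g1 /=.
    rewrite !MPmap_cst; congr (cst n _).
    apply: ev_comp => [z|i lt_i]; first exact: ev_cst.
    by rewrite ev_var // tau_lt.
  by rewrite !MPmap_var.
rewrite /generic_form rmorph_sum; apply: eq_bigr => j _.
by rewrite rmorphM /= MPmap_var MPmap_cst ev_var.
Qed.

Lemma generic_ev_cY c : generic_ev (cY c) = cst n (iota c).
Proof.
rewrite -[generic_ev _]/(pev (MPmap tau_ev n) form_at (cst n (cst d c))%:P).
by rewrite pevC MPmap_cst /tau_ev ev_cst.
Qed.

Lemma generic_evC c : generic_ev (c%:P : {poly Aring}) = MPmap tau_ev n c.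
Proof. by rewrite -[LHS]/(pev (MPmap tau_ev n) form_at c%:P) pevC. Qed.
End Point.

Section Transfer.
Variables (C H : {poly Aring}) (q : nat).
Hypothesis q_gt0 : (0 < q)%N.
Hypothesis CE : C = H \Po 'X^q.
Hypothesis frob : forall (S : comNzRingType) (f : {rmorphism k -> S}) (x y : S),
  (x + y) ^+ q = x ^+ q + y ^+ q.

(** The derivative of [C] with respect to the [q]-th power of its variable; it replaces the ordinary
    derivative, which may be zero. *)
Definition sep_deriv : {poly Aring} := H^`() \Po 'X^q.

(** The contribution at order [q] of an increment of [u_j] that passes through the coefficients of
    [H]. *)
Definition shifted j : {poly Aring} :=
  \sum_(i < size H) ((shift n Tring j H`_i)`_q)%:P * 'X^(q * i).

(* The coefficient of [w^q] in [C(t, u + w e_j, y + w x_j) = 0]. *)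
Lemma shift_identity (L : fieldType) (iota : {rmorphism k -> L}) (x : nat -> L) j :
  (j < n)%N -> generic_ev iota x C = 0 ->
  generic_ev iota x (shifted j) + generic_ev iota x sep_deriv * cst n (x j) ^+ q = 0.
Proof.
move=> lt_j C0; set f := MPmap (tau_ev iota x) n; set w := form_at x.
pose S := shift n L j.
have gE p : generic_ev iota x p = pev f w p by [].
have Sw : S w = w%:P + (cst n (x j))%:P * 'X.
  rewrite /w /form_at rmorph_sum /=.
  transitivity (\sum_(i < n) ((var n i * cst n (x i))%:P +
     (if i == j :> nat then (cst n (x j))%:P * 'X else 0)) : {poly MP L n}).
    apply: eq_bigr => i _; rewrite rmorphM /= {1}/S /shift ev_var // /S /shift ev_cst /=.
    rewrite /shift_var mulrDl -polyCM; congr (_ + _).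
    by case: eqP => [->|_]; [rewrite mulrC | rewrite mul0r].
  rewrite big_split /= -rmorph_sum /=; congr (_ + _).
  rewrite (bigD1 (Ordinal lt_j)) //= eqxx big1 ?addr0 // => i.
  by rewrite -val_eqE /= => /negPf->.
pose iP : {rmorphism k -> {poly MP L n}} := (polyC \o (cst n \o iota) : {rmorphism _ -> _}).
have Swq : S w ^+ q = (w ^+ q)%:P + (cst n (x j) ^+ q)%:P * 'X^q.
  by rewrite Sw (frob iP) exprMn -!rmorphXn.
have SH c : S (f c) = map_poly f (shift n Tring j c) by rewrite /S /f shift_map.
have : S (generic_ev iota x C) = 0 by rewrite C0 rmorph0.
rewrite gE CE pev_comp rmorphXn /= pevX pev_sum rmorph_sum.
move/polyP/(_ q); rewrite coef0 coef_sum.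
under eq_bigr => i _ do rewrite rmorphM rmorphXn rmorphXn /= Swq SH coef_shift_power //
  !coef_map shift_coef0.
rewrite big_split /= => {}C0; rewrite -[RHS]C0; congr (_ + _).
  rewrite gE /shifted rmorph_sum; apply: eq_bigr => i _.
  by rewrite rmorphM rmorphXn /= pevC pevX exprM.
rewrite gE /sep_deriv pev_comp rmorphXn /= pevX pev_deriv mulr_suml.
by apply: eq_bigr => i _; rewrite mulrnAr.
Qed.

(* Up to a power of the derivative, the [q]-th power of [g(x)] is a polynomial
   in the parametrisation [(t, u, y)]. *)
Lemma transfer_power (g : Xring) : exists (m : nat) (P : Yring),
  forall (L : fieldType) (iota : {rmorphism k -> L}) (x : nat -> L),
    generic_ev iota x C = 0 ->
    generic_ev iota x P = generic_ev iota x sep_deriv ^+ m * cst n (ev iota x n g) ^+ q.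
Proof.
elim/MP_ind: g => [c|j lt_j|g1 g2 [m1 [P1 E1]] [m2 [P2 E2]]|g1 g2 [m1 [P1 E1]] [m2 [P2 E2]]].
- exists 0%N, (cY (c ^+ q)) => L iota x _.
  by rewrite expr0 mul1r ev_cst generic_ev_cY !rmorphXn.
- exists 1%N, (- shifted j) => L iota x /(shift_identity lt_j)/eqP.
  by rewrite addr_eq0 rmorphN expr1 ev_var // => /eqP->; rewrite opprK.
- exists (m1 + m2)%N, ((sep_deriv : Yring) ^+ m2 * P1 + (sep_deriv : Yring) ^+ m1 * P2).
  move=> L iota x C0; rewrite rmorphD !rmorphM !rmorphXn /= E1 // E2 // rmorphD.
  rewrite rmorphD (frob (cst n \o iota : {rmorphism k -> MP L n})) exprD; ring.
exists (m1 + m2)%N, (P1 * P2) => L iota x C0.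
by rewrite !rmorphM /= E1 // E2 // exprMn exprD; ring.
Qed.

Variables (L0 : fieldType) (iota0 : {rmorphism k -> L0}) (a : nat -> L0).
Hypothesis a_indep : injective (tau_ev iota0 a).
Hypothesis C_prime : prime_elt (C : Yring).
Hypothesis aC : generic_ev iota0 a C = 0.

Lemma generic_evC_eq0 c : generic_ev iota0 a (c%:P : {poly Aring}) = 0 -> c = 0.
Proof.
rewrite generic_evC => E; apply: (MPmap_inj a_indep); rewrite E.
by rewrite rmorph0.
Qed.

Lemma size_generic : (1 < size C)%N.
Proof.
rewrite ltnNge; apply/negP => sC; have [C0 _ _] := C_prime; case/eqP: C0.
move: aC; rewrite (size1_polyC sC) => /generic_evC_eq0 ->.
by rewrite polyC0.
Qed.

(** The resultant of [C] and [p] is a constant in the ideal they generate. The evaluation kills it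
    and is injective on constants, so it is 0; hence there is a common factor of positive degree,
    and [C] is prime. *)
Lemma generic_divides (p : Yring) : generic_ev iota0 a p = 0 -> divides (C : Yring) p.
Proof.
move=> p0; have C_gt1 := size_generic.
have [sp|p_gt1] := leqP (size (p : {poly Aring})) 1.
  move: p0; rewrite (size1_polyC sp) => /generic_evC_eq0 ->.
  by exists 0; rewrite mul0r.
have [[u v] /= _ E] := resultant_in_ideal C_gt1 p_gt1.
have res0 : resultant C p = 0.
  by apply: generic_evC_eq0; rewrite E rmorphD !rmorphM p0 aC !mulr0 addr0.
have := resultant_eq0 C p; rewrite res0 eqxx => /esym; set D := Pdiv.Idomain.gcdp C p => D_gt1.
have /Pdiv.Idomain.dvdpP[[c1 e] /= c10 E1] : Pdiv.Idomain.dvdp D C by apply: dvdp_gcdl.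
have /Pdiv.Idomain.dvdpP[[c2 f] /= c20 E2] : Pdiv.Idomain.dvdp D p by apply: dvdp_gcdr.
rewrite -mul_polyC in E1; rewrite -mul_polyC in E2.
have [C0 _ Cp] := C_prime.
have const_ndv (c : Aring) : c != 0 -> ~ divides (C : Yring) (c%:P : {poly Aring}).
  move=> c0 [g gE]; have g0 : g != 0.
    by apply: contraNneq c0 => g0; rewrite -polyC_eq0 gE g0 mul0r.
  have : (size (c%:P : {poly Aring}) <= 1)%N by apply: size_polyC_leq1.
  rewrite gE size_mul // -subn1 leq_subLR addn1 => le2.
  by have := size_poly_gt0 (g : {poly Aring}); rewrite g0 => g_gt0; move: le2 C_gt1 g_gt0; clear; lia.
have : divides (C : Yring) (e * D) by exists (c1%:P : {poly Aring}); rewrite -E1.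
case/Cp => [[e' eE]|[D' DE]].
  have : c1%:P = e' * D :> {poly Aring}.
    by apply: (mulIf C0); rewrite E1 eE; ring.
  move=> cE; have e'0 : e' != 0.
    by apply: contraNneq c10 => e'0; rewrite -polyC_eq0 cE e'0 mul0r.
  have D0 : D != 0 by rewrite -size_poly_gt0 (ltn_trans _ D_gt1).
  have : (size (c1%:P : {poly Aring}) <= 1)%N by apply: size_polyC_leq1.
  rewrite cE size_mul // -subn1 leq_subLR addn1 => le2.
  have := size_poly_gt0 (e' : {poly Aring}); rewrite e'0 => e_gt0.
  by move: le2 D_gt1 e_gt0; clear; lia.
have : divides (C : Yring) ((c2%:P : {poly Aring}) * p).
  by exists (f * D'); rewrite E2 DE mulrA.
by case/Cp => // /(const_ndv _ c20).
Qed.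

(** Otherwise [C] would divide a nonzero polynomial of smaller degree, by [generic_divides]. *)
Lemma sep_deriv_neq0 : H^`() != 0 -> generic_ev iota0 a sep_deriv != 0.
Proof.
move=> H'0; apply/negP => /eqP/generic_divides[g gE].
have [C0 _ _] := C_prime; have C_gt1 := size_generic.
have s0 : sep_deriv != 0.
  by rewrite /sep_deriv comp_poly_eq0 // size_polyXn ltnS.
have g0 : g != 0 by apply: contraNneq s0 => g0; rewrite gE g0 mul0r.
have : (size C <= size sep_deriv)%N.
  rewrite gE size_mul // -(prednK (_ : 0 < size g)%N) ?size_poly_gt0 //.
  by rewrite addSn /= leq_addl.
have H0 : H != 0 by apply: contraNneq H'0 => ->; rewrite deriv0.
have szC : (size C).-1 = ((size H).-1 * q)%N by rewrite CE size_comp_poly size_polyXn.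
have szS : (size sep_deriv).-1 = ((size H^`()).-1 * q)%N.
  by rewrite size_comp_poly size_polyXn.
have lt_H := lt_size_deriv H0.
have H'_gt0 : (0 < size H^`())%N by rewrite size_poly_gt0.
have s_gt0 : (0 < size sep_deriv)%N by rewrite size_poly_gt0.
have C_gt0 : (0 < size C)%N by apply: ltnW.
move: szC szS lt_H H'_gt0 s_gt0 C_gt0 q_gt0; clear.
move: (size C) (size H) (size sep_deriv) (size H^`()) => c h s h' E1 E2; nia.
Qed.

(** The polynomial that [transfer_power] attaches to [g] vanishes at [a], hence is a multiple of [C]
    and vanishes at [x]; the power of [sep_deriv] in it can be cancelled there. *)
Lemma determined (L : fieldType) (iota : {rmorphism k -> L}) (x : nat -> L) (g : Xring) :
  generic_ev iota x C = 0 -> generic_ev iota x sep_deriv != 0 ->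
  ev iota0 a n g = 0 -> ev iota x n g = 0.
Proof.
move=> xC xs ag; have [m [P PE]] := transfer_power g.
have /generic_divides[h hE] : generic_ev iota0 a P = 0.
  by rewrite PE // ag rmorph0 expr0n eqn0Ngt q_gt0 mulr0.
have := PE L iota x xC; rewrite hE rmorphM xC mulr0 => /esym/eqP.
rewrite mulf_eq0 expf_eq0 (negPf xs) andbF /= expf_eq0 q_gt0 /= => /eqP E.
by apply: (@cst_inj _ n); rewrite E rmorph0.
Qed.
End Transfer.
End Generic.

Lemma prime_factor_root (R S : idomainType) (f : {rmorphism R -> S}) (x : R) :
  ufd R -> x != 0 -> f x = 0 -> exists C, [/\ prime_elt C, divides C x & f C = 0].
Proof.
move=> R_ufd x0; have [s [u [sP uU ->]]] := R_ufd x x0 => {x x0}.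
rewrite rmorphM => /eqP; rewrite mulf_eq0 => /orP[/eqP fu|].
  have := rmorphV f uU; have := divrr uU => /(congr1 f).
  by rewrite rmorphM fu mul0r rmorph1 => /esym/eqP; rewrite oner_eq0.
elim: s sP => [|p s IH] sP; first by rewrite big_nil rmorph1 oner_eq0.
rewrite big_cons rmorphM mulf_eq0 => /orP[/eqP fp|fs].
  exists p; split=> //; first by apply: sP; rewrite mem_head.
  by exists (u * \prod_(q <- s) q); rewrite mulrCA mulrC.
have [|C [CP [c Cs] fC]] := IH _ fs; first by move=> q sq; apply: sP; rewrite inE sq orbT.
by exists C; split=> //; exists (c * p); rewrite mulrAC -Cs mulrAC mulrA.
Qed.

Lemma prime_scale (R : idomainType) (u C : R) :
  u \is a GRing.unit -> prime_elt C -> prime_elt (u * C).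
Proof.
move=> uU [C0 CU CP]; have u0 : u != 0 by apply: contraTneq uU => ->; rewrite unitr0.
have dvE x : divides (u * C) x <-> divides C x.
  split=> [[c ->]|[c ->]]; first by exists (c * u); rewrite mulrA.
  by exists (c * u^-1); rewrite mulrA mulrVK.
split; first by rewrite mulf_neq0.
  by rewrite unitrM uU.
by move=> x y /dvE /CP[] /dvE; [left | right].
Qed.

(** * Points determined by bounded polynomials *)

Section Determination.
Local Opaque Phi Om Ex theta Psi elim_bound factor_bound.
Variables (G : nat -> nat) (gG : growth G).
Variables (k : fieldType) (kb : nat -> k -> Prop).
Notation bok := (bok G).
Notation Phi := (Phi G).
Notation Psi := (Psi G).
Hypothesis kok : bok kb 0.
Hypothesis k_factor : forall N (p : {poly k}), p != 0 -> bP kb N p ->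
  exists s : seq {poly k}, [/\ (size s <= G N)%N,
    forall q, q \in s -> irreducible_poly q /\ bP kb (G N) q & p %= \prod_(q <- s) q].
Let gPhi := growth_Phi gG.
Let gPsi := growth_Psi gG.

(* Coordinates [x_(xi j)] for [j < m] are those of interest, among [n]; the
   coordinates [x_(xi (tau i))], [i < d], play the role of parameters. *)
Variables (n m d : nat) (xi tau : nat -> nat).
Hypothesis xi_lt : forall j, (j < m)%N -> (xi j < n)%N.
Hypothesis tau_lt : forall i, (i < d)%N -> (tau i < m)%N.

Notation Y := (Yring k m d).
Notation bY := (bP (bMP (bMP kb d) m)).
Notation rY := ((m + (d + 0)).+1).
Notation cYf := (cY k m d).

Lemma Yok : bok (bY : nat -> Y -> Prop) rY.
Proof. exact: (bok_poly gG (bok_MP gG m (bok_MP gG d kok))). Qed.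

Lemma b_cY N c : kb N c -> bY N (cYf c).
Proof.
move=> bc; apply: (bpolyC (bok_MP gG m (bok_MP gG d kok))).
by apply: (bcst gG m (bok_MP gG d kok)); apply: (bcst gG d kok).
Qed.

(** The relation may involve the parameters alone. In [point_dependent] the parameters are
    independent, so there it makes the coordinate algebraic over them. *)
Definition dep_at (L : fieldType) (iota : {rmorphism k -> L}) (x : nat -> L) (j : nat) :=
  exists2 g : MP k d.+1, g != 0 &
    ev iota (fun i => if (i < d)%N then x (xi (tau i)) else x (xi j)) d.+1 g = 0.

Definition param_eq i : MP Y n :=
  cst n ((cst m (var d i))%:P : Y) - var n (xi (tau i)).

Definition form_eq : MP Y n :=
  cst n ('X : Y) - \sum_(j < m) cst n ((var m j)%:P : Y) * var n (xi j).

(** Its points are zeros of [E] whose parameters are the [t_i] and whose generic linear form is [y],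
    in fields where all of [t], [u], [y] are independent. *)
Definition gen_system (E : seq (MP k n)) : seq (MP Y n) :=
  [seq MPmap cYf n e | e <- E] ++ rcons [seq param_eq i | i <- iota 0 d] form_eq.

Definition slevel N := Phi (Phi (iter N Phi (Phi (Phi N)))).

Lemma gen_system_bounded N (E : seq (MP k n)) : (n + rY <= N)%N -> (0 < N)%N ->
  (size E + d < N)%N -> (forall e, e \in E -> bMP kb n N e) ->
  (size (gen_system E) <= slevel N)%N /\
  (forall e, e \in gen_system E -> bMP bY n (slevel N) e).
Proof.
move=> r_N N_gt0 sE bE; have Mok := bok_MP gG n Yok.
have le_N2 : (N <= Phi (Phi N))%N.
  by apply: leq_trans (growth_infl gPhi _) (growth_infl gPhi _).
have le_N3 : (N <= iter N Phi (Phi (Phi N)))%N.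
  by apply: leq_trans le_N2 (iter_infl _ _ gPhi).
have le_N : (N <= slevel N)%N.
  by apply: leq_trans le_N3 _; apply: leq_trans (growth_infl gPhi _) (growth_infl gPhi _).
have bv i : bMP bY n N (var n i) by apply: (bvar gG n i Yok).
have bc c : bY N c -> bMP bY n N (cst n c) by apply: (bcst gG n Yok).
have bk i : bMP kb d N (var d i) by apply: (bvar gG d i kok).
have bA i : bMP (bMP kb d) m N (var m i).
  by apply: (bvar gG m i (bok_MP gG d kok)).
have bYC c : bMP (bMP kb d) m N c -> bY N (c%:P : {poly _}).
  exact: (bpolyC (bok_MP gG m (bok_MP gG d kok))).
split.
  rewrite size_cat size_rcons !size_map size_iota addnS; apply: leq_trans le_N.
  exact: sE.
move=> e; rewrite mem_cat mem_rcons inE => /or3P[/mapP[f Ef ->]|/eqP->|/mapP[i _ ->]].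
- apply: (bok_mono Mok le_N); apply: bMPmap (leqnn N) _ (bE f Ef) => c.
  exact: b_cY.
- rewrite /form_eq /slevel; apply: (bB gG Mok).
    apply: (bok_mono Mok le_N3); apply: bc.
    exact: (bpolyX (bok_MP gG m (bok_MP gG d kok)) N_gt0).
  have bt (j : 'I_m) : bMP bY n (Phi N) (cst n ((var m j)%:P : Y) * var n (xi j)).
    by apply: (bM gG Mok r_N); [apply: bc; apply: bYC; apply: bA | apply: bv].
  apply: (bok_mono Mok _ (bsum gG Mok bt)); apply: iter_mono => //.
    by apply: leq_trans r_N; rewrite addnS; apply: leqW; rewrite addnA addnAC leq_addl.
  exact: (growth_infl gPhi).
rewrite /param_eq /slevel; apply: (bB gG Mok); apply: (bok_mono Mok le_N3); last exact: bv.
by apply: bc; apply: bYC; apply: (bcst gG m (bok_MP gG d kok)).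
Qed.

Section Point.
Variables (L : fieldType) (h : {rmorphism MP Y n -> L}).
Hypothesis h_inj : injective (fun c => h (cst n c)).
Let iota : {rmorphism k -> L} := (h \o (cst n \o cYf) : {rmorphism k -> L}).
Let x i := h (var n i).

Lemma point_ev p : h (MPmap cYf n p) = ev iota x n p.
Proof.
pose h' : {rmorphism MP k n -> L} := (h \o MPmap cYf n : {rmorphism _ -> _}).
apply: (ev_uniq (h := h')) => [c|i lt_i]; rewrite /h' /=.
  by rewrite MPmap_cst.
by rewrite MPmap_var.
Qed.

(** If the coordinates are algebraic over [k(t)], then the form [y] is algebraic over [k(t, u)]; but
    [y] is transcendental over it, as [Y] embeds into [L]. *)
Lemma point_dependent : (forall i, (i < d)%N -> h (param_eq i) = 0) ->
  h form_eq = 0 -> ~ (forall j, (j < m)%N -> dep_at iota x j).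
Proof.
move=> hpar hform hdep.
pose beta : {rmorphism Y -> L} := (h \o cst n : {rmorphism Y -> L}).
pose fA : {rmorphism MP (MP k d) m -> L} :=
  (beta \o (@polyC (MP (MP k d) m) : {rmorphism _ -> Y}) : {rmorphism _ -> _}).
have fA_inj : injective fA by move=> c c' /h_inj/polyC_inj.
pose fT : {rmorphism MP k d -> L} := (fA \o cst m : {rmorphism _ -> _}).
have fT_inj : injective fT by move=> c c' /fA_inj/cst_inj.
have fTE : fT =1 ev iota (fun i => x (xi (tau i))) d.
  apply: ev_uniq => [c|i lt_i]; first by rewrite /fT /=.
  have /eqP := hpar i lt_i; rewrite /param_eq rmorphB subr_eq0 => /eqP E.
  exact: E.
have alg (j : 'I_m) : exists2 c, c != 0 & integralOver fA (fA c * x (xi j)).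
  have [g g0 gE] := hdep j (ltn_ord j).
  have lg0 : lead_coef (g : {poly MP k d}) != 0 by rewrite lead_coef_eq0.
  exists (cst m (lead_coef (g : {poly MP k d}))).
    by apply: contraNneq lg0 => E; apply/eqP/(@cst_inj _ m); rewrite E rmorph0.
  have [|p pm rp] := @integral_lead _ _ fT fT_inj (g : {poly MP k d}) (x (xi j)) g0.
    rewrite -gE /= ltnn; transitivity (pev (ev iota (fun i => x (xi (tau i))) d) (x (xi j)) g).
      exact: eq_pev fTE.
    by apply: eq_pev; apply: eq_ev => // i ->.
  exists (map_poly (cst m) p); first by apply: monic_map.
  by move: rp; rewrite /root -map_poly_comp.
have [c c0 intc] := integral_sum_scaled (fun j => var m j) alg.
have yE : beta 'X = \sum_(j < m) fA (var m j) * x (xi j).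
  have /eqP := hform; rewrite /form_eq rmorphB subr_eq0 => /eqP.
  rewrite /beta /= => ->; rewrite rmorph_sum; apply: eq_bigr => j _.
  by rewrite rmorphM.
rewrite -yE in intc; have [p p0 pE] := integral_unscale c0 intc.
case/eqP: p0; apply: h_inj; rewrite !rmorph0 -pE.
by apply: (pev_uniq (h := beta)).
Qed.
End Point.

Section Relation.
Variables (L0 : fieldType) (iota0 : {rmorphism k -> L0}) (a : nat -> L0).
Notation gev := (@generic_ev k m d tau L0 iota0 (fun j => a (xi j))).

(* The generic point of the eliminated system lying over [a]. *)
Definition lift_ev : {rmorphism MP Y n -> MP L0 m} := ev gev (fun i => cst m (a i)) n.

Lemma lift_ev_lift p : lift_ev (MPmap cYf n p) = cst m (ev iota0 a n p).
Proof.
pose c0 : {rmorphism k -> MP L0 m} := (cst m \o iota0 : {rmorphism _ -> _}).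
transitivity (ev c0 (fun i => cst m (a i)) n p).
  by apply: ev_MPmap => c; rewrite generic_ev_cY.
by symmetry; apply: ev_comp.
Qed.

Lemma lift_ev_param i : (i < d)%N -> lift_ev (param_eq i) = 0.
Proof.
move=> lt_i; rewrite /param_eq rmorphB /= /lift_ev ev_cst ev_var ?xi_lt ?tau_lt //.
by rewrite generic_evC MPmap_cst /tau_ev ev_var // subrr.
Qed.

Lemma lift_ev_form : lift_ev form_eq = 0.
Proof.
rewrite /form_eq rmorphB /= /lift_ev ev_cst rmorph_sum.
rewrite -[gev 'X]/(pev (MPmap (@tau_ev k d tau L0 iota0 (fun j => a (xi j))) m)
  (form_at m (fun j => a (xi j))) 'X) pevX.
rewrite /form_at -sumrB big1 // => j _; rewrite rmorphM /= ev_cst ev_var ?xi_lt //.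
by rewrite generic_evC MPmap_var subrr.
Qed.

Lemma generic_relation N (E : seq (MP k n)) s :
  (n + rY < N)%N -> (size E + d < N)%N ->
  (forall e, e \in E -> bMP kb n N e) -> bMP kb n N s ->
  (forall e, e \in E -> ev iota0 a n e = 0) -> ev iota0 a n s != 0 ->
  (forall (L : fieldType) (iota : {rmorphism k -> L}) x,
     (forall e, e \in E -> ev iota x n e = 0) -> ev iota x n s != 0 ->
     forall j, (j < m)%N -> dep_at iota x j) ->
  exists R : Y, [/\ R != 0, bY (elim_bound G (slevel N)) R & gev R = 0].
Proof.
move=> r_N sE bE bs aE as0 hdep.
have N_gt0 : (0 < N)%N by apply: leq_trans r_N.
have [sE' bE'] := gen_system_bounded (ltnW r_N) N_gt0 sE bE.
have le_N : (N <= slevel N)%N.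
  rewrite /slevel; do 2!apply: leq_trans (growth_infl gPhi _).
  apply: leq_trans (iter_infl _ _ gPhi).
  by apply: leq_trans (growth_infl gPhi _) (growth_infl gPhi _).
have Mok := bok_MP gG n Yok.
have bs' : bMP bY n (slevel N) (MPmap cYf n s).
  apply: (bok_mono Mok le_N); apply: bMPmap (leqnn N) _ bs => c; exact: b_cY.
have np : no_points (cst n) (gen_system E) (MPmap cYf n s).
  move=> L h h_inj hE; apply/eqP; apply: contraT => hs.
  have mE e : e \in gen_system E -> h e = 0 := hE e.
  case: (point_dependent h_inj).
  - move=> i lt_i; apply: mE; rewrite mem_cat mem_rcons inE; apply/or3P; apply: Or33.
    by apply/mapP; exists i; rewrite ?mem_iota.
  - by apply: mE; rewrite mem_cat mem_rcons inE eqxx orbT.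
  move=> j lt_j; apply: hdep => // [e Ee|]; last by rewrite -point_ev.
  by rewrite -point_ev; apply: mE; rewrite mem_cat map_f.
have [R [R0 bR JR]] := elimination gG Yok (leq_trans r_N le_N) sE' bE' bs' np.
exists R; split=> //.
(* The kernel of [lift_ev] is a prime ideal that contains the system but not [s], so it contains the
   eliminant. *)
have := JR (fun p => lift_ev p = 0); rewrite rmorphM /= lift_ev_lift /lift_ev ev_cst.
move=> H; have /eqP : gev R * cst m (ev iota0 a n s) = 0.
  apply: H => [|e]; first split.
  - exact: rmorph0.
  - by move=> p q _ _ p0 q0; rewrite rmorphD p0 q0 addr0.
  - by move=> p q _ _ q0; rewrite rmorphM q0 mulr0.
  - by move=> p _ /eqP; rewrite rmorphM mulf_eq0 orbb => /eqP.
  rewrite mem_cat mem_rcons inE => /or3P[/mapP[f Ef ->]|/eqP->|/mapP[i i_lt ->]].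
  - by rewrite [LHS]lift_ev_lift aE // rmorph0.
  - exact: lift_ev_form.
  - by apply: lift_ev_param; move: i_lt; rewrite mem_iota.
rewrite mulf_eq0 => /orP[/eqP //|/eqP E0].
by case/eqP: as0; apply: (@cst_inj _ m); rewrite E0 rmorph0.
Qed.
End Relation.

Definition sublevel M := Psi (iter M Psi (iter M Phi (Phi M))).

Lemma generic_subst_bounded M (p : Y) : (d <= M)%N -> (m + (m + 0) <= M)%N ->
  (0 < M)%N -> bY M p ->
  bMP (bMP kb m) m (sublevel M) (@generic_subst k m d tau p).
Proof.
move=> d_M m_M M_gt0 bp; have Xok := bok_MP gG m kok; have Uok := bok_MP gG m Xok.
have m_M' : (m + 0 <= M)%N by apply: leq_trans m_M; apply: leq_addl.
set M' := iter M Psi (iter M Phi (Phi M)).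
have le_M1 : (M <= Phi M)%N := growth_infl gPhi M.
have le_M2 : (M <= iter M Phi (Phi M))%N := leq_trans le_M1 (iter_infl _ _ gPhi).
have le_M : (M <= M')%N := leq_trans le_M2 (iter_infl _ _ gPsi).
have bts (c : MP k d) : bMP kb d M c -> bMP kb m M' (@tau_subst k m d tau c).
  move=> bc; have : bMP kb m (iter d Psi M) (@tau_subst k m d tau c).
    apply: (bev gG Xok m_M' (leqnn M) _ _ bc) => [z|i _]; first by exact: (bcst gG m kok).
    exact: (bvar gG m _ kok).
  by apply: (bok_mono Xok); apply: iter_mono.
apply: (bpev gG Uok _ le_M _ _ bp); first exact: leq_trans m_M le_M.
  by move=> c; apply: bMPmap le_M _.
have bt (j : 'I_m) : bMP (bMP kb m) m (Phi M) (var m j * cst m (var m j)).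
  apply: (bM gG Uok m_M); first exact: (bvar gG m _ Xok).
  by apply: (bcst gG m Xok); apply: (bvar gG m _ kok).
apply: (bok_mono Uok _ (bsum gG Uok bt)); apply: leq_trans (iter_infl _ _ gPsi).
by apply: iter_mono => //; apply: leq_trans m_M'; rewrite addn0.
Qed.

Lemma sep_deriv_bounded M q (H C : {poly MP (MP k d) m}) : (0 < q)%N ->
  C = H \Po 'X^q -> bY M C -> bY (iter M.+1 Phi M) (sep_deriv H q).
Proof.
move=> q_gt0 CE [sC bC]; have Aok := bok_MP gG m (bok_MP gG d kok).
have HE i : H`_i = C`_(i * q) by rewrite CE coef_comp_poly_Xn // dvdn_mull // mulnK.
have sE i : (sep_deriv H q)`_i = if (q %| i)%N then C`_(i + q) *+ (i %/ q).+1 else 0.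
  rewrite /sep_deriv coef_comp_poly_Xn //; case: ifP => // q_i.
  by rewrite coef_deriv HE mulSn addnC divnK.
split.
  apply: leq_trans (_ : M.+1 <= _)%N; last by rewrite ltnS; apply: iter_infl.
  apply/leq_sizeP => i le_i; rewrite sE; case: ifP => // _.
  rewrite nth_default ?mul0rn //; apply: leq_trans sC _.
  by apply: leq_trans le_i (leq_addr _ _).
have bMn x t : bMP (bMP kb d) m M x -> bMP (bMP kb d) m (iter t Phi M) (x *+ t).
  move=> bx; have := bsum gG Aok (fun _ : 'I_t => bx).
  by rewrite sumr_const card_ord.
move=> i; rewrite sE; case: ifP => [q_i|_]; last exact: (bok0 Aok).
have [lt_i|le_i] := ltnP (i + q) (size C); last first.
  by rewrite nth_default // mul0rn; apply: (bok0 Aok).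
apply: (bok_mono Aok _ (bMn _ _ (bC _))); apply: iter_mono => //.
apply: leq_trans _ sC; apply: leq_trans lt_i; apply: leqW.
by apply: leq_trans (_ : i.+1 <= _)%N; [rewrite ltnS leq_div | rewrite -addn1 leq_add2l].
Qed.

Lemma bounded_prime_factor M (R : Y) (S : idomainType) (f : {rmorphism Y -> S}) :
  (rY <= M)%N -> R != 0 -> bY M R -> f R = 0 ->
  exists C : Y, [/\ prime_elt C, bY (factor_bound G M) C & f C = 0].
Proof.
move=> r_M R0 bR fR.
have Yufd : ufd Y by apply: ufd_poly; do 2!apply: ufd_MP; apply: ufd_field.
have [C [CP [z RE] fC]] := prime_factor_root Yufd R0 fR.
have tY : tower G kb bY rY cYf.
  exact: (tower_poly gG kok (tower_MP gG kok m (tower_MP gG kok d (tower_base kok)))).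
have [c c0 bC] := factor_bounded gG kok k_factor tY r_M (leq_trans (ltn0Sn _) r_M) R0 bR RE.
(* The bound is on a constant multiple of [C], which is prime as well. *)
exists (cYf c * C); split=> //; last by rewrite rmorphM fC mulr0.
by apply: prime_scale => //; apply: rmorph_unit; rewrite unitfE.
Qed.

Definition detlevel N :=
  sublevel (iter (factor_bound G (elim_bound G (slevel N))).+1 Phi
    (factor_bound G (elim_bound G (slevel N)))).

(** The conditions of [determined] on [C] and [sep_deriv] are about polynomials in [u]. The first
    says that all coefficients vanish at [x]: these form [S]. The second is secured by one
    coefficient [t], chosen nonzero at [a]. *)
Lemma determination_at N (E : seq (MP k n)) s (L0 : fieldType)
    (iota0 : {rmorphism k -> L0}) (a : nat -> L0) :
  (n + rY < N)%N -> (m + m <= N)%N -> (size E + d < N)%N ->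
  (forall e, e \in E -> bMP kb n N e) -> bMP kb n N s ->
  (forall e, e \in E -> ev iota0 a n e = 0) -> ev iota0 a n s != 0 ->
  (forall g : MP k d, ev iota0 (fun i => a (xi (tau i))) d g = 0 -> g = 0) ->
  (forall (L : fieldType) (iota : {rmorphism k -> L}) x,
     (forall e, e \in E -> ev iota x n e = 0) -> ev iota x n s != 0 ->
     forall j, (j < m)%N -> dep_at iota x j) ->
  exists (S : seq (MP k m)) (t : MP k m),
    [/\ (size S <= finf (detlevel N))%N,
        forall e, e \in t :: S -> bMP kb m (detlevel N) e,
        forall e, e \in S -> ev iota0 (fun j => a (xi j)) m e = 0,
        ev iota0 (fun j => a (xi j)) m t != 0 &
        forall (L : fieldType) (iota : {rmorphism k -> L}) x,
          (forall e, e \in S -> ev iota x m e = 0) -> ev iota x m t != 0 ->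
          forall g, ev iota0 (fun j => a (xi j)) m g = 0 -> ev iota x m g = 0].
Proof.
move=> r_N m_N sE bE bs aE as0 a_indep hdep.
have [R [R0 bR aR]] := generic_relation r_N sE bE bs aE as0 hdep.
have N_gt0 : (0 < N)%N by apply: leq_trans r_N.
have le_N : (N <= slevel N)%N.
  rewrite /slevel; do 2!apply: leq_trans (growth_infl gPhi _).
  apply: leq_trans (iter_infl _ _ gPhi).
  by apply: leq_trans (growth_infl gPhi _) (growth_infl gPhi _).
have le_N1 := leq_trans le_N (growth_infl (growth_elim_bound gG) _).
have le_r : (rY <= N)%N by apply: leq_trans (ltnW r_N); apply: leq_addl.
have [C [CP bC aC]] := bounded_prime_factor (leq_trans le_r le_N1) R0 bR aR.
have le_N2 := leq_trans le_N1 (growth_infl (growth_factor_bound gG) _).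
have inj_a : injective (@tau_ev k d tau L0 iota0 (fun j => a (xi j)) : MP k d -> L0).
  move=> g g' E0; apply/eqP; rewrite -subr_eq0; apply/eqP/a_indep.
  by apply/eqP; rewrite rmorphB subr_eq0; apply/eqP.
have C_gt1 := size_generic inj_a CP aC.
pose cA : {rmorphism k -> MP (MP k d) m} := (cst m \o cst d : {rmorphism _ -> _}).
have [q [H [q_gt0 CE H'0 frob]]] := frobenius_decomposition cA C_gt1.
have as' := sep_deriv_neq0 q_gt0 CE inj_a CP aC H'0.
rewrite /detlevel; move: (factor_bound G _) le_N2 bC => M le_NM bC.
have bC' := bok_mono Yok (iter_infl M.+1 M gPhi) bC.
have bS' := sep_deriv_bounded q_gt0 CE bC.
have le_NM' : (N <= iter M.+1 Phi M)%N := leq_trans le_NM (iter_infl _ _ gPhi).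
move: (iter M.+1 Phi M) le_NM' bC' bS' => M' le_NM' bC' bS'.
have d_M : (d <= M')%N.
  by apply: leq_trans le_NM'; apply: leq_trans (ltnW sE); apply: leq_addl.
have m_M : (m + (m + 0) <= M')%N by rewrite addn0; apply: leq_trans le_NM'.
have M_gt0 : (0 < M')%N by apply: leq_trans le_NM'.
have bC2 := generic_subst_bounded d_M m_M M_gt0 bC'.
have bS2 := generic_subst_bounded d_M m_M M_gt0 bS'.
have [szS bS] := bmcoefs bC2; have [_ bT] := bmcoefs bS2.
have [t tT at0] : exists2 t, t \in mcoefs m (@generic_subst k m d tau (sep_deriv H q)) &
    ev iota0 (fun j => a (xi j)) m t != 0.
  apply: NNPP => nex; case/eqP: as'; rewrite generic_evE //; apply/mcoefs_eq0 => t tT.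
  by apply/eqP; apply: contraT => at0; case: nex; exists t.
exists (mcoefs m (@generic_subst k m d tau C)), t; split=> //.
- apply: leq_trans szS _; rewrite /finf.
  apply: (@leq_trans ((sublevel M').+2 ^ m)).
    by case: (m) => // m'; rewrite leq_exp2r // leqW.
  rewrite leq_exp2l //; apply: leqW; apply: leq_trans (_ : M' <= _)%N.
    by apply: leq_trans m_M; apply: leq_addr.
  apply: leq_trans (growth_infl gPsi _); apply: leq_trans (iter_infl _ _ gPsi).
  by apply: leq_trans (iter_infl _ _ gPhi); apply: (growth_infl gPhi).
- by move=> e; rewrite inE => /orP[/eqP->|]; [apply: bT | apply: bS].
- by apply/mcoefs_eq0; rewrite -generic_evE.
move=> L iota x xS xt g ag.
apply: (determined q_gt0 CE frob inj_a CP aC _ _ ag).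
  by rewrite generic_evE //; apply/mcoefs_eq0.
apply: contraNneq xt => E0; apply/eqP; move: E0; rewrite generic_evE // => /mcoefs_eq0.
exact.
Qed.

End Determination.

(** * Extension of kernels *)

Lemma pev_transcendental (A : idomainType) (L : fieldType) (g : {rmorphism A -> L}) p :
  pev ((@tofrac {poly L} \o polyC) \o g : {rmorphism A -> {fraction {poly L}}})
    (tofrac 'X) p = tofrac (map_poly g p).
Proof.
rewrite pev_sum; have sz : (size (map_poly g p) <= size p)%N by exact: size_poly.
rewrite -[in RHS](take_poly_id sz) /take_poly poly_def rmorph_sum /=.
by apply: eq_bigr => j _; rewrite -mul_polyC rmorphM rmorphXn coef_map.
Qed.

Section OneStep.
Variables (A : idomainType) (K L : fieldType).
Variables (f : {rmorphism A -> K}) (g : {rmorphism A -> L}).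
Hypothesis same_ker : forall x, f x = 0 <-> g x = 0.
Variable z : K.

Lemma map_poly_eq0P (S : fieldType) (h : {rmorphism A -> S}) (p : {poly A}) :
  map_poly h p = 0 <-> forall i, h p`_i = 0.
Proof.
split=> [/polyP H i|H]; first by have := H i; rewrite coef_map coef0.
by apply/polyP => i; rewrite coef_map coef0 /= H.
Qed.

Lemma same_map (p : {poly A}) : map_poly f p = 0 <-> map_poly g p = 0.
Proof.
by split=> /map_poly_eq0P H; apply/map_poly_eq0P => i; apply/same_ker.
Qed.

Lemma truncate (p : {poly A}) : map_poly f p != 0 -> exists p' : {poly A}, [/\ (size p' <= size p)%N,
  f (lead_coef p') != 0 & pev f z p' = pev f z p].
Proof.
move=> fp0; set e := size (map_poly f p).
have e_gt0 : (0 < e)%N by rewrite size_poly_gt0.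
have le_e : (e <= size p)%N by apply: size_poly.
have l0 : f p`_e.-1 != 0 by rewrite -coef_map -/(lead_coef _) lead_coef_eq0.
have p0 : p`_e.-1 != 0 by apply: contraNneq l0 => ->; rewrite rmorph0.
have sz : size (take_poly e p) = e.
  rewrite /take_poly -[X in \poly_(i < X) _](prednK e_gt0).
  by rewrite size_poly_eq ?prednK.
exists (take_poly e p); split; first by rewrite sz.
  by rewrite lead_coefE sz coef_take_poly prednK // leqnn.
rewrite !pevE; congr (_.[_]); apply/polyP => i; rewrite !coef_map coef_take_poly.
case: ltnP => //= le_i; rewrite rmorph0 -coef_map nth_default //.
Qed.

(** Extension of a field isomorphism by one element, phrased over [A] with pseudo-division. For
    algebraic [z], the equation [p] is minimal among those whose leading coefficient survives [f].
    Its image over [L] may be reducible, and [w] is a root of an irreducible factor. *)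
Lemma extend_one : exists (L' : fieldType) (kap : {rmorphism L -> L'}) (w : L'),
  forall p : {poly A}, pev f z p = 0 <-> pev (kap \o g : {rmorphism A -> L'}) w p = 0.
Proof.
case: (classic (exists2 p : {poly A}, pev f z p = 0 & f (lead_coef p) != 0)); last first.
  move=> trans; exists {fraction {poly L}},
    (@tofrac {poly L} \o polyC : {rmorphism L -> {fraction {poly L}}}), (tofrac 'X) => p.
  rewrite pev_transcendental; split=> [p0|/eqP].
    have -> : map_poly g p = 0; last exact: rmorph0.
    apply/same_map/eqP; apply: contraT => /truncate[p' [_ l0 E]].
    by case: trans; exists p'; rewrite // E.
  rewrite tofrac_eq0 => /eqP/same_map fp0.
  by rewrite pevE fp0 horner0.
move=> [p1 p10 l1]; pose P n := exists p : {poly A},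
  [/\ pev f z p = 0, f (lead_coef p) != 0 & size p = n].
have [n [[p [pz l0 pn]] min_n]] : exists n, P n /\ forall i, (i < n)%N -> ~ P i.
  have : P (size p1) by exists p1.
  elim/ltn_ind: (size p1) => n IH Pn.
  case: (classic (exists2 i, (i < n)%N & P i)) => [[i lt_i Pi]|nex]; first exact: IH Pi.
  by exists n; split=> // i lt_i Pi; apply: nex; exists i.
have min_p (q : {poly A}) : (size q < size p)%N -> map_poly f q != 0 -> pev f z q != 0.
  move=> lt_q /truncate[q' [le_q' lq' E]]; apply/eqP => q0.
  apply: (min_n (size q')); first by rewrite -pn (leq_ltn_trans le_q').
  by exists q'; rewrite E.
have p_gt1 : (1 < size p)%N.
  rewrite ltnNge; apply/negP => sp; move: pz l0; rewrite (size1_polyC sp) pevC.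
  by rewrite lead_coefC => ->; rewrite eqxx.
have gl0 : g (lead_coef p) != 0.
  by apply: contraNneq l0 => /same_ker ->.
have szg : size (map_poly g p) = size p by apply: size_map_poly_id0.
have [t irr_t t_dv] : exists2 q, irreducible_poly q & q %| map_poly g p.
  by apply: irredp_factor; rewrite szg.
have [L' [kap [w rw]]] := root_ext irr_t; exists L', kap, w.
set h : {rmorphism A -> L'} := (kap \o g : {rmorphism A -> L'}).
have hE q : pev h w q = (map_poly kap (map_poly g q)).[w].
  by rewrite pevE /h (map_poly_comp kap g).
have pw : pev h w p = 0.
  by rewrite hE; apply/eqP; apply: root_dvdp rw; rewrite dvdp_map.
have h0 x : h x = 0 <-> f x = 0.
  rewrite /h /=; split=> [/eqP|/same_ker ->]; last exact: rmorph0.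
  by rewrite fmorph_eq0 => /eqP/same_ker.
have pdiv (a b : {poly A}) : b != 0 -> exists j (q r : {poly A}),
    [/\ (lead_coef b ^+ j)%:P * a = q * b + r & (size r < size b)%N].
  move=> b0; exists (Pdiv.Idomain.scalp a b), (Pdiv.Idomain.divp a b), (Pdiv.Idomain.modp a b).
  rewrite mul_polyC; split; first exact: Pdiv.Idomain.divp_eq.
  by rewrite Pdiv.Idomain.ltn_modp.
have p0 : p != 0 by rewrite -size_poly_gt0 (ltn_trans _ p_gt1).
have dir a : pev f z a = 0 -> pev h w a = 0.
  move=> az; have [j [q [r [E lt_r]]]] := pdiv a p p0.
  have rz : map_poly f r = 0.
    apply/eqP; apply: contraT => fr0; have := min_p r lt_r fr0.
    have /eqP := congr1 (pev f z) E; rewrite rmorphM rmorphD rmorphM /= az pz !mulr0 add0r.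
    by rewrite eq_sym => ->.
  have rw0 : pev h w r = 0 by rewrite hE (proj1 (same_map r) rz) rmorph0 horner0.
  have /eqP := congr1 (pev h w) E; rewrite rmorphM rmorphD rmorphM /= pw rw0 mulr0 addr0.
  rewrite mulf_eq0 => /orP[|/eqP//]; rewrite pevC rmorphXn expf_eq0 => /andP[_].
  by move/eqP/h0/eqP; rewrite (negPf l0).
move=> a; split; first exact: dir.
move: {2}(size a) (leqnn (size a)) => s; elim: s a => [|s IH] a le_a aw.
  by move: le_a; rewrite leqn0 size_poly_eq0 => /eqP->; rewrite rmorph0.
have [sa1|a_gt1] := leqP (size a) 1.
  by move: aw; rewrite (size1_polyC sa1) !pevC => /h0.
have a0 : a != 0 by rewrite -size_poly_gt0 (ltn_trans _ a_gt1).
have [fla0|fla] := eqVneq (f (lead_coef a)) 0.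
  set b := a - (lead_coef a)%:P * 'X^((size a).-1).
  have lt_b : (size b < size a)%N by apply: size_drop_lead.
  have hla0 : h (lead_coef a) = 0 by apply/h0.
  have bE (S : comNzRingType) (u : {rmorphism A -> S}) v :
      u (lead_coef a) = 0 -> pev u v b = pev u v a.
    by move=> u0; rewrite rmorphB rmorphM /= pevC u0 mul0r subr0.
  rewrite -(bE _ f) //; apply: IH; first by rewrite -ltnS (leq_trans lt_b).
  by rewrite (bE _ h).
have [le_pa|lt_ap] := leqP (size p) (size a).
  have [j [q [r [E lt_r]]]] := pdiv a p p0.
  have rz : pev f z r = 0.
    apply: IH; first by rewrite -ltnS (leq_trans (leq_trans lt_r le_pa)).
    have := congr1 (pev h w) E; rewrite rmorphM rmorphD rmorphM /= pw aw !mulr0 add0r.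
    by move=> <-.
  have /eqP := congr1 (pev f z) E; rewrite rmorphM rmorphD rmorphM /= pz rz mulr0 addr0.
  rewrite mulf_eq0 => /orP[|/eqP//]; rewrite pevC rmorphXn expf_eq0 => /andP[_].
  by rewrite (negPf l0).
(* For [a] shorter than [p], the remainder of [p] by [a] is shorter still and vanishes at [z] by
   induction. The quotient is too short to vanish at [z], so [a] does. *)
have [j [q [r [E lt_r]]]] := pdiv p a a0.
have rz : pev f z r = 0.
  apply: IH; first by rewrite -ltnS (leq_trans lt_r).
  have := congr1 (pev h w) E; rewrite rmorphM rmorphD rmorphM /= pw aw !mulr0 add0r.
  by move=> <-.
have lq : map_poly f q != 0.
  apply/eqP => fq0; have := congr1 (map_poly f) E.
  rewrite rmorphM rmorphD rmorphM /= fq0 mul0r add0r map_polyC /= rmorphXn => /(congr1 (size \o polyseq)) /=.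
  rewrite mul_polyC size_scale ?expf_neq0 // size_map_poly_id0 // => szE.
  have : (size (map_poly f r) <= size r)%N by apply: size_poly.
  by rewrite -szE leqNgt (ltn_trans lt_r lt_ap).
have q0 : q != 0 by apply: contraNneq lq => ->; rewrite rmorph0.
have lt_q : (size q < size p)%N.
  have la0 : lead_coef a ^+ j != 0 by rewrite expf_neq0 // lead_coef_eq0.
  have szq : (size (q * a)%R <= size p)%N.
    have -> : q * a = (lead_coef a ^+ j)%:P * p - r by rewrite E addrK.
    apply: leq_trans (size_polyD _ _) _; rewrite size_polyN geq_max mul_polyC size_scale //.
    by rewrite leqnn ltnW // (ltn_trans lt_r lt_ap).
  move: szq; rewrite size_mul // => szq; move: szq a_gt1; clear.
  by move: (size q) (size a) (size p) => x y w; lia.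
have := congr1 (pev f z) E; rewrite rmorphM rmorphD rmorphM /= pz rz mulr0 addr0.
move/esym/eqP; rewrite mulf_eq0 (negPf (min_p q lt_q lq)) /= => /eqP.
by [].
Qed.
End OneStep.

(** * Kernels of the shift *)

Section Kernel.
Variables (k : fieldType) (vs : {rmorphism k -> k}) (m : nat).
Hypothesis m_gt0 : (0 < m)%N.

(* [a] is a partial solution: [x_i |-> x_(i + m)] and [vs] induce an isomorphism
   between the fields generated by the first [q] coordinates and their shifts. *)
Definition compatible (L : fieldType) (iota : {rmorphism k -> L}) (a : nat -> L) q :=
  forall p : MP k q, ev iota a q p = 0 <->
    ev (iota \o vs : {rmorphism k -> L}) (fun i => a (i + m)%N) q p = 0.

(** [extend_one] carries the coordinate [a q] along the isomorphism; its image is the new coordinate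
    of index [q + m]. *)
Lemma compatible_extend (L : fieldType) (iota : {rmorphism k -> L}) a q :
  compatible iota a q -> exists (L' : fieldType) (kap : {rmorphism L -> L'}) (a' : nat -> L'),
    (forall i, (i < q + m)%N -> a' i = kap (a i)) /\
    compatible (kap \o iota : {rmorphism k -> L'}) a' q.+1.
Proof.
move=> ca; have [L' [kap [w wE]]] := extend_one ca (a q).
pose a' i := if (i < q + m)%N then kap (a i) else w.
exists L', kap, a'; split=> [i lt_i|p]; first by rewrite /a' lt_i.
have -> : ev (kap \o iota : {rmorphism k -> L'}) a' q.+1 p = kap (ev iota a q.+1 p).
  symmetry; apply: ev_comp => // i lt_i; rewrite /a' ifT //.
  by apply: leq_trans lt_i _; rewrite -addn1 leq_add2l.
have -> : ev (kap \o iota \o vs : {rmorphism k -> L'}) (fun i => a' (i + m)%N) q.+1 p =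
   pev (kap \o ev (iota \o vs : {rmorphism k -> L}) (fun i => a (i + m)%N) q
     : {rmorphism _ -> _}) w p.
  rewrite /=; have -> : a' (q + m)%N = w by rewrite /a' ltnn.
  apply: eq_pev => c /=; symmetry; apply: ev_comp => // i lt_i.
  by rewrite /a' ltn_add2r lt_i.
rewrite -wE; split=> [/eqP|]; last by move=> /= ->; rewrite rmorph0.
by rewrite fmorph_eq0 => /eqP.
Qed.

Lemma compatible_eq (L : fieldType) (iota iota' : {rmorphism k -> L}) a q :
  iota =1 iota' -> compatible iota a q -> compatible iota' a q.
Proof.
move=> E ca p; have := ca p.
have -> : ev iota a q p = ev iota' a q p by apply: eq_ev.
suff -> : ev (iota \o vs : {rmorphism k -> L}) (fun i => a (i + m)%N) q p =
  ev (iota' \o vs : {rmorphism k -> L}) (fun i => a (i + m)%N) q p by [].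
by apply: eq_ev => // c /=; apply: E.
Qed.

Lemma compatible_extend_many (L : fieldType) (iota : {rmorphism k -> L}) a q r :
  compatible iota a q -> exists (L' : fieldType) (kap : {rmorphism L -> L'}) (a' : nat -> L'),
    (forall i, (i < q + m)%N -> a' i = kap (a i)) /\
    compatible (kap \o iota : {rmorphism k -> L'}) a' (q + r).
Proof.
move=> ca; elim: r => [|r [L1 [kap1 [a1 [E1 c1]]]]].
  by exists L, idfun, a; split=> //; rewrite addn0; apply: compatible_eq ca.
have [L2 [kap2 [a2 [E2 c2]]]] := compatible_extend c1.
exists L2, (kap2 \o kap1 : {rmorphism L -> L2}), a2; split=> [i lt_i|].
  by rewrite E2 ?E1 // -addnA addnCA (leq_trans lt_i) // leq_addl.
by rewrite addnS; apply: compatible_eq c2.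
Qed.
End Kernel.

(** * Compatible points *)

Lemma classical_filter (T : eqType) (s : seq T) (P : T -> Prop) :
  exists t, subseq t s /\ forall x, x \in t <-> x \in s /\ P x.
Proof.
elim: s => [|x s [t [ts tP]]]; first by exists [::]; split=> // x; split=> // -[].
case: (classic (P x)) => [Px|nPx].
  exists (x :: t); split; first by rewrite /= eqxx.
  move=> y; rewrite !inE; split=> [/orP[/eqP->|/tP[sy Py]]|[/orP[->//|sy Py]]].
  - by rewrite eqxx.
  - by rewrite sy orbT.
  by apply/orP; right; apply/tP.
exists t; split; first exact: subseq_trans ts (subseq_cons s x).
move=> y; rewrite inE; split=> [/tP[sy Py]|[/orP[/eqP->//|sy Py]]]; first by rewrite sy orbT.
exact/tP.
Qed.

Definition indep (k L : fieldType) (iota : {rmorphism k -> L}) (y : nat -> L) d :=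
  forall g : MP k d, ev iota y d g = 0 -> g = 0.

Section Independence.
Variables (k L : fieldType) (iota : {rmorphism k -> L}).

Lemma indep0 y : indep iota y 0.
Proof. by move=> g /= /eqP; rewrite fmorph_eq0 => /eqP. Qed.

Lemma var_neq d i j : (i < d)%N -> (j < d)%N -> i != j -> var d i - var d j != 0 :> MP k d.
Proof.
move=> lt_i lt_j ne; apply/eqP => E.
have := congr1 (ev (idfun : {rmorphism k -> k}) (fun l => (l == i)%:R) d) E.
rewrite rmorphB /= !ev_var // eqxx eq_sym (negPf ne) subr0 rmorph0 => /eqP.
by rewrite oner_eq0.
Qed.

Lemma indep_leq (x : nat -> L) n d (tau : nat -> nat) :
  (forall i, (i < d)%N -> (tau i < n)%N) -> indep iota (fun i => x (tau i)) d -> (d <= n)%N.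
Proof.
move=> tau_lt ind; rewrite -(size_iota 0 d) -(size_map tau) -[X in (_ <= X)%N](size_iota 0 n).
apply: uniq_leq_size; last first.
  by move=> _ /mapP[i i_d ->]; move: i_d; rewrite !mem_iota => /tau_lt.
rewrite map_inj_in_uniq ?iota_uniq // => i j; rewrite !mem_iota /= !add0n => lt_i lt_j E.
apply/eqP; apply: contraT => ne; case/eqP: (var_neq lt_i lt_j ne); apply: ind.
by rewrite rmorphB /= !ev_var // E subrr.
Qed.

Lemma dependent_or_extend (y : nat -> L) d (tau : nat -> nat) j :
  indep iota (fun i => y (if (i < d)%N then tau i else j)) d.+1 \/
  exists2 g : MP k d.+1, g != 0 &
    ev iota (fun i => if (i < d)%N then y (tau i) else y j) d.+1 g = 0.
Proof.
case: (classic (exists2 g : MP k d.+1, g != 0 &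
    ev iota (fun i => if (i < d)%N then y (tau i) else y j) d.+1 g = 0)); first by right.
move=> nex; left => g gE; apply/eqP; apply: contraT => g0; case: nex; exists g => //.
by rewrite -gE; apply: eq_ev => // i _; case: ifP.
Qed.

Lemma max_indep (y : nat -> L) q : exists d (tau : nat -> nat),
  [/\ (d <= q)%N, forall i, (i < d)%N -> (tau i < q)%N, indep iota (fun i => y (tau i)) d &
   forall j, (j < q)%N -> exists2 g : MP k d.+1, g != 0 &
    ev iota (fun i => if (i < d)%N then y (tau i) else y j) d.+1 g = 0].
Proof.
pose P d := exists tau : nat -> nat, (forall i, (i < d)%N -> (tau i < q)%N) /\
  indep iota (fun i => y (tau i)) d.
have Pq d : P d -> (d <= q)%N by move=> [tau [H ind]]; apply: (indep_leq H ind).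
have [d [Pd nPd]] : exists d, P d /\ ~ P d.+1.
  apply: NNPP => nex; have : P q.+1.
    elim: q.+1 => [|d IH]; first by exists id; split=> //; apply: indep0.
    by apply: NNPP => nP; apply: nex; exists d.
  by move/Pq; rewrite ltnn.
have le_d := Pq d Pd; have [tau [H ind]] := Pd; exists d, tau; split=> // j lt_j.
have [ext|//] := dependent_or_extend y d tau j; case: nPd.
exists (fun i => if (i < d)%N then tau i else j); split=> // i _.
by case: ifP => // lt_i; apply: (H _ lt_i).
Qed.
End Independence.

(** * Chains of levels *)

Section Levels.
Variables (G : nat -> nat) (gG : growth G).
Variables (k : fieldType) (kb : nat -> k -> Prop).
Notation bok := (bok G).
Notation Phi := (Phi G).
Notation Psi := (Psi G).
Hypothesis kok : bok kb 0.
Hypothesis k_factor : forall N (p : {poly k}), p != 0 -> bP kb N p ->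
  exists s : seq {poly k}, [/\ (size s <= G N)%N,
    forall q, q \in s -> irreducible_poly q /\ bP kb (G N) q & p %= \prod_(q <- s) q].
Hypothesis kbV : forall N c, kb N c -> kb (G N) c^-1.
Variables (vs vsi : {rmorphism k -> k}).
Hypothesis vsK : cancel vs vsi.
Hypothesis vsiK : cancel vsi vs.
Hypothesis kb_vs : forall N c, kb N c -> kb (G N) (vs c).
Hypothesis kb_vsi : forall N c, kb N c -> kb (G N) (vsi c).
Let gPhi := growth_Phi gG.
Let gPsi := growth_Psi gG.

(** The iteration is for a product of up to [Phi N] polynomials of level [N]; the outer part leaves
    room for the numerical conditions of [determination_at]. *)
Definition statelevel N := Phi (Phi (Phi (iter (Phi N) Phi N))).
Definition detbound N := finf (detlevel G N).
Definition thrice N := Phi (Phi (Phi N)).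
Definition embedlevel N := iter (Phi (Phi N)) Psi (Phi (Phi N)).
(** From the inside: the system of a level, equations that determine the whole point, equations that
    determine a block of its coordinates, and the images of these in all coordinates. *)
Definition step N := embedlevel (detbound (thrice (detbound (statelevel N)))).

Lemma growth_slevel : growth (slevel G).
Proof.
do 2!apply: (growth_comp gPhi); apply: growth_iter => //; first exact: growth_id.
by apply: (growth_comp gPhi).
Qed.

Lemma growth_detlevel : growth (detlevel G).
Proof.
have g1 := growth_comp (growth_factor_bound gG)
  (growth_comp (growth_elim_bound gG) growth_slevel).
have g2 : growth (sublevel G).
  apply: (growth_comp gPsi); apply: growth_iter => //; first exact: growth_id.
  by apply: growth_iter => //; exact: growth_id.
apply: (growth_comp g2); apply: growth_iter => //.
exact: (growth_comp growth_S g1).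
Qed.

Lemma growth_detbound : growth detbound.
Proof. exact: (growth_comp growth_finf growth_detlevel). Qed.

Lemma growth_thrice : growth thrice.
Proof. by apply: (growth_comp gPhi); apply: (growth_comp gPhi). Qed.

Lemma growth_statelevel : growth statelevel.
Proof.
apply: (growth_comp growth_thrice); apply: growth_iter => //; exact: growth_id.
Qed.

Lemma growth_embedlevel : growth embedlevel.
Proof. by apply: growth_iter => //; apply: (growth_comp gPhi). Qed.

Lemma growth_step : growth step.
Proof.
apply: (growth_comp growth_embedlevel); apply: (growth_comp growth_detbound).
apply: (growth_comp growth_thrice); apply: (growth_comp growth_detbound).
exact: growth_statelevel.
Qed.

Lemma thrice_ge N : (0 < N)%N -> (4 * N + 4 < thrice N)%N.
Proof.
move=> N_gt0; have N1 := Phi_double gG N_gt0.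
have N2 := Phi_double gG (leq_trans N_gt0 (growth_infl gPhi N)).
rewrite /thrice; apply: leq_trans (growth_infl gPhi _).
by move: N1 N2; move: (Phi (Phi N)) (Phi N) => a b; clear -N_gt0; lia.
Qed.

Section Ideal.
Variables (n : nat) (J : MP k n -> Prop).

(** A finite system for [agrees]: the product [s] keeps all small polynomials outside [J] from
    vanishing at once. *)
Definition is_state N (E : seq (MP k n)) (s : MP k n) :=
  [/\ (size E <= Phi N)%N, forall e, e \in E <-> bMP kb n N e /\ J e &
    exists t : seq (MP k n), [/\ s = \prod_(p <- t) p, uniq t, (size t <= Phi N)%N &
      forall p, p \in t <-> bMP kb n N p /\ ~ J p]].

Lemma state_exists N : (n <= N)%N -> exists E s, is_state N E s.
Proof.
move=> le_n; have [U sU UP] := bF (bok_MP gG n kok) (N := N) (leq_trans (eq_leq (addn0 n)) le_n).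
have [E [EU EP]] := classical_filter (undup U) (fun p => bMP kb n N p /\ J p).
have [t [tU tP]] := classical_filter (undup U) (fun p => bMP kb n N p /\ ~ J p).
have sub V : subseq V (undup U) -> (size V <= Phi N)%N.
  move=> VU; apply: leq_trans sU; apply: leq_trans (size_undup U).
  exact: size_subseq.
exists E, (\prod_(p <- t) p); split; first exact: sub.
  by move=> e; split=> [/EP[_]|[be Je]] //; apply/EP; rewrite mem_undup UP.
exists t; split=> //; first by apply: subseq_uniq tU (undup_uniq U).
  exact: sub.
by move=> p; split=> [/tP[_]|[bp Jp]] //; apply/tP; rewrite mem_undup UP.
Qed.

Definition agrees N (L : fieldType) (iota : {rmorphism k -> L}) (x : nat -> L) :=
  forall p, bMP kb n N p -> (ev iota x n p = 0 <-> J p).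

Lemma state_agrees N E s (L : fieldType) (iota : {rmorphism k -> L}) x :
  is_state N E s -> agrees N iota x <->
  (forall e, e \in E -> ev iota x n e = 0) /\ ev iota x n s != 0.
Proof.
move=> [_ EP [t [-> _ _ tP]]]; split=> [ag|[xE xs] p bp].
  split=> [e /EP[be Je]|]; first by apply/ag.
  rewrite rmorph_prod prodf_seq_neq0; apply/allP => p /= /tP[bp nJp].
  by apply/eqP => /(ag p bp).
split=> [xp|Jp]; last by apply: xE; apply/EP.
apply: NNPP => nJp; case/eqP: xs; rewrite rmorph_prod.
have tp : p \in t by apply/tP.
by rewrite (perm_big _ (perm_to_rem tp)) big_cons /= xp mul0r.
Qed.

Lemma bprod_in N (t : seq (MP k n)) : (n + 0 <= N)%N ->
  (forall p, p \in t -> bMP kb n N p) -> bMP kb n (iter (size t) Phi N) (\prod_(p <- t) p).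
Proof.
move=> le_n; have Mok := bok_MP gG n kok; elim: t => [|p t IH] bt.
  by rewrite big_nil; apply: (bok1 Mok).
rewrite big_cons; have le_it := iter_infl (size t) N gPhi.
apply: (bM gG Mok); first exact: leq_trans le_n le_it.
  by apply: (bok_mono Mok le_it); apply: bt; apply: mem_head.
by apply: IH => p' tp'; apply: bt; rewrite inE tp' orbT.
Qed.

Lemma state_bounded N E s : (n <= N)%N -> (0 < N)%N -> is_state N E s ->
  [/\ (forall e, e \in E -> bMP kb n (statelevel N) e), bMP kb n (statelevel N) s &
      forall d, (d <= n)%N -> (n + (n + (d + 0)).+1 < statelevel N)%N /\
        (size E + d < statelevel N)%N].
Proof.
move=> le_n N_gt0 [sE EP [t [-> _ st tP]]]; have Mok := bok_MP gG n kok.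
set X := iter (Phi N) Phi N; have le_NX : (N <= X)%N by apply: iter_infl.
have Phi_gt0 : (0 < Phi N)%N by apply: leq_trans (growth_infl gPhi N).
have le_PX : (Phi N <= X)%N.
  by rewrite /X -(prednK Phi_gt0) iterSr prednK //; apply: iter_infl.
have lt_X := thrice_ge (leq_trans N_gt0 le_NX).
have le_X : (X <= statelevel N)%N.
  by rewrite /statelevel -/X; do 2!apply: leq_trans (growth_infl gPhi _); apply: growth_infl.
split.
- by move=> e /EP[be _]; apply: (bok_mono Mok (leq_trans le_NX le_X)).
- have bt := @bprod_in N t (leq_trans (eq_leq (addn0 n)) le_n) (fun p tp => (proj1 (tP p) tp).1).
  apply: (bok_mono Mok _ bt); apply: leq_trans le_X.
  by rewrite /X; apply: iter_mono.
move=> d le_d; have := leq_trans le_n le_NX; have := leq_trans sE le_PX.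
move: lt_X; rewrite /statelevel -/X -/(thrice X) => lt_X sEX nX.
by clear -lt_X sEX nX le_d; clearbody X; move: (thrice X) (size E) lt_X sEX => a b; lia.
Qed.

(** Without a point, elimination yields a multiple of [s] in [J] by a nonzero element of [k].
    Dividing by it puts [s] in [J], against the hypothesis on products. *)
Lemma agrees_exists N : (n <= N)%N -> (0 < N)%N ->
  nideal (bMP kb n) (thrice (elim_bound G (statelevel N))) J ->
  (forall t : seq (MP k n), uniq t -> (forall p, p \in t -> bMP kb n N p /\ ~ J p) ->
     ~ J (\prod_(p <- t) p)) ->
  exists (L : fieldType) (iota : {rmorphism k -> L}) (x : nat -> L), agrees N iota x.
Proof.
move=> le_n N_gt0 iJ prodJ; have [E [s Es]] := state_exists le_n.
have [bE bs H] := state_bounded le_n N_gt0 Es; have [ltn _] := H 0%N (leq0n n).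
have Mok := bok_MP gG n kok.
apply: NNPP => nex; have np : no_points (cst n) E s.
  move=> L h _ hE; apply/eqP; apply: contraT => hs; case: nex.
  pose iota : {rmorphism k -> L} := (h \o cst n : {rmorphism k -> L}).
  exists L, iota, (fun i => h (var n i)).
  have hev : h =1 ev iota (fun i => h (var n i)) n by apply: ev_uniq.
  by apply/(state_agrees _ _ Es); split=> [e Ee|]; rewrite -hev //; apply: hE.
have lt_n : (n + 0 < statelevel N)%N by apply: leq_ltn_trans ltn; rewrite leq_add2l.
have sE : (size E <= statelevel N)%N.
  by have [_] := H 0%N (leq0n n); rewrite addn0 => /ltnW.
have [rho [rho0 br Jr]] := elimination gG kok lt_n sE bE bs np.
set M := elim_bound G (statelevel N) in iJ br Jr.
have le_M : (statelevel N <= M)%N := growth_infl (growth_elim_bound gG) _.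
have le_MT : (M <= thrice M)%N := growth_infl growth_thrice M.
have le_PT : (Phi (Phi M) <= thrice M)%N := growth_infl gPhi _.
have Es' := Es; have [_ EP [t [sE' t_uniq _ tP]]] := Es'.
apply: (prodJ t t_uniq (fun p tp => proj1 (tP p) tp)); rewrite -sE'.
have -> : s = cst n rho^-1 * (cst n rho * s).
  by rewrite mulrA -rmorphM mulVf // rmorph1 mul1r.
have r_M : (n + 0 <= M)%N := leq_trans (ltnW lt_n) le_M.
apply: (nidealM iJ).
- apply: (bcst gG n kok); apply: (bok_mono kok _ (kbV br)).
  exact: leq_trans (G_Phi gG M) (leq_trans (growth_infl gPhi _) le_PT).
- apply: (bok_mono Mok (leq_trans (growth_infl gPhi _) le_PT)).
  apply: (bM gG Mok r_M); last exact: (bok_mono Mok le_M).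
  exact: (bcst gG n kok).
apply: Jr => [|e /EP[] //]; exact: (nideal_mono Mok le_MT).
Qed.

Definition achieved N d := exists (L : fieldType) (iota : {rmorphism k -> L}) (x : nat -> L)
  (tau : nat -> nat), [/\ agrees N iota x, forall i, (i < d)%N -> (tau i < n)%N &
    indep iota (fun i => x (tau i)) d].

Lemma achieved_leq N d : achieved N d -> (d <= n)%N.
Proof. by move=> [L [iota [x [tau [_ H ind]]]]]; apply: (indep_leq H ind). Qed.

Lemma agrees_mono N M (L : fieldType) (iota : {rmorphism k -> L}) x :
  (N <= M)%N -> agrees M iota x -> agrees N iota x.
Proof. by move=> le ag p bp; apply: ag; apply: (bok_mono (bok_MP gG n kok) le). Qed.

(** As no point of level [N] has [d.+1] independent coordinates, the coordinates of every such
    point, not just those of [a], satisfy the relations that [determination_at] asks for. *)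
Lemma vanishing_determined N d (L : fieldType) (iota : {rmorphism k -> L}) a tau :
  (n <= N)%N -> (0 < N)%N -> agrees N iota a ->
  (forall i, (i < d)%N -> (tau i < n)%N) -> indep iota (fun i => a (tau i)) d ->
  ~ achieved N d.+1 ->
  exists (S : seq (MP k n)) (t : MP k n),
    [/\ (size S <= detbound (statelevel N))%N,
        forall e, e \in t :: S -> bMP kb n (detbound (statelevel N)) e,
        forall e, e \in S -> ev iota a n e = 0,
        ev iota a n t != 0 &
        forall (L' : fieldType) (iota' : {rmorphism k -> L'}) x,
          (forall e, e \in S -> ev iota' x n e = 0) -> ev iota' x n t != 0 ->
          forall g, ev iota a n g = 0 -> ev iota' x n g = 0].
Proof.
move=> le_n N_gt0 ag tau_lt ind nach; have [E [s Es]] := state_exists le_n.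
have [bE bs H] := state_bounded le_n N_gt0 Es.
have le_d := indep_leq tau_lt ind; have [lt1 lt2] := H d le_d.
have le_nn : (n + n <= statelevel N)%N.
  by apply: leq_trans (ltnW lt1); rewrite leq_add2l; apply: leqW; apply: leq_addr.
have [aE as0] := proj1 (state_agrees iota a Es) ag.
have [|S [t [sS bS aS at0 det]]] := determination_at (xi := id) gG kok k_factor
  (fun j lt_j => lt_j) tau_lt lt1 le_nn lt2 bE bs aE as0 ind.
  move=> L' iota' x xE xs j lt_j.
  have agx : agrees N iota' x by apply/(state_agrees _ _ Es).
  have [ext|//] := dependent_or_extend iota' x d tau j; case: nach.
  exists L', iota', x, (fun i => if (i < d)%N then tau i else j); split=> // i _.
  by case: ifP => // lt_i; apply: (tau_lt _ lt_i).
exists S, t; split=> //.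
by move=> e /bS; apply: (bok_mono (bok_MP gG n kok)); apply: (growth_infl growth_finf).
Qed.

(** The parameters are a maximal independent family among the selected coordinates of [a]. The
    relations at [a] hold at every point satisfying [S] and [t], by the last hypothesis, so they
    serve at all those points. *)
Lemma sub_determined M q (xi : nat -> nat) (L : fieldType) (iota : {rmorphism k -> L}) a
    (S : seq (MP k n)) t :
  (n <= M)%N -> (q <= n)%N -> (0 < M)%N -> (forall j, (j < q)%N -> (xi j < n)%N) ->
  (size S <= M)%N -> (forall e, e \in t :: S -> bMP kb n M e) ->
  (forall e, e \in S -> ev iota a n e = 0) -> ev iota a n t != 0 ->
  (forall (L' : fieldType) (iota' : {rmorphism k -> L'}) x,
    (forall e, e \in S -> ev iota' x n e = 0) -> ev iota' x n t != 0 ->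
    forall g, ev iota a n g = 0 -> ev iota' x n g = 0) ->
  exists (S' : seq (MP k q)) (t' : MP k q),
    [/\ forall e, e \in t' :: S' -> bMP kb q (detbound (thrice M)) e,
        forall e, e \in S' -> ev iota (fun j => a (xi j)) q e = 0,
        ev iota (fun j => a (xi j)) q t' != 0 &
        forall (L' : fieldType) (iota' : {rmorphism k -> L'}) x,
          (forall e, e \in S' -> ev iota' x q e = 0) -> ev iota' x q t' != 0 ->
          forall g, ev iota (fun j => a (xi j)) q g = 0 -> ev iota' x q g = 0].
Proof.
move=> le_n le_q M_gt0 xi_lt sS bS aS at0 det; have Mok := bok_MP gG n kok.
have lt_M := thrice_ge M_gt0; have le_M := growth_infl growth_thrice M.
have [d [tau [le_d tau_lt ind hdep]]] := max_indep iota (fun j => a (xi j)) q.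
have lt1 : (n + (q + (d + 0)).+1 < thrice M)%N.
  by move: lt_M le_n le_q le_d; move: (thrice M) => T; clear; lia.
have le_qq : (q + q <= thrice M)%N.
  by move: lt_M le_n le_q; move: (thrice M) => T; clear; lia.
have lt2 : (size S + d < thrice M)%N.
  by move: lt_M le_n le_q le_d sS; move: (thrice M) (size S) => T b; clear; lia.
have b1 e : e \in S -> bMP kb n (thrice M) e.
  by move=> Se; apply: (bok_mono Mok le_M); apply: bS; rewrite inE Se orbT.
have b2 : bMP kb n (thrice M) t.
  by apply: (bok_mono Mok le_M); apply: bS; apply: mem_head.
have [|S' [t' [_ bS' aS' at' det']]] :=
    determination_at gG kok k_factor xi_lt tau_lt lt1 le_qq lt2 b1 b2 aS at0 ind.
  move=> L' iota' x xS xt j lt_j; have [g g0 gE] := hdep j lt_j.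
  exists g => //; pose y i := if (i < d)%N then var n (xi (tau i)) else var n (xi j) : MP k n.
  have lt_y (T : fieldType) (io : {rmorphism k -> T}) z :
    ev io z n (ev (cst n) y d.+1 g) =
    ev io (fun i => if (i < d)%N then z (xi (tau i)) else z (xi j)) d.+1 g.
    apply: ev_comp => [c|i _]; first exact: ev_cst.
    by rewrite /y; case: ltnP => lt_i; rewrite ev_var ?xi_lt ?tau_lt.
  by rewrite -lt_y; apply: det => //; rewrite lt_y.
exists S', t'; split=> //.
by move=> e /bS'; apply: (bok_mono (bok_MP gG q kok)); apply: (growth_infl growth_finf).
Qed.

End Ideal.

Section Shifts.
Variables (q m : nat).
Let n := (q + m)%N.

Definition incl : {rmorphism MP k q -> MP k n} := ev (cst n) (fun i => var n i) q.
Definition shft : {rmorphism MP k q -> MP k n} :=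
  ev (cst n \o vs : {rmorphism k -> MP k n}) (fun i => var n (i + m)) q.

Lemma ev_incl (L : fieldType) (iota : {rmorphism k -> L}) x p :
  ev iota x n (incl p) = ev iota x q p.
Proof.
apply: ev_comp => [c|i lt_i]; first exact: ev_cst.
by rewrite ev_var // (leq_trans lt_i) // leq_addr.
Qed.

Lemma ev_shft (L : fieldType) (iota : {rmorphism k -> L}) x p :
  ev iota x n (shft p) = ev (iota \o vs : {rmorphism k -> L}) (fun i => x (i + m)%N) q p.
Proof.
apply: ev_comp => [c|i lt_i] /=; first by rewrite ev_cst.
by rewrite ev_var // ltn_add2r.
Qed.

Lemma embed_bounded N p : (n <= N)%N -> (0 < N)%N -> bMP kb q (Phi N) p ->
  bMP kb n (embedlevel N) (incl p) /\ bMP kb n (embedlevel N) (shft p).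
Proof.
move=> le_n N_gt0 bp; have Mok := bok_MP gG n kok.
have le1 := growth_infl gPhi N; have le2 := growth_infl gPhi (Phi N).
have le_12 := leq_trans le1 le2.
have r_N : (n + 0 <= Phi (Phi N))%N by rewrite addn0 (leq_trans le_n).
have N2_gt0 := leq_trans N_gt0 le_12.
have lev : (iter q Psi (Phi (Phi N)) <= embedlevel N)%N.
  apply: iter_mono => //; apply: leq_trans le_12; apply: leq_trans le_n.
  exact: leq_addr.
split; apply: (bok_mono Mok lev); apply: (bev gG Mok r_N le2 _ _ bp).
- by move=> c bc; apply: (bcst gG n kok); apply: (bok_mono kok le2).
- by move=> i _; apply: (bvar gG n i kok).
- move=> c bc /=; apply: (bcst gG n kok); apply: (bok_mono kok _ (kb_vs bc)).
  exact: G_Phi.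
- by move=> i _; apply: (bvar gG n _ kok).
Qed.

(** [S1] and [t1] determine the first [q] coordinates and are small enough to pass through [J] to
    the shifted ones; this is one implication of [compatible]. [S2] and [t2], for the last [q]
    coordinates, give the converse after twisting coefficients by [vsi]. *)
Lemma levels_step (J : MP k n -> Prop) N d (L : fieldType) (iota : {rmorphism k -> L}) a tau :
  (n <= N)%N -> (0 < N)%N -> agrees J (step N) iota a ->
  (forall i, (i < d)%N -> (tau i < n)%N) -> indep iota (fun i => a (tau i)) d ->
  ~ achieved J N d.+1 ->
  (forall p, bMP kb q (step N) p -> J (incl p) <-> J (shft p)) ->
  compatible vs m iota a q.
Proof.
move=> le_n N_gt0 ag tau_lt ind nach Jc.
have le_step := growth_infl growth_step N.
have [S [t [sS bS aS at0 det]]] :=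
  vanishing_determined le_n N_gt0 (agrees_mono le_step ag) tau_lt ind nach.
move: Jc ag {le_step}; rewrite /step; set Nb := detbound (statelevel N) in sS bS *.
have le_Nb : (N <= Nb)%N.
  by apply: leq_trans (growth_infl growth_statelevel N) (growth_infl growth_detbound _).
have le_nb := leq_trans le_n le_Nb; have Nb_gt0 := leq_trans N_gt0 le_Nb.
have [|S1 [t1 [bS1 aS1 at1 det1]]] :=
  sub_determined (xi := id) (q := q) le_nb (leq_addr m q) Nb_gt0 _ sS bS aS at0 det.
  by move=> j lt_j; apply: leq_trans lt_j (leq_addr _ _).
have [|S2 [t2 [bS2 aS2 at2 det2]]] :=
  sub_determined (xi := addn^~ m) (q := q) le_nb (leq_addr m q) Nb_gt0 _ sS bS aS at0 det.
  by move=> j lt_j; rewrite ltn_add2r.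
have le_Nd : (Nb <= detbound (thrice Nb))%N.
  by apply: leq_trans (growth_infl growth_thrice Nb) (growth_infl growth_detbound _).
have {le_nb} le_nd := leq_trans le_nb le_Nd; have {Nb_gt0} Nd_gt0 := leq_trans Nb_gt0 le_Nd.
move: (detbound (thrice Nb)) bS1 bS2 le_nd Nd_gt0 => Nd bS1 bS2 le_nd Nd_gt0 Jc ag.
have Qok := bok_MP gG q kok.
have le_e : (Phi Nd <= embedlevel Nd)%N.
  by apply: leq_trans (growth_infl gPhi _) (iter_infl _ _ gPsi).
have link p : bMP kb q (Phi Nd) p -> ev iota a q p = 0 <->
    ev (iota \o vs : {rmorphism k -> L}) (fun i => a (i + m)%N) q p = 0.
  move=> bp; have [b1 b2] := embed_bounded le_nd Nd_gt0 bp.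
  rewrite -ev_incl -ev_shft (ag _ b1) (ag _ b2); apply: Jc.
  exact: (bok_mono Qok le_e).
have bS1' e : e \in t1 :: S1 -> bMP kb q (Phi Nd) e.
  by move/bS1; apply: (bok_mono Qok); apply: (growth_infl gPhi).
have tw (io : {rmorphism k -> L}) x e :
    ev (io \o vsi : {rmorphism k -> L}) x q e = ev io x q (MPmap vsi q e).
  by symmetry; apply: ev_MPmap.
have vv x e : ev ((iota \o vs) \o vsi : {rmorphism k -> L}) x q e = ev iota x q e.
  by apply: eq_ev => // c /=; rewrite vsiK.
have link2 e : e \in t2 :: S2 ->
    ev (iota \o vsi : {rmorphism k -> L}) a q e = 0 <->
    ev iota (fun i => a (i + m)%N) q e = 0.
  move=> /bS2 be; rewrite tw -[ev iota (fun i => _) q e]vv tw; apply: link.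
  apply: bMPmap (growth_infl gPhi Nd) _ be => c bc.
  by apply: (bok_mono kok (G_Phi gG Nd)); apply: kb_vsi.
move=> p; split=> [ap|ap].
  apply: det1 ap => [e Se|]; first by apply/link; [apply: bS1'; rewrite inE Se orbT | apply: aS1].
  apply/eqP => /(link _ (bS1' _ (mem_head _ _))) E0; case/eqP: at1; exact: E0.
have -> : ev iota a q p = ev (iota \o vsi : {rmorphism k -> L}) a q (MPmap vs q p).
  rewrite (ev_MPmap (h := iota)) // => c /=; by rewrite vsK.
apply: det2.
- by move=> e Se; apply/link2; [rewrite inE Se orbT | apply: aS2].
- by apply/eqP => /(link2 _ (mem_head _ _)) E0; case/eqP: at2; exact: E0.
by rewrite (ev_MPmap (h := iota \o vs : {rmorphism k -> L})).
Qed.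

Definition toplevel N := iter n.+1 step N.

Theorem compatible_point (J : MP k n -> Prop) N : (n <= N)%N -> (0 < N)%N ->
  nideal (bMP kb n) (thrice (elim_bound G (statelevel (toplevel N)))) J ->
  (forall t : seq (MP k n), uniq t ->
     (forall p, p \in t -> bMP kb n (toplevel N) p /\ ~ J p) -> ~ J (\prod_(p <- t) p)) ->
  (forall p, bMP kb q (toplevel N) p -> J (incl p) <-> J (shft p)) ->
  exists (L : fieldType) (iota : {rmorphism k -> L}) (a : nat -> L),
    agrees J N iota a /\ compatible vs m iota a q.
Proof.
move=> le_n N_gt0 iJ prodJ Jc; have lev i := iter_infl i N growth_step.
have le_top : (N <= toplevel N)%N := lev _.
(* The number of independent coordinates of points of a level cannot drop at each of
   [n.+1] steps. *)
have [i [d [le_i ach nach]]] : exists i d, [/\ (i <= n)%N,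
    achieved J (iter i.+1 step N) d & ~ achieved J (iter i step N) d.+1].
  apply: NNPP => nex.
  have H i : (i <= n.+1)%N -> achieved J (iter (n.+1 - i) step N) i.
    elim: i => [_|i IH lt_i].
      have [L [iota [x ag]]] := agrees_exists (leq_trans le_n le_top)
        (leq_trans N_gt0 le_top) iJ prodJ.
      by exists L, iota, x, id; split=> //; apply: indep0.
    apply: NNPP => nach; apply: nex; exists (n.+1 - i.+1)%N, i; split=> //.
      by rewrite subSS leq_subr.
    have -> : (n.+1 - i.+1).+1 = (n.+1 - i)%N by rewrite subnSK.
    exact/IH/ltnW.
  by have /achieved_leq := H n.+1 (leqnn _); rewrite ltnn.
have [L [iota [a [tau [ag tau_lt ind]]]]] := ach; exists L, iota, a.
have le_lev : (iter i.+1 step N <= toplevel N)%N.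
  by apply: iter_mono => //; exact: growth_step.
split; first exact: (agrees_mono (lev i.+1)).
apply: (levels_step (leq_trans le_n (lev i)) (leq_trans N_gt0 (lev i)) ag tau_lt ind nach).
by move=> p bp; apply: Jc; apply: (bok_mono (bok_MP gG q kok) le_lev).
Qed.

End Shifts.
End Levels.

(** * Saturation by a colon ideal *)

Section Saturation.
Variables (G : nat -> nat) (gG : growth G).
Variables (k : fieldType) (kb : nat -> k -> Prop).
Hypothesis kok : bok G kb 0.
Notation Phi := (Phi G).
Notation Om := (Om G).
Let gPhi := growth_Phi gG.

Lemma maximal_product (R : comNzRingType) (J : R -> Prop) (U : seq R) f : ~ J f ->
  exists X : seq R, [/\ uniq X, {subset X <= U}, ~ J (f * \prod_(p <- X) p) &
    forall p, p \in U -> p \in X \/ J (p * (f * \prod_(p <- X) p))].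
Proof.
move=> nJf; pose P d := exists X : seq R,
  [/\ uniq X, {subset X <= U}, ~ J (f * \prod_(p <- X) p) & size X = d].
have [d [[X [uX sX nX <-]] nP]] : exists d, P d /\ ~ P d.+1.
  apply: NNPP => nex; have : P (size U).+1.
    elim: (size U).+1 => [|d IH]; first by exists [::]; rewrite big_nil mulr1.
    by apply: NNPP => nP; apply: nex; exists d.
  by move=> [X [uX sX _ E]]; have := uniq_leq_size uX sX; rewrite E ltnn.
exists X; split=> // p Up; case: (boolP (p \in X)) => [|pX]; [by left | right].
apply: NNPP => nJ; apply: nP; exists (p :: X); split=> //=; first by rewrite pX.
  by move=> x; rewrite inE => /orP[/eqP->|/sX].
by rewrite big_cons mulrCA.
Qed.

Definition satlevel N := iter (Phi N).+1 Phi N.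

(** By maximality, a small polynomial outside the colon ideal is a factor of [s]. A product of
    distinct such polynomials then divides [s]; were it in the colon ideal, [J] would contain
    [s * s] and so [s]. *)
Lemma saturation n (J : MP k n -> Prop) N K f :
  (n <= N)%N -> (satlevel N <= K)%N -> bMP kb n N f -> nideal (bMP kb n) (Om K) J -> ~ J f ->
  exists s, let J' := fun x => J (x * s) in
    [/\ bMP kb n K s, nideal (bMP kb n) K J', ~ J' f &
      forall t : seq (MP k n), uniq t ->
        (forall p, p \in t -> bMP kb n N p /\ ~ J' p) -> ~ J' (\prod_(p <- t) p)].
Proof.
move=> le_n le_K bf iJ nJf; have Mok := bok_MP gG n kok.
have n0 : (n + 0 <= N)%N by rewrite addn0.
have [U sU UP] := bF Mok n0.
have [V [/size_subseq sVU VP]] := classical_filter (undup U) (bMP kb n N).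
have {}sVU : (size V <= Phi N)%N by apply: leq_trans sVU (leq_trans (size_undup U) sU).
have [X [uX sX nX XP]] := maximal_product V nJf.
have sub_bounded (Y : seq (MP k n)) : uniq Y -> {subset Y <= X} ->
    bMP kb n (iter (Phi N) Phi N) (\prod_(p <- Y) p).
  move=> uY sY; have bY p : p \in Y -> bMP kb n N p by move=> /sY/sX/VP[].
  have b := bprod_in gG kok n0 bY; apply: (bok_mono Mok _ b); apply: iter_mono => //.
  by apply: leq_trans sVU; apply: uniq_leq_size uY _ => p /sY; exact: sX.
have le_it := iter_infl (Phi N) N gPhi.
have bfY (Y : seq (MP k n)) : uniq Y -> {subset Y <= X} -> bMP kb n K (f * \prod_(p <- Y) p).
  move=> uY sY; apply: (bok_mono Mok le_K); rewrite /satlevel iterS.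
  apply: (bM gG Mok (leq_trans n0 le_it)); last exact: sub_bounded.
  exact: (bok_mono Mok le_it).
set s := f * \prod_(p <- X) p in nX XP; have bs : bMP kb n K s by apply: bfY.
have le_NK : (N <= K)%N.
  by apply: leq_trans le_K; apply: leq_trans le_it _; apply: growth_infl gPhi _.
have le_nK : (n + 0 <= K)%N := leq_trans n0 le_NK.
have le_PK : (Phi K <= Om K)%N by do 11!apply: leq_trans (growth_infl gPhi _).
have le_O : (K <= Om K)%N := growth_infl (growth_Om gG) K.
have b_prod (Y : seq (MP k n)) : uniq Y -> {subset Y <= X} -> bMP kb n K (\prod_(p <- Y) p).
  move=> uY sY; apply: (bok_mono Mok _ (sub_bounded Y uY sY)).
  by apply: leq_trans le_K; apply: growth_infl gPhi _.
have square g c : bMP kb n K g -> bMP kb n K c -> s = c * g -> ~ J (g * s).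
  move=> bg bc sE Jg; apply: nX; apply: (nidealR iJ); first exact: (bok_mono Mok le_O).
  have -> : s * s = c * (g * s) by rewrite {1}sE mulrA.
  apply: (nidealM iJ) => //; first exact: (bok_mono Mok le_O).
  by apply: (bok_mono Mok le_PK); apply: (bM gG Mok le_nK).
exists s => J'; split=> //; first exact: (nideal_colon gG Mok le_nK bs iJ).
  by apply: (square f (\prod_(p <- X) p)); [exact: (bok_mono Mok le_NK) | exact: b_prod | rewrite mulrC].
move=> t ut tP; have st : {subset t <= X}.
  move=> p tp; have [bp nJp] := tP p tp; have [|//|Jp] := XP p; last by case: nJp.
  by apply/VP; rewrite mem_undup; split=> //; apply: UP.
have sr : {subset [seq x <- X | x \notin t] <= X} by move=> x; rewrite mem_filter => /andP[].
apply: (square _ (f * \prod_(p <- [seq x <- X | x \notin t]) p)); [exact: b_prod | |].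
  by apply: bfY => //; apply: filter_uniq.
have XE : perm_eq X (t ++ [seq x <- X | x \notin t]).
  apply: uniq_perm => //.
    rewrite cat_uniq ut filter_uniq // andbT /=; apply/hasPn => x.
    by rewrite mem_filter => /andP[].
  by move=> x; rewrite mem_cat mem_filter; case: (boolP (x \in t)) => // /st ->.
by rewrite /s (perm_big _ XE) big_cat /= -mulrA [X in f * X]mulrC.
Qed.
End Saturation.

(** * Certificates *)

Lemma chead_code a s : chead (CodeSeq.code (a :: s)) = a.
Proof. by rewrite /chead CodeSeq.codeK. Qed.

Lemma ctail_code a s : ctail (CodeSeq.code (a :: s)) = CodeSeq.code s.
Proof. by rewrite /ctail CodeSeq.codeK. Qed.

Lemma code_consP r a s :
  r = CodeSeq.code (a :: s) <-> [/\ (0 < r)%N, chead r = a & ctail r = CodeSeq.code s].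
Proof.
split=> [->|[r_gt0 <- tE]]; first by rewrite chead_code ctail_code lt0n code_eq0.
by rewrite code_cons -tE; apply: code_head_tail.
Qed.

(** * Coded difference polynomials *)

Section Terms.
Variables (k : fieldType) (code : k -> nat) (m : nat).
Hypothesis code_inj : injective code.
Variables (KS : nat -> bool) (Fa Fm : nat -> nat -> nat) (Fs : nat -> nat).
Variable vs : {rmorphism k -> k}.
Hypothesis KSP : forall n, KS n <-> exists a, code a = n.
Hypothesis FaE : forall a b, Fa (code a) (code b) = code (a + b).
Hypothesis FmE : forall a b, Fm (code a) (code b) = code (a * b).
Hypothesis FsE : forall a, Fs (code a) = code (vs a).
Notation dterm := (k * seq (dvar m))%type.
Notation dterms := (Defs.dterms k m).
Notation dc := (dterms_code code).

Definition vcode (v : dvar m) := CodeSeq.code [:: val v.1; v.2].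
Definition tcode (u : dterm) := CodeSeq.code (code u.1 :: map vcode u.2).

Lemma vcode_inj : injective vcode.
Proof.
move=> [i j] [i' j'] /(can_inj CodeSeq.codeK) [E ->]; congr pair; exact: val_inj.
Qed.

Lemma dterms_codeE (t : dterms) : dc t = CodeSeq.code (map tcode t).
Proof. by []. Qed.

Definition termProd p q r :=
  [&& (0 < r)%N, chead r == Fm (chead p) (chead q) & isCat (ctail p) (ctail q) (ctail r)].

Definition term_mul (u v : dterm) : dterm := (u.1 * v.1, u.2 ++ v.2).

Lemma termProdP u v r : termProd (tcode u) (tcode v) r <-> r = tcode (term_mul u v).
Proof.
rewrite /termProd !chead_code !ctail_code FmE isCatE !(CodeSeq.codeK (map vcode _)) -map_cat.
rewrite code_consP; split=> [/and3P[r_gt0 /eqP-> /eqP E]|[-> -> ->]].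
  by split=> //; rewrite -E CodeSeq.decodeK.
by rewrite CodeSeq.codeK !eqxx.
Qed.

Definition varShift v w := (csize w == 2) && (cnth w 0 == cnth v 0) && (cnth w 1 == (cnth v 1).+1).

Lemma code2P a b w : (csize w == 2) && (cnth w 0 == a) && (cnth w 1 == b) <->
  w = CodeSeq.code [:: a; b].
Proof.
rewrite /csize /cnth -{4}[w]CodeSeq.decodeK; split=> [|/(can_inj CodeSeq.codeK)->].
  by case: (CodeSeq.decode w) => [|x [|y [|]]] //= /andP[/eqP-> /eqP->].
by rewrite /= !eqxx.
Qed.

Lemma varShiftP v w : varShift (vcode v) w <-> w = vcode (dvar_shift v).
Proof. by rewrite /varShift code2P /vcode /cnth CodeSeq.codeK. Qed.

Definition termSigma p r :=
  [&& (0 < r)%N, chead r == Fs (chead p) & isMap varShift (ctail p) (ctail r)].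

Definition term_sigma (u : dterm) : dterm := (vs u.1, map (@dvar_shift m) u.2).

Lemma termSigmaP u r : termSigma (tcode u) r <-> r = tcode (term_sigma u).
Proof.
rewrite /termSigma !chead_code !ctail_code FsE.
have H := isMapP u.2 (ctail r) varShiftP.
rewrite code_consP -map_comp; split=> [/and3P[r_gt0 /eqP-> /H]|[-> -> /H->]] //.
by rewrite eqxx.
Qed.

Definition isMul := isProd termProd.
Definition isSigma := isMap termSigma.
Definition terms_mul (b a : dterms) : dterms := [seq term_mul u v | u <- b, v <- a].
Definition terms_sigma (a : dterms) : dterms := map term_sigma a.

Lemma isMulP (b a : dterms) x : isMul (dc b) (dc a) x <-> x = dc (terms_mul b a).
Proof.
rewrite [dc (terms_mul _ _)]dterms_codeE /terms_mul map_allpairs; exact: (isProdP b a x termProdP).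
Qed.

Lemma isSigmaP (a : dterms) x : isSigma (dc a) x <-> x = dc (terms_sigma a).
Proof. by rewrite [dc (terms_sigma _)]dterms_codeE -map_comp; exact: (isMapP a x termSigmaP). Qed.

Lemma isCatP (a b : dterms) x : isCat (dc a) (dc b) x <-> x = dc (a ++ b).
Proof.
rewrite !dterms_codeE isCatE !CodeSeq.codeK -map_cat; split=> [/eqP E|->].
  by rewrite -E CodeSeq.decodeK.
by rewrite CodeSeq.codeK.
Qed.

Definition validVar n v := (csize v == 2) && (cnth v 0 < n)%N.
Definition validTerm n p :=
  [&& (0 < p)%N, KS (chead p) & allb (csize (ctail p)) (fun u => validVar n (cnth (ctail p) u))].
(** Numbers guessed in a certificate have to pass this test, so that they stand for difference
    polynomials. *)
Definition valid n a := allb (csize a) (fun u => validTerm n (cnth a u)).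

Lemma validVarP v : validVar m v <-> exists w, v = vcode w.
Proof.
rewrite /validVar; split=> [|[w ->]]; last by rewrite /csize /cnth CodeSeq.codeK /=.
rewrite /csize /cnth -{3}[v]CodeSeq.decodeK.
case: (CodeSeq.decode v) => [|i [|j []]] //= lt_i.
by exists (Ordinal lt_i, j).
Qed.

Lemma validTermP p : validTerm m p <-> exists u, p = tcode u.
Proof.
rewrite /validTerm all_decode; split=> [/and3P[p_gt0 /KSP[c cE]]|[u ->]].
  move/(all_mapP _ validVarP) => [w wE]; exists (c, w).
  by apply/code_consP; split=> //; rewrite -wE CodeSeq.decodeK.
rewrite chead_code ctail_code CodeSeq.codeK lt0n code_eq0 andTb; apply/andP; split.
  by apply/KSP; exists u.1.
by apply/(all_mapP _ validVarP); exists u.2.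
Qed.

Lemma validP a : valid m a <-> exists t : dterms, a = dc t.
Proof.
rewrite /valid all_decode (all_mapP _ validTermP); split=> -[t tE]; exists t.
  by rewrite dterms_codeE -tE CodeSeq.decodeK.
by rewrite tE CodeSeq.codeK.
Qed.

Definition monom (w : seq (dvar m)) : {cmonom dvar m} := \big[mmul/mone]_(v <- w) ucm v.

Lemma dX_prod w : \prod_(v <- w) dX k v = << monom w >>.
Proof.
have fgX (c d : {cmonom dvar m}) : << c >> * << d >> = << mmul c d >> :> dpoly k m.
  by rewrite malgM_def fgmulUU mulr1.
rewrite /monom; elim: w => [|v w IH]; first by rewrite !big_nil.
rewrite big_cons IH fgX; congr << _ >>; by rewrite big_cons.
Qed.

Lemma monomE w v : monom w v = count_mem v w.
Proof.
rewrite /monom; elim: w => [|u w IH]; first by rewrite big_nil cm1.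
by rewrite big_cons cmM cmU IH.
Qed.

Lemma monom_eq w w' : (monom w == monom w') = perm_eq w w'.
Proof.
apply/eqP/allP => [E x _ /=|H]; first by rewrite -!monomE E.
apply/eqP/cmP => v; rewrite !monomE; case: (boolP (v \in w ++ w')) => [/H/eqP//|].
by rewrite mem_cat negb_or => /andP[/count_memPn-> /count_memPn->].
Qed.

Lemma dpoly_coef (t : dterms) w :
  (dpoly_of t)@_(monom w) = \sum_(u <- t | perm_eq u.2 w) u.1.
Proof.
rewrite /dpoly_of raddf_sum /= [RHS]big_mkcond /=; apply: eq_bigr => u _.
rewrite dX_prod /dC malgM_def fgmulUU mul1m mulr1 mcoeffU monom_eq.
by case: perm_eq; rewrite ?mulr1n ?mulr0n.
Qed.

Definition coefSum c0 a w n := nat_rect (fun=> nat) c0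
  (fun i r => if sameMon (ctail (cnth a i)) w then Fa r (chead (cnth a i)) else r) n.

Lemma coefSumE (t : dterms) w :
  coefSum (code 0) (dc t) (CodeSeq.code (map vcode w)) (csize (dc t)) =
  code (\sum_(u <- t | perm_eq u.2 w) u.1).
Proof.
pose u0 : dterm := (0, [::]); rewrite /csize CodeSeq.codeK size_map -{3}[t]take_size.
suff H n : (n <= size t)%N -> coefSum (code 0) (dc t) (CodeSeq.code (map vcode w)) n =
    code (\sum_(u <- take n t | perm_eq u.2 w) u.1) by apply: H.
elim: n => [|n IH] lt_n; first by rewrite take0 big_nil.
rewrite (take_nth u0) // -cats1 big_cat /= big_cons big_nil addr0 IH 1?ltnW //.
rewrite /cnth CodeSeq.codeK (nth_map u0) // chead_code ctail_code sameMonE !CodeSeq.codeK.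
have pE : perm_eq [seq vcode v | v <- (nth u0 t n).2] [seq vcode v | v <- w] = perm_eq (nth u0 t n).2 w.
  by apply/idP/idP => [/(perm_map_inj vcode_inj)|]; last exact: perm_map.
by rewrite pE; case: ifP => _; rewrite ?FaE ?addr0.
Qed.

(** Comparing coefficients at the monomials that occur in either presentation suffices: all other
    coefficients are 0. *)
Definition eqPoly c0 a x :=
  allb (csize a) (fun u => coefSum c0 a (ctail (cnth a u)) (csize a) ==
                           coefSum c0 x (ctail (cnth a u)) (csize x)) &&
  allb (csize x) (fun u => coefSum c0 a (ctail (cnth x u)) (csize a) ==
                           coefSum c0 x (ctail (cnth x u)) (csize x)).

Lemma eqPolyP (s t : dterms) : eqPoly (code 0) (dc s) (dc t) <-> dpoly_of s = dpoly_of t.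
Proof.
have all_mem (r : dterms) : allb (csize (dc r)) (fun u =>
    coefSum (code 0) (dc s) (ctail (cnth (dc r) u)) (csize (dc s)) ==
    coefSum (code 0) (dc t) (ctail (cnth (dc r) u)) (csize (dc t))) =
    all (fun u : dterm => (dpoly_of s)@_(monom u.2) == (dpoly_of t)@_(monom u.2)) r.
  rewrite (all_decode (fun p => coefSum (code 0) (dc s) (ctail p) (csize (dc s)) ==
    coefSum (code 0) (dc t) (ctail p) (csize (dc t)))) CodeSeq.codeK all_map.
  by apply: eq_all => u /=; rewrite ctail_code !coefSumE (inj_eq code_inj) !dpoly_coef.
rewrite /eqPoly !all_mem -all_cat; split=> [/allP H|->]; last by apply/allP.
apply/malgP => w.
case: (boolP (has (fun u : dterm => monom u.2 == w) (s ++ t))) => [/hasP[u stu /eqP<-]|].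
  by apply/eqP; apply: H.
have coef0 (r : dterms) : ~~ has (fun u : dterm => monom u.2 == w) r -> (dpoly_of r)@_w = 0.
  move=> /hasPn nr; rewrite /dpoly_of raddf_sum /= big_seq big1 // => u ru.
  rewrite dX_prod /dC malgM_def fgmulUU mul1m mulr1 mcoeffU.
  by rewrite (negPf (nr u ru)) mulr0n.
by rewrite has_cat negb_or => /andP[/coef0-> /coef0->].
Qed.

Lemma dpoly_cat (s t : dterms) : dpoly_of (s ++ t) = dpoly_of s + dpoly_of t.
Proof. by rewrite /dpoly_of big_cat. Qed.

Lemma dpoly_mul (s t : dterms) : dpoly_of (terms_mul s t) = dpoly_of s * dpoly_of t.
Proof.
rewrite /dpoly_of /terms_mul big_allpairs_dep mulr_suml; apply: eq_bigr => u _.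
rewrite mulr_sumr; apply: eq_bigr => v _ /=.
have -> : dC m (u.1 * v.1) = dC m u.1 * dC m v.1 by apply: rmorphM.
by rewrite big_cat /=; apply: mulrACA.
Qed.

Lemma rmorph_dpoly_of (S : comNzRingType) (h : {rmorphism dpoly k m -> S}) (t : dterms) :
  h (dpoly_of t) = \sum_(u <- t) h (dC m u.1) * \prod_(v <- u.2) h (dX k v).
Proof.
rewrite /dpoly_of rmorph_sum; apply: eq_bigr => u _.
by rewrite rmorphM rmorph_prod.
Qed.

Lemma dpoly_sigma (t : dterms) : dpoly_of (terms_sigma t) = dsigma vs (dpoly_of t).
Proof.
have [ds [E C X]] : exists ds : {rmorphism dpoly k m -> dpoly k m},
    [/\ forall f, ds f = dsigma vs f, forall c, ds (dC m c) = dC m (vs c) &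
        forall v, ds (dX k v) = dX k (dvar_shift v)].
  by exists (dsigma vs); split=> [//|c|v]; [exact: dsigmaC | exact: dsigmaX].
rewrite -E rmorph_dpoly_of /dpoly_of /terms_sigma big_map.
apply: eq_bigr => u _; congr (_ * _); first exact: (esym (C u.1)).
rewrite big_map; apply: eq_bigr => v _; exact: (esym (X v)).
Qed.

End Terms.

Lemma hasb_drop (Q : nat -> bool) s i :
  hasb (size s) (fun j => (i < j)%N && Q (nth 0%N s j)) = has Q (drop i.+1 s).
Proof.
apply/hasbP/(has_nthP 0%N) => [[j lt_j /andP[lt_ij Qj]]|[j]].
  exists (j - i.+1)%N; last by rewrite nth_drop subnKC.
  by rewrite size_drop ltn_sub2r // (leq_ltn_trans lt_ij).
rewrite size_drop nth_drop => lt_j Qj; exists (i.+1 + j)%N; first by rewrite -ltn_subRL.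
by rewrite Qj andbT addSn ltnS leq_addr.
Qed.

Lemma hasb_mem z x : hasb (csize z) (fun i => cnth z i == x) = (x \in CodeSeq.decode z).
Proof.
by apply/hasbP/(nthP 0%N) => -[i lt_i /eqP E]; exists i => //; apply/eqP.
Qed.

(** * Derivations and their verification *)

Section Certificates.
Variables (KS : nat -> bool) (Fa Fm : nat -> nat -> nat) (Fs : nat -> nat) (c0 : nat).
Notation valid := (valid KS).
Notation isMul := (isMul Fm).
Notation isSigma := (isSigma Fs).
Notation eqPoly := (eqPoly Fa c0).

(* Certificates list their entries last first: [l] holds the entries before [x]. *)
Definition justified m M cs x (l : seq nat) :=
  [|| x \in CodeSeq.decode cs, x == 0%N | has (fun a =>
    [|| has (fun b => isCat a b x) l,
        hasb M.+1 (fun b => valid m b && isMul b a x),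
        valid m x && eqPoly a x |
        hasb M.+1 (fun b => hasb M.+1 (fun c =>
          [&& valid m b, isSigma b c, isMul b c a & (x == b) || (x == c)]))]) l].

Fixpoint certificate m M cs l :=
  if l is x :: l' then [&& (x <= M)%N, justified m M cs x l' & certificate m M cs l'] else true.

Definition checkEntry m M cs z i :=
  (cnth z i <= M)%N && [|| hasb (csize cs) (fun u => cnth cs u == cnth z i), cnth z i == 0%N |
   hasb (csize z) (fun j => (i < j)%N && [|| hasb (csize z) (fun l =>
        (i < l)%N && isCat (cnth z j) (cnth z l) (cnth z i)),
      hasb M.+1 (fun b => valid m b && isMul b (cnth z j) (cnth z i)),
      valid m (cnth z i) && eqPoly (cnth z j) (cnth z i) |
      hasb M.+1 (fun b => hasb M.+1 (fun c => [&& valid m b, isSigma b c,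
        isMul b c (cnth z j) & (cnth z i == b) || (cnth z i == c)]))])].

Definition check m M cs z := allb (csize z) (checkEntry m M cs z).

Lemma checkE m M cs z : check m M cs z = certificate m M cs (CodeSeq.decode z).
Proof.
have E i : checkEntry m M cs z i =
    (cnth z i <= M)%N && justified m M cs (cnth z i) (drop i.+1 (CodeSeq.decode z)).
  rewrite /checkEntry /justified hasb_mem; congr (_ && [|| _, _ | _]).
  rewrite -hasb_drop; apply: eq_has => j; congr andb; congr orb.
  by rewrite -hasb_drop.
rewrite /check /allb (eq_all E) /cnth /csize; elim: (CodeSeq.decode z) => //= x l IH.
rewrite drop0 -andbA -IH; do 2!congr andb.
by rewrite (iotaDl 1 0) all_map; apply: eq_all.
Qed.

Lemma justified_sub m M cs x l l' :
  {subset l <= l'} -> justified m M cs x l -> justified m M cs x l'.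
Proof.
move=> sl /or3P[xc|x0|/hasP[a la H]]; apply/or3P; [exact: Or31|exact: Or32|apply: Or33].
apply/hasP; exists a; first exact: sl.
case/or4P: H => [/hasP[b lb H]|H|H|H]; apply/or4P;
  [apply: Or41; apply/hasP; exists b => //; exact: sl|exact: Or42|exact: Or43|exact: Or44].
Qed.

Lemma certificate_cat m M cs l l' :
  certificate m M cs l -> certificate m M cs l' -> certificate m M cs (l ++ l').
Proof.
move=> + cl'; elim: l => //= x l IH /and3P[-> jx /IH->]; rewrite andbT /=.
by apply: justified_sub jx => y ly; rewrite mem_cat ly.
Qed.

(** Entries are at most [M], so a certificate without repetitions has at most [M.+1] of them and its
    code is below [certbound M]. Hence bounding the entries already bounds the search. *)
Lemma certificate_undup m M cs l : certificate m M cs l -> certificate m M cs (undup l).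
Proof.
elim: l => //= x l IH /and3P[le_x jx /IH cl]; case: ifP => //= _; rewrite le_x cl andbT /=.
by apply: justified_sub jx => y; rewrite mem_undup.
Qed.

Lemma certificate_leq m M cs l x : certificate m M cs l -> x \in l -> (x <= M)%N.
Proof. by elim: l => //= y l IH /and3P[le_y _ /IH H]; rewrite inE => /orP[/eqP->|]. Qed.

Definition derc m M cs x := exists2 l, certificate m M cs l & x \in l.

Lemma derc_just m M cs x l : certificate m M cs l -> (x <= M)%N -> justified m M cs x l ->
  derc m M cs x.
Proof. by move=> cl le_x jx; exists (x :: l); rewrite ?mem_head //= le_x jx. Qed.

Lemma derc_mem m M cs x : x \in CodeSeq.decode cs -> (x <= M)%N -> derc m M cs x.
Proof. by move=> xc le_x; apply: (@derc_just _ _ _ _ [::]) => //; rewrite /justified xc. Qed.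

(** 0 is the code of the empty presentation, that is, of the zero polynomial. *)
Lemma derc0 m M cs : derc m M cs 0.
Proof. by apply: (@derc_just _ _ _ _ [::]); rewrite // /justified eqxx orbT. Qed.

Lemma derc_cat m M cs a b x : derc m M cs a -> derc m M cs b -> (x <= M)%N -> isCat a b x ->
  derc m M cs x.
Proof.
move=> [l cl la] [l' cl' lb] le_x H; apply: (derc_just (certificate_cat cl cl')) => //.
apply/or3P/Or33/hasP; exists a; first by rewrite mem_cat la.
by apply/or4P/Or41/hasP; exists b; rewrite // mem_cat lb orbT.
Qed.

Lemma derc_mul m M cs a b x : derc m M cs a -> (b <= M)%N -> valid m b -> (x <= M)%N ->
  isMul b a x -> derc m M cs x.
Proof.
move=> [l cl la] le_b vb le_x H; apply: (derc_just cl) => //.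
apply/or3P/Or33/hasP; exists a => //; apply/or4P/Or42/hasbP.
by exists b; rewrite ?vb.
Qed.

Lemma derc_eq m M cs a x : derc m M cs a -> valid m x -> (x <= M)%N -> eqPoly a x ->
  derc m M cs x.
Proof.
move=> [l cl la] vx le_x H; apply: (derc_just cl) => //.
by apply/or3P/Or33/hasP; exists a => //; apply/or4P/Or43; rewrite vx.
Qed.

Lemma derc_perfect m M cs a b c : derc m M cs a -> valid m b -> (b <= M)%N -> (c <= M)%N ->
  isSigma b c -> isMul b c a -> derc m M cs b /\ derc m M cs c.
Proof.
move=> [l cl la] vb le_b le_c sb mb.
have H x : (x == b) || (x == c) -> justified m M cs x l.
  move=> E; apply/or3P/Or33/hasP; exists a => //; apply/or4P/Or44/hasbP.
  by exists b => //; apply/hasbP; exists c; rewrite // vb sb mb E.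
by split; apply: (derc_just cl) => //; apply: H; rewrite eqxx ?orbT.
Qed.

Definition certbound M := (2 ^ (M.+1 * M.+1))%N.
Arguments certbound : simpl never.

Lemma code_bound e s : (forall x, x \in s -> (x <= e)%N) ->
  (CodeSeq.code s < 2 ^ (e.+1 * size s))%N.
Proof.
elim: s => [|x s IH] sP; first by rewrite muln0.
have {}IH := IH (fun y sy => sP y (mem_behead (s := x :: s) sy)).
rewrite code_cons /ccons /= (mulnS e.+1) expnD expnS.
have le_x : (2 ^ x <= 2 ^ e)%N by rewrite leq_exp2l // sP ?mem_head.
apply: (@leq_trans (2 ^ e * (CodeSeq.code s).+1.*2)%N); last first.
  by rewrite -mul2n mulnCA -mulnA leq_mul // leq_mul.
rewrite doubleS; apply: (@leq_trans (2 ^ x * (CodeSeq.code s).*2.+1 + 2 ^ e)%N).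
  by rewrite -addn1 leq_add2l expn_gt0.
by rewrite [X in (_ <= X)%N]mulnS [X in (_ <= X)%N]addnC leq_add2r leq_mul.
Qed.

Definition derives m M c cs :=
  hasb (certbound M) (fun z => check m M cs z && hasb (csize z) (fun i => cnth z i == c)).

Lemma derivesP m M c cs : derives m M c cs <-> derc m M cs c.
Proof.
split=> [/hasbP[z _ /andP[]]|[l cl lc]].
  by rewrite checkE hasb_mem => cz zc; exists (CodeSeq.decode z).
apply/hasbP; exists (CodeSeq.code (undup l)); last first.
  by rewrite checkE hasb_mem CodeSeq.codeK certificate_undup ?mem_undup.
have lM x : x \in undup l -> (x <= M)%N by rewrite mem_undup; apply: certificate_leq cl.
apply: leq_trans (code_bound lM) _; rewrite leq_exp2l // leq_mul //.
rewrite -(size_iota 0 M.+1); apply: uniq_leq_size (undup_uniq _) _ => x /lM le_x.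
by rewrite mem_iota.
Qed.

Hypothesis KSprs : prb (fun e => KS (nth 0%N e 0)).
Hypothesis Faprs : prs (fun e => Fa (nth 0%N e 0) (nth 0%N e 1)).
Hypothesis Fmprs : prs (fun e => Fm (nth 0%N e 0) (nth 0%N e 1)).
Hypothesis Fsprs : prs (fun e => Fs (nth 0%N e 0)).

Lemma prb_termProd f g h : prs f -> prs g -> prs h ->
  prb (fun e => termProd Fm (f e) (g e) (h e)).
Proof.
apply: (prs_comp3 (g := fun a b x => nat_of_bool (termProd Fm a b x))).
rewrite /termProd; prs_auto; last by apply: prb_isCat; prs_auto.
by apply: (prs_comp2 Fmprs); prs_auto.
Qed.

Lemma prb_isMul f g h : prs f -> prs g -> prs h -> prb (fun e => isMul (f e) (g e) (h e)).
Proof. by apply: prb_isProd; apply: prb_termProd; prs_auto. Qed.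

Lemma prb_varShift f g : prs f -> prs g -> prb (fun e => varShift (f e) (g e)).
Proof.
apply: (prs_comp2 (g := fun a x => nat_of_bool (varShift a x))).
rewrite /varShift; prs_auto.
Qed.

Lemma prb_isSigma f g : prs f -> prs g -> prb (fun e => isSigma (f e) (g e)).
Proof.
apply: prb_isMap; rewrite /termSigma; prs_auto.
  by apply: (prs_comp1 Fsprs); prs_auto.
by apply: prb_isMap; [apply: prb_varShift | |]; prs_auto.
Qed.

Lemma prb_valid f g : prs f -> prs g -> prb (fun e => valid (f e) (g e)).
Proof.
apply: (prs_comp2 (g := fun m x => nat_of_bool (valid m x))).
rewrite /valid /validTerm /validVar; prs_auto.
by apply: (prs_comp1 (g := fun x => nat_of_bool (KS x))); [exact: KSprs | prs_auto].
Qed.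

Lemma prs_coefSum f g h : prs f -> prs g -> prs h ->
  prs (fun e => coefSum Fa c0 (f e) (g e) (h e)).
Proof.
apply: prs_comp3; rewrite /coefSum.
apply: (prs_rec2 (g := fun i r e => if sameMon (ctail (cnth (nth 0%N e 0) i)) (nth 0%N e 1)
  then Fa r (chead (cnth (nth 0%N e 0) i)) else r)); prs_auto.
  by apply: prb_sameMon; prs_auto.
by apply: (prs_comp2 Faprs); prs_auto.
Qed.

Lemma prb_eqPoly f g : prs f -> prs g -> prb (fun e => eqPoly (f e) (g e)).
Proof.
apply: (prs_comp2 (g := fun a x => nat_of_bool (eqPoly a x))).
by rewrite /eqPoly; prs_auto; apply: prs_coefSum; prs_auto.
Qed.

Lemma prb_check f1 f2 f3 f4 : prs f1 -> prs f2 -> prs f3 -> prs f4 ->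
  prb (fun e => check (f1 e) (f2 e) (f3 e) (f4 e)).
Proof.
apply: (prs_comp4 (g := fun m M cs z => nat_of_bool (check m M cs z))).
rewrite /check /checkEntry; prs_auto;
  first [apply: prb_isCat | apply: prb_valid | apply: prb_isMul | apply: prb_eqPoly
        | apply: prb_isSigma]; prs_auto.
Qed.

Lemma prb_derives f1 f2 f3 f4 : prs f1 -> prs f2 -> prs f3 -> prs f4 ->
  prb (fun e => derives (f1 e) (f2 e) (f3 e) (f4 e)).
Proof.
apply: (prs_comp4 (g := fun m M c cs => nat_of_bool (derives m M c cs))).
by rewrite /derives /certbound; prs_auto; apply: prb_check; prs_auto.
Qed.
End Certificates.

(** * Completeness *)

Lemma growth_certbound : growth certbound.
Proof.
rewrite /certbound; split=> [|N|N M le_NM]; first by prs_auto.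
  apply: leq_trans (ltnW (ltn_expl N (isT : 1 < 2)%N)) _; rewrite leq_exp2l //.
  by apply: leq_trans (leqnSn N) _; rewrite leq_pmulr.
by rewrite leq_exp2l // leq_mul.
Qed.

Lemma code_leq B s : (size s <= B)%N -> (forall x, x \in s -> (x <= B)%N) ->
  (CodeSeq.code s <= certbound B)%N.
Proof.
move=> szB sB; apply: leq_trans (ltnW (code_bound sB)) _; rewrite leq_exp2l //.
by rewrite leq_mul // ltnW.
Qed.

Lemma mem_code_leq s x : x \in s -> (x <= CodeSeq.code s)%N.
Proof.
elim: s => // y s IH; rewrite code_cons; have [lt1 lt2] := ccons_ltn y (CodeSeq.code s).
rewrite inE => /orP[/eqP->|/IH le_x]; first exact: ltnW.
exact: leq_trans le_x (ltnW lt2).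
Qed.

(** The functions given with an effective field need not be monotone; summing their values yields
    growth functions above them. *)
Definition maj1 (F : nat -> nat) N := (N + \sum_(i < N.+1) F i)%N.
Definition maj2 (F : nat -> nat -> nat) N := (N + \sum_(i < N.+1) \sum_(j < N.+1) F i j)%N.

Lemma maj1P F i N : (i <= N)%N -> (F i <= maj1 F N)%N.
Proof.
move=> le_i; apply: leq_trans (leq_addl _ _).
by rewrite (bigD1 (Ordinal (le_i : i < N.+1)%N)) //= leq_addr.
Qed.

Lemma maj2P F i j N : (i <= N)%N -> (j <= N)%N -> (F i j <= maj2 F N)%N.
Proof.
move=> le_i le_j; apply: leq_trans (leq_addl _ _).
rewrite (bigD1 (Ordinal (le_i : i < N.+1)%N)) //= (bigD1 (Ordinal (le_j : j < N.+1)%N)) //=.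
by rewrite -addnA leq_addr.
Qed.

Lemma leq_sum_widen (F : nat -> nat) N M : (N <= M)%N ->
  (\sum_(i < N) F i <= \sum_(i < M) F i)%N.
Proof.
move=> le_NM; rewrite -!(big_mkord xpredT) (big_cat_nat (leq0n N) le_NM) /=.
exact: leq_addr.
Qed.

Lemma growth_maj1 F : prs (fun e => F (nth 0%N e 0)) -> growth (maj1 F).
Proof.
move=> pF; rewrite /maj1; split=> [|N|N M le_NM]; last first.
- by apply: leq_add => //; apply: leq_sum_widen.
- exact: leq_addr.
apply: prs_add; first exact: prs_nth.
apply: (prs_sum2 (g := fun i _ => F i)); prs_auto.
by apply: (prs_comp1 pF); prs_auto.
Qed.

Lemma growth_maj2 F : prs (fun e => F (nth 0%N e 0) (nth 0%N e 1)) -> growth (maj2 F).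
Proof.
move=> pF; rewrite /maj2; split=> [|N|N M le_NM]; last first.
- apply: leq_add => //; apply: (@leq_trans (\sum_(i < N.+1) \sum_(j < M.+1) F i j)).
    by apply: leq_sum => i _; apply: leq_sum_widen.
  by apply: (leq_sum_widen (fun i => \sum_(j < M.+1) F i j)%N).
- exact: leq_addr.
apply: prs_add; first exact: prs_nth.
apply: (prs_sum2 (g := fun i e => \sum_(j < (nth 0 e 0).+1) F i j)%N); prs_auto.
apply: (prs_sum2 (g := fun j e => F (nth 0 e 0) j)%N); prs_auto.
by apply: (prs_comp2 pF); prs_auto.
Qed.

Section PerfectIdentities.
Variables (R : comNzRingType) (s : {rmorphism R -> R}).

(** Perfect ideals are radical: with [x * x] they contain [s (x * x)], hence the left side, and the
    perfect rule applied twice gives [x]. *)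
Lemma square_perfect (x : R) : x * s x * s (x * s x) = x * s (s x) * s (x * x).
Proof. by rewrite !rmorphM /=; ring. Qed.

(** With [colon_perfect']: [x * y] and [s x * y] are in a perfect ideal together, so its colon ideal
    by any [y] is compatible with [s]. *)
Lemma colon_perfect (x y : R) : s x * y * s (s x * y) = s (s x) * y * s (x * y).
Proof. by rewrite !rmorphM /=; ring. Qed.

Lemma colon_perfect' (x y : R) : x * y * s (x * y) = x * s y * (s x * y).
Proof. by rewrite !rmorphM /=; ring. Qed.
End PerfectIdentities.

(** * Levels of an effective difference field *)

Section Bounds.
Variables (k : fieldType) (code : k -> nat).
Hypothesis code_inj : injective code.
Variables (KS : nat -> bool) (Fa Fm : nat -> nat -> nat) (Fi Fs Fsi Fd : nat -> nat).
Variables vs vsi : {rmorphism k -> k}.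
Hypothesis KSP : forall n, KS n <-> exists a, code a = n.
Hypothesis FaE : forall a b, Fa (code a) (code b) = code (a + b).
Hypothesis FmE : forall a b, Fm (code a) (code b) = code (a * b).
Hypothesis FiE : forall a, a != 0 -> Fi (code a) = code a^-1.
Hypothesis FsE : forall a, Fs (code a) = code (vs a).
Hypothesis vsK : cancel vs vsi.
Hypothesis vsiK : cancel vsi vs.
Hypothesis FsiE : forall a, Fsi (code a) = code (vsi a).
Hypothesis FdE : forall p : {poly k}, p != 0 -> exists s : seq {poly k},
  [/\ Fd (poly_code code p) = CodeSeq.code (map (poly_code code) s),
      forall q, q \in s -> irreducible_poly q & p %= \prod_(q <- s) q].
Hypothesis Faprs : prs (fun e => Fa (nth 0%N e 0) (nth 0%N e 1)).
Hypothesis Fmprs : prs (fun e => Fm (nth 0%N e 0) (nth 0%N e 1)).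
Hypothesis Fiprs : prs (fun e => Fi (nth 0%N e 0)).
Hypothesis Fsprs : prs (fun e => Fs (nth 0%N e 0)).
Hypothesis Fsiprs : prs (fun e => Fsi (nth 0%N e 0)).
Hypothesis Fdprs : prs (fun e => Fd (nth 0%N e 0)).

(** Added to every level, so that level 0 already has the constants 0, 1, -1 and a presentation of
    the polynomial 1. *)
Definition base := (code 0 + code 1 + code (-1) +
  CodeSeq.code [:: CodeSeq.code [:: code 1%R]])%N.
Definition kb N (a : k) := (code a <= N + base)%N.

Definition mul_entry A := certbound (maj2 Fm A + A + A).+1.
Definition mul_level A := certbound (mul_entry A + A * A.+1).
Definition sigma_entry A := certbound (maj1 Fs A + certbound (A + 3) + A.+1).
Definition sigma_level A := certbound (sigma_entry A + A).
Definition const_level A := certbound (certbound (A + 1) + 1).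
Definition var_level A := certbound (certbound (certbound (A + 2) + A + 2) + 1).
Definition split_level A := maj1 Fd (certbound A).

(** The sum dominates every basic operation, on elements of [k] and on presentations, so that a
    single [G] serves both. *)
Definition Gsum A := (A.+1 + maj2 Fa A + maj2 Fm A + maj1 Fi A + maj1 Fs A + maj1 Fsi A +
  split_level A + certbound (A + A) + mul_level A + sigma_level A + const_level A +
  var_level A)%N.
Definition G N := Gsum (N + base).

Lemma growth_G : growth G.
Proof.
have gS := growth_S.
have gc f : growth f -> growth (fun A => certbound (f A)) := growth_comp growth_certbound.
have g2 F : prs (fun e => F (nth 0%N e 0) (nth 0%N e 1)) -> growth (maj2 F) := @growth_maj2 F.
have g1 F : prs (fun e => F (nth 0%N e 0)) -> growth (maj1 F) := @growth_maj1 F.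
have gid := growth_id; have gAA := growth_add gid gid.
have gS' f : growth f -> growth (fun A => (f A).+1) := growth_comp gS.
have gent : growth mul_entry.
  exact: (gc _ (gS' _ (growth_add (growth_add (g2 _ Fmprs) gid) gid))).
have gsent : growth sigma_entry.
  exact: (gc _ (growth_add (growth_add (g1 _ Fsprs) (gc _ (growth_addn 3 gid))) gS)).
have gm : growth mul_level := gc _ (growth_add gent (growth_mulS gid gid)).
have gs : growth sigma_level := gc _ (growth_add gsent gid).
have gco : growth const_level := gc _ (growth_addn 1 (gc _ (growth_addn 1 gid))).
have gv : growth var_level.
  exact: (gc _ (growth_addn 1 (gc _ (growth_addn 2 (growth_add (gc _ (growth_addn 2 gid)) gid))))).
have gsp : growth split_level := growth_comp (g1 _ Fdprs) growth_certbound.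
apply: (growth_comp (f := Gsum)); last exact: (growth_addn _ gid).
exact: (growth_add (growth_add (growth_add (growth_add (growth_add (growth_add (growth_add
  (growth_add (growth_add (growth_add (growth_add gS (g2 _ Faprs)) (g2 _ Fmprs)) (g1 _ Fiprs))
  (g1 _ Fsprs)) (g1 _ Fsiprs)) gsp) (gc _ gAA)) gm) gs) gco) gv).
Qed.
Let gG := growth_G.

Lemma kb_all B : exists2 s : seq k, (size s <= B.+1)%N & forall c, (code c <= B)%N -> c \in s.
Proof.
elim: B => [|B [s sB sP]].
  case: (classic (exists c, code c = 0%N)) => [[c cE]|nex].
    exists [:: c] => // c'; rewrite leqn0 => /eqP E; rewrite inE; apply/eqP/code_inj.
    by rewrite E cE.
  by exists [::] => // c; rewrite leqn0 => /eqP E; case: nex; exists c.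
case: (classic (exists c, code c = B.+1)) => [[c cE]|nex].
  exists (c :: s) => // c'; rewrite leq_eqVlt inE => /orP[/eqP E|/sP->]; last by rewrite orbT.
  by apply/orP; left; apply/eqP/code_inj; rewrite E cE.
exists s => [|c]; first exact: leqW.
by rewrite leq_eqVlt => /orP[/eqP E|/sP//]; case: nex; exists c.
Qed.

Lemma Gsum_bounds A : [/\ (A < Gsum A)%N, (maj2 Fa A <= Gsum A)%N, (maj2 Fm A <= Gsum A)%N,
   (maj1 Fi A <= Gsum A)%N & (maj1 Fs A <= Gsum A)%N /\ (maj1 Fsi A <= Gsum A)%N] /\
  [/\ (split_level A <= Gsum A)%N, (certbound (A + A) <= Gsum A)%N, (mul_level A <= Gsum A)%N,
   (sigma_level A <= Gsum A)%N & (const_level A <= Gsum A)%N /\ (var_level A <= Gsum A)%N].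
Proof.
rewrite /Gsum; move: (maj2 Fa A) (maj2 Fm A) (maj1 Fi A) (maj1 Fs A) (maj1 Fsi A).
move: (split_level A) (certbound (A + A)) (mul_level A) (sigma_level A) (const_level A).
move: (var_level A) => x1 x2 x3 x4 x5 x6 x7 x8 x9 x10 x11; clear; repeat split; lia.
Qed.

Lemma base_bounds : [/\ (code 0 <= base)%N, (code 1 <= base)%N, (code (-1) <= base)%N &
  (CodeSeq.code [:: CodeSeq.code [:: code 1%R]] <= base)%N].
Proof.
rewrite /base; move: (code 0) (code 1) (code (-1)) (CodeSeq.code _) => a b c d.
by clear; split; lia.
Qed.

Lemma kbG N c x : (x <= Gsum (N + base))%N -> code c = x -> kb (G N) c.
Proof. by move=> le_x cE; rewrite /kb cE; apply: leq_trans le_x (leq_addr _ _). Qed.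

Lemma kb_ok : bok G kb 0.
Proof.
have [b0 b1 bm1 _] := base_bounds.
split=> [N M x le_NM|N|N|N x y bx by_|N x bx|N x y bx by_|N].
- by move=> bx; apply: leq_trans bx _; rewrite leq_add2r.
- exact: leq_trans b0 (leq_addl _ _).
- exact: leq_trans b1 (leq_addl _ _).
- have [[_ le _ _ [_ _]] _] := Gsum_bounds (N + base).
  by apply: kbG (esym (FaE x y)); apply: leq_trans le; apply: maj2P.
- have [[_ _ le _ [_ _]] _] := Gsum_bounds (N + base).
  rewrite -mulN1r; apply: kbG (esym (FmE _ _)); apply: leq_trans le; apply: maj2P => //.
  exact: leq_trans bm1 (leq_addl _ _).
- have [[_ _ le _ [_ _]] _] := Gsum_bounds (N + base).
  by apply: kbG (esym (FmE x y)); apply: leq_trans le; apply: maj2P.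
have [s sB sP] := kb_all (N + base); exists s => //.
by have [[le _ _ _ [_ _]] _] := Gsum_bounds (N + base); apply: leq_trans sB le.
Qed.

Lemma kb_inv N c : kb N c -> kb (G N) c^-1.
Proof.
move=> bc; have [->|c0] := eqVneq c 0; first by rewrite invr0; apply: (bok0 kb_ok).
have [[_ _ _ le [_ _]] _] := Gsum_bounds (N + base).
by apply: kbG (esym (FiE c0)); apply: leq_trans le; apply: maj1P.
Qed.

Lemma kb_vs N c : kb N c -> kb (G N) (vs c).
Proof.
move=> bc; have [[_ _ _ _ [le _]] _] := Gsum_bounds (N + base).
by apply: kbG (esym (FsE c)); apply: leq_trans le; apply: maj1P.
Qed.

Lemma kb_vsi N c : kb N c -> kb (G N) (vsi c).
Proof.
move=> bc; have [[_ _ _ _ [_ le]] _] := Gsum_bounds (N + base).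
by apply: kbG (esym (FsiE c)); apply: leq_trans le; apply: maj1P.
Qed.

Lemma kb_factor N (p : {poly k}) : p != 0 -> bP kb N p ->
  exists s : seq {poly k}, [/\ (size s <= G N)%N,
    forall q, q \in s -> irreducible_poly q /\ bP kb (G N) q & p %= \prod_(q <- s) q].
Proof.
move=> p0 [sp bp]; have [s [sE sI sP]] := FdE p0.
have [_ [le _ _ _ _]] := Gsum_bounds (N + base).
(* The code of the list of factors bounds their number, their sizes and their coefficients. *)
have leC : (CodeSeq.code (map (poly_code code) s) <= G N)%N.
  rewrite -sE; apply: leq_trans le; apply: maj1P; apply: leq_trans (_ : _ <= 2 ^ _)%N.
    apply: ltnW; apply: (code_bound (e := (N + base)%N)) => x /mapP[c /(nthP 0)[i _ <-] ->].
    exact: bp.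
  rewrite size_map leq_exp2l // leq_mul //; apply: leq_trans sp _.
  by rewrite ltnS leq_addr.
exists s; split=> //.
  by rewrite -(size_map (poly_code code)); apply: leq_trans (size_code _) leC.
move=> q sq; split; first exact: sI.
have leq_q : (poly_code code q <= G N)%N.
  by apply: leq_trans leC; apply: mem_code_leq; apply: map_f.
split=> [|i]; first by apply: leqW; apply: leq_trans leq_q; rewrite -(size_map code); apply: size_code.
have [lt_i|le_i] := ltnP i (size q); last by rewrite nth_default //; apply: (bok0 kb_ok).
apply: leq_trans (leq_addr _ _); apply: leq_trans leq_q; apply: mem_code_leq.
by apply: map_f; apply: mem_nth.
Qed.

Section Difference.
Variables (m : nat) (ds : {rmorphism dpoly k m -> dpoly k m}).
(* The morphism [dsigma vs], kept abstract because unification would unfold it. *)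
Hypothesis dsE : forall f, ds f = dsigma vs f.
Notation dterms := (Defs.dterms k m).
Notation dc := (dterms_code code).

Definition dbnd N (g : dpoly k m) := exists2 t : dterms, dpoly_of t = g & (dc t <= N + base)%N.

Lemma dterms_bounds A (t : dterms) : (dc t <= A)%N ->
  (size t <= A)%N /\ forall u, u \in t -> [/\ (code u.1 <= A)%N, (size u.2 <= A)%N &
    forall v, v \in u.2 -> [/\ (vcode v <= A)%N, (v.1 <= A)%N & (v.2 <= A)%N]].
Proof.
move=> le_t; split; first by apply: leq_trans le_t; rewrite -(size_map (@tcode k code m)); apply: size_code.
move=> u tu; have le_u : (tcode code u <= A)%N.
  by apply: leq_trans le_t; apply: mem_code_leq; apply: map_f.
split.
- by apply: leq_trans le_u; apply: mem_code_leq; apply: mem_head.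
- apply: leq_trans le_u; apply: leq_trans (size_code _); rewrite /= size_map.
  exact: leqnSn.
move=> v uv; have le_v : (vcode v <= A)%N.
  by apply: leq_trans le_u; apply: mem_code_leq; rewrite inE map_f ?orbT.
split=> //; apply: leq_trans le_v; apply: mem_code_leq; rewrite !inE eqxx ?orbT //.
Qed.

Lemma cat_bound A (s t : dterms) : (dc s <= A)%N -> (dc t <= A)%N ->
  (dc (s ++ t) <= certbound (A + A))%N.
Proof.
move=> le_s le_t; apply: code_leq.
  rewrite size_map size_cat leq_add //.
    by have [] := dterms_bounds le_s.
  by have [] := dterms_bounds le_t.
move=> x; rewrite map_cat mem_cat => /orP[] /mem_code_leq le_x; apply: leq_trans le_x _.
  exact: leq_trans le_s (leq_addr _ _).
exact: leq_trans le_t (leq_addr _ _).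
Qed.

Lemma mul_bound A (s t : dterms) : (dc s <= A)%N -> (dc t <= A)%N ->
  (dc (terms_mul s t) <= mul_level A)%N.
Proof.
move=> le_s le_t; have [zs sP] := dterms_bounds le_s; have [zt tP] := dterms_bounds le_t.
apply: code_leq => [|x /mapP[w /allpairsP[[u v] [su tv ->]] ->]].
  rewrite size_map size_allpairs; apply: leq_trans (leq_addl _ _).
  by apply: leq_mul => //; apply: leqW.
have [cu zu uP] := sP u su; have [cv zv vP] := tP v tv.
apply: leq_trans (leq_addr _ _); apply: code_leq => /= [|y].
  by rewrite size_map size_cat ltnS -addnA; apply: leq_trans (leq_addl _ _); apply: leq_add.
rewrite inE => /orP[/eqP->|/mapP[z zuv ->]]; apply: leqW.
  by rewrite -FmE -addnA; apply: leq_trans (leq_addr _ _); apply: maj2P.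
apply: leq_trans (leq_addl _ _).
by move: zuv; rewrite mem_cat => /orP[/uP[] | /vP[]].
Qed.

Lemma vcode_bound A (v : dvar m) : (v.1 <= A)%N -> (v.2 <= A)%N -> (vcode v <= certbound A.+2)%N.
Proof.
move=> v1 v2; apply: (@code_leq A.+2 [:: val v.1; v.2]) => // x.
by rewrite !inE => /orP[/eqP->|/eqP->]; do 2!apply: leqW.
Qed.

Lemma sigma_bound A (t : dterms) : (dc t <= A)%N -> (dc (terms_sigma vs t) <= sigma_level A)%N.
Proof.
move=> le_t; have [zt tP] := dterms_bounds le_t.
apply: code_leq => [|x /mapP[w /mapP[u tu ->] ->]].
  by rewrite !size_map; apply: leq_trans (leq_addl _ _).
have [cu zu uP] := tP u tu; apply: leq_trans (leq_addr _ _); apply: code_leq => /= [|y].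
  by rewrite !size_map; apply: leq_trans (leq_addl _ _).
rewrite inE => /orP[/eqP->|/mapP[z /mapP[v uv ->] ->]].
  by rewrite -FsE -addnA; apply: leq_trans (leq_addr _ _); apply: maj1P.
rewrite addnAC; apply: leq_trans (leq_addl _ _); have [_ v1 v2] := uP v uv.
apply: leq_trans (vcode_bound (A := A.+1) _ _) _; [exact: leqW | by [] |].
by rewrite -addn3.
Qed.

Lemma dbnd_mono N M g : (N <= M)%N -> dbnd N g -> dbnd M g.
Proof. by move=> le [t tE bt]; exists t => //; apply: leq_trans bt _; rewrite leq_add2r. Qed.

Lemma dbndG N (t : dterms) : (dc t <= Gsum (N + base))%N -> dbnd (G N) (dpoly_of t).
Proof. by move=> le_t; exists t => //; apply: leq_trans le_t (leq_addr _ _). Qed.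

Lemma dbnd0 N : dbnd N 0.
Proof. by exists [::]; rewrite /dpoly_of ?big_nil. Qed.

Lemma dpoly_const (c : k) : dpoly_of [:: (c, [::])] = dC m c.
Proof. by rewrite /dpoly_of big_seq1 /= big_nil mulr1. Qed.

Lemma dbnd1 N : dbnd N 1.
Proof.
exists [:: (1, [::])]; first by rewrite dpoly_const; apply: rmorph1.
have [_ _ _ le] := base_bounds; exact: leq_trans le (leq_addl _ _).
Qed.

Lemma term_bound B (u : k * seq (dvar m)) : (size u.2 < B)%N -> (code u.1 <= B)%N ->
  (forall v, v \in u.2 -> (vcode v <= B)%N) -> (dc [:: u] <= certbound (certbound B + 1))%N.
Proof.
move=> szu cu uB; apply: (@code_leq _ [:: tcode code u]) => [|x]; first exact: leq_addl.
rewrite inE => /eqP->; apply: leq_trans (leq_addr _ _).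
apply: code_leq => [|y]; first by rewrite /= size_map.
by rewrite inE => /orP[/eqP->|/mapP[v uv ->]] //; apply: uB.
Qed.

Lemma dbndC N c : kb N c -> dbnd (G N) (dC m c).
Proof.
move=> bc; rewrite -dpoly_const; apply: dbndG.
have [_ [_ _ _ _ [le _]]] := Gsum_bounds (N + base); apply: leq_trans le.
by apply: term_bound => //=; [rewrite addn1 | apply: leq_trans bc (leq_addr _ _)].
Qed.

Lemma dbndX N (v : dvar m) : (v.1 <= N)%N -> (v.2 <= N)%N -> dbnd (G N) (dX k v).
Proof.
move=> v1 v2; have -> : dX k v = dpoly_of [:: (1, [:: v])].
  have -> : dpoly_of [:: (1, [:: v])] = dC m 1 * dX k v by rewrite /dpoly_of !big_seq1.
  have -> : dC m 1 = 1 :> dpoly k m by apply: rmorph1.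
  by rewrite mul1r.
apply: dbndG; have [_ [_ _ _ _ [_ le]]] := Gsum_bounds (N + base); apply: leq_trans le.
have [_ b1 _ _] := base_bounds; apply: term_bound => /= [||w].
- by rewrite addn2.
- by apply: leq_trans b1 _; move: (certbound _) => X; move: base => B; clear; lia.
rewrite inE => /eqP->; rewrite -addnA; apply: leq_trans (leq_addr _ _); rewrite addn2.
by apply: vcode_bound; [apply: leq_trans v1 _ | apply: leq_trans v2 _]; apply: leq_addr.
Qed.

Lemma dbndD N f g : dbnd N f -> dbnd N g -> dbnd (G N) (f + g).
Proof.
move=> [s <- le_s] [t <- le_t]; rewrite -dpoly_cat; apply: dbndG.
have [_ [_ le _ _ _]] := Gsum_bounds (N + base); apply: leq_trans le; exact: cat_bound.
Qed.

Lemma dbndM N f g : dbnd N f -> dbnd N g -> dbnd (G N) (f * g).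
Proof.
move=> [s <- le_s] [t <- le_t]; rewrite -dpoly_mul; apply: dbndG.
have [_ [_ _ le _ _]] := Gsum_bounds (N + base); apply: leq_trans le; exact: mul_bound.
Qed.

Lemma dbndS N f : dbnd N f -> dbnd (G N) (dsigma vs f).
Proof.
move=> [s <- le_s]; rewrite -dpoly_sigma; apply: dbndG.
have [_ [_ _ _ le _]] := Gsum_bounds (N + base); apply: leq_trans le; exact: sigma_bound.
Qed.

Definition evlevel N := iter (N + N + 3) G N.

Lemma growth_evlevel : growth evlevel.
Proof.
apply: (growth_iter gG _ growth_id); apply: growth_addn.
exact: (growth_add growth_id growth_id).
Qed.

Lemma dbnd_pev (R : idomainType) (b : nat -> R -> Prop) (g : {rmorphism R -> dpoly k m}) z N p :
  (forall c, b N c -> dbnd N (g c)) -> dbnd N z -> bP b N p -> dbnd (evlevel N) (pev g z p).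
Proof.
move=> bg bz [sp bp]; rewrite pev_sum.
have le_it i : (N <= iter i G N)%N := iter_infl i N gG.
have bX i : dbnd (iter i G N) (z ^+ i).
  elim: i => [|i IH]; first by rewrite expr0; apply: dbnd1.
  by rewrite exprS; apply: dbndM IH; exact: (dbnd_mono (le_it i) bz).
have le_ii i j : (i <= j)%N -> (iter i G N <= iter j G N)%N by move=> le; apply: iter_mono gG le _.
have bT (i : 'I_(size p)) : dbnd (iter N.+2 G N) (g p`_i * z ^+ i).
  have le_i : (i <= N.+1)%N := leq_trans (ltnW (ltn_ord i)) sp.
  exact: (dbndM (dbnd_mono (le_it N.+1) (bg _ (bp i))) (dbnd_mono (le_ii _ _ le_i) (bX i))).
have bS n (F : 'I_n -> dpoly k m) : (forall i, dbnd (iter N.+2 G N) (F i)) ->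
    dbnd (iter (n + N.+2) G N) (\sum_(i < n) F i).
  elim: n F => [|n IH] F bF; first by rewrite big_ord0; apply: dbnd0.
  rewrite big_ord_recr addSn; have bl := bF ord_max.
  exact: (dbndD (IH _ (fun i => bF _)) (dbnd_mono (le_ii _ _ (leq_addl _ _)) bl)).
apply: dbnd_mono (bS _ _ bT); apply: le_ii.
by move: sp; move: (size p) => n; clear; lia.
Qed.

Lemma dbnd_ev (g : {rmorphism k -> dpoly k m}) z n N M p : (N <= M)%N ->
  (forall c, kb N c -> dbnd M (g c)) -> (forall i, (i < n)%N -> dbnd M (z i)) ->
  bMP kb n N p -> dbnd (iter n evlevel M) (ev g z n p).
Proof.
move=> le_NM bg; elim: n p => [|n IH] p bz bp; first exact: bg.
rewrite /=; have le_it := iter_infl n M growth_evlevel.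
have [sp cp] := bp; apply: (@dbnd_pev (MP k n) (fun _ => bMP kb n N)).
- by move=> c bc; apply: IH => // i lt_i; apply: bz; apply: ltnW.
- by exact: (dbnd_mono le_it (bz n _)).
split=> //; apply: leq_trans sp _; rewrite ltnS; exact: leq_trans le_NM le_it.
Qed.

(** * Bounded derivability of polynomials *)

Section Derivable.
Variables (M cs : nat).

Definition der (g : dpoly k m) := exists2 t : dterms, dpoly_of t = g &
  derc KS Fa Fm Fs (code 0) m M cs (dc t).

Lemma dc_valid (t : dterms) : valid KS m (dc t).
Proof. by apply/(validP m KSP); exists t. Qed.

Lemma der_eq (t : dterms) g : der g -> dpoly_of t = g -> (dc t <= M)%N ->
  derc KS Fa Fm Fs (code 0) m M cs (dc t).
Proof.
move=> [s sE dgs] tE le_t; apply: (derc_eq dgs) => //; first exact: dc_valid.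
by apply/(eqPolyP code_inj FaE); rewrite sE tE.
Qed.

Lemma der0 : der 0.
Proof. by exists [::]; [rewrite /dpoly_of big_nil | exact: derc0]. Qed.

(** Two applications of [G], because [derP] multiplies a presentation by its shift, which already
    lies one level higher. *)
Lemma level_leq N : (G (G N) + base <= M)%N ->
  [/\ (N + base <= M)%N, (Gsum (N + base) <= M)%N & (Gsum (Gsum (N + base) + base) <= M)%N].
Proof.
move=> le; have le1 := growth_infl gG N; have le2 := growth_infl gG (G N).
have le3 := leq_trans (leq_addr base _) le; split=> //; last exact: leq_trans le2 le3.
by apply: leq_trans le; rewrite leq_add2r (leq_trans le1).
Qed.

Lemma derD N f g : (G (G N) + base <= M)%N -> dbnd N f -> dbnd N g -> der f -> der g ->
  der (f + g).
Proof.
move=> /level_leq[le0 le1 _] [s sE bs] [t tE bt] df dg; exists (s ++ t).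
  by rewrite dpoly_cat sE tE.
have [_ [_ le _ _ _]] := Gsum_bounds (N + base).
apply: (derc_cat (der_eq df sE (leq_trans bs le0)) (der_eq dg tE (leq_trans bt le0))).
  by apply: leq_trans le1; apply: leq_trans le; apply: cat_bound.
exact/isCatP.
Qed.

Lemma derM N f g : (G (G N) + base <= M)%N -> dbnd N f -> dbnd N g -> der g -> der (f * g).
Proof.
move=> /level_leq[le0 le1 _] [s sE bs] [t tE bt] dg; exists (terms_mul s t).
  by rewrite dpoly_mul sE tE.
have [_ [_ _ le _ _]] := Gsum_bounds (N + base).
apply: (derc_mul (der_eq dg tE (leq_trans bt le0)) (leq_trans bs le0) (dc_valid s)).
  by apply: leq_trans le1; apply: leq_trans le; apply: mul_bound.
exact/(isMulP FmE).
Qed.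

Lemma derP N f : (G (G N) + base <= M)%N -> dbnd N f -> der (f * dsigma vs f) ->
  der f /\ der (dsigma vs f).
Proof.
move=> /level_leq[le0 le1 le2] [s sE bs] dg.
have [_ [_ _ _ le _]] := Gsum_bounds (N + base).
have bS : (dc (terms_sigma vs s) <= Gsum (N + base))%N.
  by apply: leq_trans le; apply: sigma_bound.
have [[leA _ _ _ [_ _]] _] := Gsum_bounds (N + base).
set A := Gsum (N + base) in bS le1 le2 leA.
have bs' : (dc s <= A + base)%N.
  by apply: leq_trans (leq_addr _ _); apply: leq_trans bs (ltnW leA).
have bSM : (dc (terms_mul s (terms_sigma vs s)) <= M)%N.
  apply: leq_trans le2; have [_ [_ _ le' _ _]] := Gsum_bounds (A + base).
  by apply: leq_trans le'; apply: mul_bound => //; apply: leq_trans bS (leq_addr _ _).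
have dp : derc KS Fa Fm Fs (code 0) m M cs (dc (terms_mul s (terms_sigma vs s))).
  by apply: (der_eq dg) bSM; rewrite dpoly_mul dpoly_sigma sE.
have [|d1 d2] := derc_perfect dp (dc_valid s) (leq_trans bs le0) (leq_trans bS le1)
  (proj2 (isSigmaP FsE _ _) erefl).
  exact/(isMulP FmE).
by split; [exists s | exists (terms_sigma vs s); rewrite ?dpoly_sigma ?sE].
Qed.
End Derivable.

Lemma der_mem M (ts : seq dterms) (t : dterms) : t \in ts -> (dc t <= M)%N ->
  der M (CodeSeq.code (map dc ts)) (dpoly_of t).
Proof.
move=> tst le_t; exists t => //; apply: derc_mem => //.
by rewrite CodeSeq.codeK; apply: map_f.
Qed.

Lemma derc_sound M (ts : seq dterms) x :
  derc KS Fa Fm Fs (code 0) m M (CodeSeq.code (map dc ts)) x ->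
  exists2 t : dterms, x = dc t &
    perfect_closure ds (fun g => g \in [seq dpoly_of u | u <- ts]) (dpoly_of t).
Proof.
set E := (fun g => g \in [seq dpoly_of u | u <- ts]); have [[I0 ID IM] IP] := perfect_closure_perfect ds E.
move=> [l cl lx]; suff H : forall y, y \in l -> exists2 t : dterms, y = dc t &
    perfect_closure ds E (dpoly_of t) by apply: H.
elim: l cl {lx} => // y l IH /and3P[_ jy /IH{}IH] z; rewrite inE => /orP[/eqP->{z}|/IH//].
case/or3P: jy => [|/eqP->|/hasP[a /IH[t -> It] /or4P[]]].
- rewrite CodeSeq.codeK => /mapP[t tst ->]; exists t => //.
  by apply: sub_perfect_closure; apply: map_f.
- by exists [::]; rewrite // /dpoly_of big_nil.
- case/hasP=> b /IH[s -> Is] /isCatP ->; exists (t ++ s) => //.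
  by rewrite dpoly_cat; apply: ID.
- case/hasbP=> b _ /andP[/(validP m KSP)[s ->] /(isMulP FmE) ->]; exists (terms_mul s t) => //.
  by rewrite dpoly_mul; apply: IM.
- case/andP=> /(validP m KSP)[s ->] /(eqPolyP code_inj FaE) E'; exists s => //.
  by rewrite -E'.
case/hasbP=> b _ /hasbP[c _ /and4P[/(validP m KSP)[s ->] /(isSigmaP FsE) -> mbc H]].
move/(isMulP FmE): mbc => mbc.
have [I1 I2] : perfect_closure ds E (dpoly_of s) /\
    perfect_closure ds E (ds (dpoly_of s)).
  have E2 : dpoly_of s * ds (dpoly_of s) = dpoly_of t.
    rewrite dsE -dpoly_sigma -dpoly_mul; apply/(eqPolyP code_inj FaE).
    by rewrite -mbc; apply/(eqPolyP code_inj FaE).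
  by apply: IP; rewrite -E2 in It.
case/orP: H => /eqP->; [by exists s | exists (terms_sigma vs s) => //].
by rewrite dpoly_sigma -dsE.
Qed.

Definition dCm : {rmorphism k -> dpoly k m} := dC m.

(** Variables in blocks of length [m]: index [j * m + i] stands for [sigma^j(x_i)], so [sigma] adds
    [m] to the index. For [m = 0] the value is the default 0. *)
Definition zvar i : dpoly k m :=
  if insub (i %% m)%N is Some o then dX k (o, (i %/ m)%N) else 0.

Definition toDpoly n : {rmorphism MP k n -> dpoly k m} := ev dCm zvar n.

Definition vindex (v : dvar m) := (v.2 * m + v.1)%N.

Lemma zvar_index v : zvar (vindex v) = dX k v.
Proof.
have m_gt0 : (0 < m)%N := leq_ltn_trans (leq0n _) (ltn_ord v.1).
have E1 : (vindex v %% m)%N = v.1 by rewrite /vindex modnMDl modn_small.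
have E2 : (vindex v %/ m)%N = v.2 by rewrite /vindex divnMDl // divn_small // addn0.
rewrite /zvar E1 E2; have -> : insub (val v.1) = Some v.1 := valK v.1.
by case: (v).
Qed.

Lemma zvar_shift i : ds (zvar i) = zvar (i + m).
Proof.
rewrite dsE /zvar; case: (posnP m) => [m0|m_gt0].
  have insub0 j : insub j = None :> option 'I_m by rewrite insubN // m0.
  by rewrite !insub0 -dsE; apply: rmorph0.
rewrite modnDr divnDr ?divnn ?m_gt0 ?addn1 ?dvdnn //.
by case: insubP => [o _ _|]; [exact: dsigmaX | rewrite -dsE rmorph0].
Qed.

Lemma dbnd_zvar N i : (i <= N)%N -> dbnd (G N) (zvar i).
Proof.
move=> le_i; rewrite /zvar; case: insubP => [o _ oE|_]; last exact: dbnd0.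
apply: dbndX => /=; first by rewrite oE (leq_trans (leq_mod _ _)).
exact: leq_trans (leq_div _ _) le_i.
Qed.

Lemma toDpoly_incl q p : toDpoly (q + m) (incl k q m p) = toDpoly q p.
Proof.
apply: ev_comp => [c|i lt_i]; first exact: ev_cst.
by rewrite ev_var // (leq_trans lt_i) // leq_addr.
Qed.

Lemma toDpoly_shft q p : toDpoly (q + m) (shft vs q m p) = ds (toDpoly q p).
Proof.
have E1 : toDpoly (q + m) (shft vs q m p) =
    ev (dCm \o vs : {rmorphism k -> dpoly k m}) (fun i => zvar (i + m)) q p.
  apply: ev_comp => [c|i lt_i]; first exact: (ev_cst dCm zvar).
  by rewrite ev_var // ltn_add2r.
rewrite E1; symmetry; apply: ev_comp => [c|i lt_i]; last exact: zvar_shift.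
by rewrite dsE; apply: dsigmaC.
Qed.

Lemma dbnd_toDpoly n N p : (n <= N)%N -> bMP kb n N p ->
  dbnd (iter N evlevel (G N)) (toDpoly n p).
Proof.
move=> le_n bp; apply: (@dbnd_mono (iter n evlevel (G N))).
  by apply: iter_mono => //; exact: growth_evlevel.
apply: dbnd_ev bp => [|c|i lt_i]; first exact: (growth_infl gG).
  exact: dbndC.
by apply: dbnd_zvar; apply: leq_trans (ltnW lt_i) le_n.
Qed.

Definition ofTerms n (t : dterms) : MP k n :=
  \sum_(u <- t) cst n u.1 * \prod_(v <- u.2) var n (vindex v).

Definition small n (t : dterms) := forall u v, u \in t -> v \in u.2 -> (vindex v < n)%N.

Lemma ev_ofTerms n (S : comNzRingType) (f : {rmorphism k -> S}) x t : small n t ->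
  ev f x n (ofTerms n t) = \sum_(u <- t) f u.1 * \prod_(v <- u.2) x (vindex v).
Proof.
move=> sm; rewrite /ofTerms rmorph_sum; apply: eq_big_seq => u tu.
rewrite rmorphM rmorph_prod ev_cst; congr (_ * _); apply: eq_big_seq => v uv.
by rewrite ev_var // (sm u).
Qed.

Lemma toDpoly_ofTerms n t : small n t -> toDpoly n (ofTerms n t) = dpoly_of t.
Proof.
move=> sm; transitivity (\sum_(u <- t) dCm u.1 * \prod_(v <- u.2) zvar (vindex v)).
  exact: ev_ofTerms.
apply: eq_bigr => u _; congr (_ * _); apply: eq_bigr => v _; exact: zvar_index.
Qed.

Lemma small_exists t : exists Q, forall n, (Q <= n)%N -> small n t.
Proof.
exists (\sum_(u <- t) \sum_(v <- u.2) (vindex v).+1)%N => n le_n u v tu uv.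
apply: leq_trans le_n; rewrite (big_rem u tu) /= (big_rem v uv) /= -addnA; exact: leq_addr.
Qed.

(** * Evaluation at points *)

Section Evaluation.
Variables (L : fieldType) (iota : {rmorphism k -> L}) (a : nat -> L).

Definition monEval (w : {cmonom dvar m}) : L := \prod_(v <- finsupp w) a (vindex v) ^+ w v.

Lemma monEvalEw (d : {fset dvar m}) (w : {cmonom dvar m}) :
  (finsupp w `<=` d)%fset -> monEval w = \prod_(v <- d) a (vindex v) ^+ w v.
Proof.
move=> le; rewrite /monEval; apply: big_fset_incl => // v _ vw.
by rewrite fsfun_dflt.
Qed.

Lemma monEval_morph : mmorphism monEval.
Proof.
split=> [x y|]; last by rewrite /monEval mdom1 big_seq_fset0.
pose d := (finsupp x `|` finsupp y)%fset.
rewrite (@monEvalEw d) ?mdomD // (@monEvalEw d x) ?fsubsetUl //.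
rewrite (@monEvalEw d y) ?fsubsetUr // -big_split /=.
by apply: eq_bigr => v _; rewrite cmM exprD.
Qed.
HB.instance Definition _ :=
  isMultiplicative.Build {cmonom dvar m} L monEval monEval_morph.

Lemma deval_exists : exists h : {rmorphism dpoly k m -> L},
  (forall c, h (dC m c) = iota c) /\ forall v, h (dX k v) = a (vindex v).
Proof.
have X v : mmap iota monEval << ucm v >> = a (vindex v).
  by rewrite mmapU /= rmorph1 mul1r /monEval mdomU big_seq_fset1 cmUU expr1.
by exists (mmap iota monEval); split=> [c|v]; [exact: mmapC | exact: X].
Qed.
End Evaluation.
Lemma level_bounds N :
  [/\ (N <= iter 4 G N)%N, (G N <= iter 4 G N)%N, (G (G N) <= iter 4 G N)%N &
      (G (G (G N)) <= iter 4 G N)%N].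
Proof.
have le i : (i <= 4)%N -> (iter i G N <= iter 4 G N)%N.
  by move=> le_i; apply: iter_mono gG le_i _.
by split; [apply: (le 0%N) | apply: (le 1%N) | apply: (le 2%N) | apply: (le 3%N)].
Qed.

Lemma dbnd_ds N f : dbnd N f -> dbnd (G N) (ds f).
Proof. by rewrite dsE; apply: dbndS. Qed.

Lemma derPs M cs N f : (G (G N) + base <= M)%N -> dbnd N f -> der M cs (f * ds f) ->
  der M cs f /\ der M cs (ds f).
Proof. by rewrite !dsE; apply: derP. Qed.

Lemma der_sqrt M cs N f : (G (G (iter 4 G N)) + base <= M)%N -> dbnd N f ->
  der M cs (f * f) -> der M cs f.
Proof.
move=> leM bf dff; have [le0 le1 le2 le3] := level_bounds N.
have bff := dbndM bf bf.
have [_ d1] : der M cs (f * f) /\ der M cs (ds (f * f)).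
  apply: (derPs leM (dbnd_mono le1 bff) _); rewrite mulrC.
  exact: (derM leM (dbnd_mono le2 (dbnd_ds bff)) (dbnd_mono le1 bff) dff).
have bs := dbnd_ds bf; have bfs : dbnd (iter 4 G N) (f * ds f).
  exact: (dbnd_mono le2 (dbndM (dbnd_mono (growth_infl gG N) bf) bs)).
have bfss : dbnd (iter 4 G N) (f * ds (ds f)).
  have le : (N <= G (G N))%N := leq_trans (growth_infl gG _) (growth_infl gG _).
  exact: (dbnd_mono le3 (dbndM (dbnd_mono le bf) (dbnd_ds bs))).
have E := square_perfect ds f.
have d2 : der M cs (f * ds f * ds (f * ds f)).
  by rewrite E; apply: (derM leM bfss (dbnd_mono le2 (dbnd_ds bff)) d1).
have [d3 _] := derPs leM bfs d2.
by have [] := derPs leM (dbnd_mono le0 bf) d3.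
Qed.

Lemma der_colon M cs N f g : (G (G (iter 4 G N)) + base <= M)%N -> dbnd N f -> dbnd N g ->
  der M cs (f * g) <-> der M cs (ds f * g).
Proof.
move=> leM bf bg; have [le0 le1 le2 le3] := level_bounds N.
have leN := growth_infl gG N; have bsf := dbnd_ds bf; have bsg := dbnd_ds bg.
have b1 := dbnd_mono le1 (dbndM bf bg).
have b2 : dbnd (iter 4 G N) (ds f * g) := dbnd_mono le2 (dbndM bsf (dbnd_mono leN bg)).
have b3 : dbnd (iter 4 G N) (f * ds g) := dbnd_mono le2 (dbndM (dbnd_mono leN bf) bsg).
split=> d.
  have [_ d1] : der M cs (f * g) /\ der M cs (ds (f * g)).
    apply: (derPs leM b1 _); rewrite mulrC.
    exact: (derM leM (dbnd_mono le2 (dbnd_ds (dbndM bf bg))) b1 d).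
  have b4 : dbnd (iter 4 G N) (ds (ds f) * g).
    have le : (N <= G (G N))%N := leq_trans leN (growth_infl gG _).
    exact: (dbnd_mono le3 (dbndM (dbnd_ds bsf) (dbnd_mono le bg))).
  have b5 := dbnd_mono le2 (dbnd_ds (dbndM bf bg)).
  have d2 : der M cs (ds f * g * ds (ds f * g)).
    by rewrite colon_perfect; apply: (derM leM b4 b5 d1).
  by have [] := derPs leM b2 d2.
have d2 : der M cs (f * g * ds (f * g)).
  by rewrite colon_perfect'; apply: (derM leM b3 b2 d).
by have [] := derPs leM b1 d2.
Qed.

(** * The explicit bound and the witness against membership *)

(** Dominates the number [m * z.+1 + m] of coordinates for [m <= z]. *)
Definition ranklevel z := (z.+1 * z.+3)%N.
Definition polylevel z :=
  iter z (Phi G) (Phi G (iter z (Phi G) (G (ranklevel z)))).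
(** Dominates [toplevel]: the number of coordinates is at most [polylevel z], so the steps suffice
    for a dimension to repeat. *)
Definition satbase z := iter (polylevel z).+1 (step G) (polylevel z).
Definition ideallevel z :=
  (satlevel G (satbase z) + thrice G (elim_bound G (statelevel G (satbase z))))%N.
Definition termlevel z :=
  iter (Om G (ideallevel z)) evlevel (G (Om G (ideallevel z))).
Definition derlevel z := (G (G (iter 4 G (termlevel z))) + base)%N.

Lemma growth_satlevel : growth (satlevel G).
Proof.
apply: growth_iter (growth_Phi gG) _ growth_id.
exact: (growth_comp growth_S (growth_Phi gG)).
Qed.

Lemma growth_polylevel : growth polylevel.
Proof.
have gP := growth_Phi gG; have gr : growth ranklevel.
  exact: (growth_mulS growth_S (growth_comp growth_S growth_S)).
have g1 : growth (fun z => iter z (Phi G) (G (ranklevel z))).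
  exact: (growth_iter gP growth_id (growth_comp gG gr)).
exact: (growth_iter gP growth_id (growth_comp gP g1)).
Qed.

Lemma growth_satbase : growth satbase.
Proof.
apply: (growth_iter (growth_step gG)); last exact: growth_polylevel.
exact: (growth_comp growth_S growth_polylevel).
Qed.

Lemma growth_ideallevel : growth ideallevel.
Proof.
apply: growth_add; first exact: (growth_comp growth_satlevel growth_satbase).
exact: (growth_comp (growth_thrice gG) (growth_comp (growth_elim_bound gG)
  (growth_comp (growth_statelevel gG) growth_satbase))).
Qed.

Lemma growth_termlevel : growth termlevel.
Proof.
have g1 := growth_comp (growth_Om gG) growth_ideallevel.
exact: (growth_iter growth_evlevel g1 (growth_comp gG g1)).
Qed.

Lemma growth_derlevel : growth derlevel.
Proof.
apply: growth_addn; do 2!apply: (growth_comp gG).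
exact: (growth_comp (growth_iterk 4 gG) growth_termlevel).
Qed.

Lemma bprod_seq n N (I : Type) (s : seq I) (F : I -> MP k n) : (n + 0 <= N)%N ->
  (forall i, bMP kb n N (F i)) -> bMP kb n (iter (size s) (Phi G) N) (\prod_(i <- s) F i).
Proof. by move=> le_n bF; apply: (bprod gG (bok_MP gG n kb_ok)). Qed.

Lemma bsum_seq n N (I : eqType) (s : seq I) (F : I -> MP k n) :
  (forall i, i \in s -> bMP kb n N (F i)) ->
  bMP kb n (iter (size s) (Phi G) N) (\sum_(i <- s) F i).
Proof.
have Mok := bok_MP gG n kb_ok; elim: s => [|i s IH] bF.
  by rewrite big_nil; apply: (bok0 Mok).
rewrite big_cons; apply: (bD gG Mok); last by apply: IH => j sj; apply: bF; rewrite inE sj orbT.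
apply: (bok_mono Mok _ (bF i (mem_head _ _))).
exact: (iter_infl _ _ (growth_Phi gG)).
Qed.

Lemma ranklevel_leq z n : (m <= z)%N -> n = (m * z.+1 + m)%N -> (n + 0 <= ranklevel z)%N.
Proof. by move=> le_m ->; rewrite /ranklevel; nia. Qed.

Lemma ofTerms_bounded z n (t : dterms) : (m <= z)%N -> n = (m * z.+1 + m)%N ->
  (dc t <= z)%N -> bMP kb n (polylevel z) (ofTerms n t).
Proof.
move=> le_m nE le_t; have [zt tP] := dterms_bounds le_t; have Mok := bok_MP gG n kb_ok.
have gP := growth_Phi gG.
have le_n := ranklevel_leq le_m nE.
set N0 := G (ranklevel z); have le_nN : (n + 0 <= N0)%N.
  exact: leq_trans le_n (growth_infl gG _).
have N0_gt0 : (0 < N0)%N by apply: leq_trans (growth_infl gG _).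
set X := iter z (Phi G) N0; have le_NX : (N0 <= X)%N := iter_infl z N0 gP.
apply: (bok_mono Mok (N := iter (size t) (Phi G) (Phi G X))); first exact: iter_mono.
apply: bsum_seq => u tu; have [cu zu uP] := tP u tu.
apply: (bM gG Mok (leq_trans le_nN le_NX)).
  apply: (bcst gG n kb_ok); apply: leq_trans cu _; apply: leq_trans (leq_addr _ _).
  apply: leq_trans le_NX; apply: leq_trans (growth_infl gG _); rewrite /ranklevel.
  by apply: leq_trans (leqnSn z) _; apply: leq_pmulr.
apply: (bok_mono Mok (N := iter (size u.2) (Phi G) N0)); first exact: iter_mono.
by apply: bprod_seq => // v; apply: (bvar gG n _ kb_ok).
Qed.

Lemma small_bounded z q (t : dterms) : q = (m * z.+1)%N -> (dc t <= z)%N -> small q t.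
Proof.
move=> -> /dterms_bounds[_ tP] u v tu uv; have [_ _ /(_ v uv)[_ _ v2]] := tP u tu.
rewrite /vindex; have := ltn_ord v.1; move: (val v.1) (v.2) v2 => i j; clear; nia.
Qed.

(** In presentations with codes at most [z] the variables have order at most [z], so [z.+1] blocks
    of [m] coordinates hold them; one further block receives the shifts. *)
Theorem witness_point z (t : dterms) (ts : seq dterms) : (m <= z)%N -> (dc t <= z)%N ->
  (forall u, u \in ts -> (dc u <= z)%N) ->
  ~ der (derlevel z) (CodeSeq.code (map dc ts)) (dpoly_of t) ->
  exists (L : fieldType) (iota : {rmorphism k -> L}) (a : nat -> L),
    [/\ compatible vs m iota a (m * z.+1),
        forall u, u \in ts -> ev iota a (m * z.+1 + m) (ofTerms (m * z.+1 + m) u) = 0 &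
        ev iota a (m * z.+1 + m) (ofTerms (m * z.+1 + m) t) != 0].
Proof.
move=> le_m le_t le_ts nd; set q := (m * z.+1)%N; set n := (q + m)%N.
set cs := CodeSeq.code _ in nd; set M := derlevel z in nd.
pose J p := der M cs (toDpoly n p); set K := ideallevel z; set O := Om G K.
have leM : (G (G (iter 4 G (termlevel z))) + base <= M)%N by [].
have [le0 le1 le2 le3] := level_bounds (termlevel z).
have le_n := ranklevel_leq le_m (erefl : n = (m * z.+1 + m)%N).
set N1 := polylevel z; set T := satbase z.
have le_rN : (ranklevel z <= N1)%N.
  apply: leq_trans (iter_infl _ _ (growth_Phi gG)); apply: leq_trans (growth_infl (growth_Phi gG) _).
  apply: leq_trans (iter_infl _ _ (growth_Phi gG)); exact: growth_infl gG _.
have N1_gt0 : (0 < N1)%N by apply: leq_trans le_rN.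
have le_nN : (n <= N1)%N by apply: leq_trans le_rN; rewrite -[n]addn0.
have le_top : (toplevel G q m N1 <= T)%N.
  exact: (iter_mono (growth_step gG) (le_nN : (n.+1 <= N1.+1)%N) (leqnn _)).
have le_NT : (N1 <= T)%N := iter_infl _ _ (growth_step gG).
have le_TK : (T <= K)%N by apply: leq_trans (growth_infl growth_satlevel T) (leq_addr _ _).
have le_KO : (K <= O)%N := growth_infl (growth_Om gG) K.
have le_nO : (n <= O)%N by apply: leq_trans le_nN (leq_trans le_NT (leq_trans le_TK le_KO)).
have bd p : bMP kb n O p -> dbnd (termlevel z) (toDpoly n p) by apply: dbnd_toDpoly.
have iJ : nideal (bMP kb n) O J.
  split=> [|x y bx by_ Jx Jy|x y bx by_ Jy|x bx Jx].
  - by rewrite /J rmorph0; apply: der0.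
  - rewrite /J rmorphD.
    exact: (derD leM (dbnd_mono le0 (bd _ bx)) (dbnd_mono le0 (bd _ by_)) Jx Jy).
  - rewrite /J rmorphM.
    exact: (derM leM (dbnd_mono le0 (bd _ bx)) (dbnd_mono le0 (bd _ by_)) Jy).
  by apply: (der_sqrt leM (bd _ bx)); move: Jx; rewrite /J rmorphM.
have sm u : (dc u <= z)%N -> small n u.
  move=> le_u i v ui iv; apply: leq_trans (small_bounded erefl le_u ui iv) _; exact: leq_addr.
have bt u : (dc u <= z)%N -> bMP kb n N1 (ofTerms n u) by apply: ofTerms_bounded.
have Mok := bok_MP gG n kb_ok.
have nJ : ~ J (ofTerms n t) by rewrite /J toDpoly_ofTerms //; apply: sm.
have [s [bs iJ' nJ' prodJ']] := saturation gG kb_ok (leq_trans le_nN le_NT)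
  (leq_addr _ _ : (satlevel G T <= K)%N) (bok_mono Mok le_NT (bt _ le_t)) iJ nJ.
have bsO := bd _ (bok_mono Mok le_KO bs).
have [|||L [iota [a [ag ca]]]] := compatible_point gG kb_ok kb_factor kb_inv vsK vsiK kb_vs kb_vsi
  (m := m) (q := q) (J := fun x => J (x * s)) le_nN N1_gt0.
- apply: (nideal_mono Mok _ iJ'); apply: leq_trans (leq_addl _ _).
  apply: (growth_mono (growth_thrice gG)); apply: (growth_mono (growth_elim_bound gG)).
  exact: (growth_mono (growth_statelevel gG)).
- move=> l ul lP; apply: prodJ' => // p /lP[bp nJp]; split=> //.
  exact: (bok_mono Mok le_top bp).
(* By [der_colon], the colon ideal is compatible with [ds] although [s] is not invariant. *)
- move=> p bp; rewrite /J !rmorphM toDpoly_incl toDpoly_shft.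
  have bO : bMP kb q O p.
    by apply: (bok_mono (bok_MP gG q kb_ok) _ bp); apply: leq_trans le_top (leq_trans le_TK le_KO).
  have bpq : dbnd (termlevel z) (toDpoly q p).
    by apply: (dbnd_toDpoly _ bO); apply: leq_trans le_nO; apply: leq_addr.
  exact: (der_colon cs leM bpq bsO).
exists L, iota, a; split=> //; last by apply/eqP => /(ag _ (bt _ le_t)).
move=> u tsu; have le_u := le_ts u tsu; apply/(ag _ (bt _ le_u)).
have bu := bok_mono Mok (leq_trans le_NT (leq_trans le_TK le_KO)) (bt _ le_u).
rewrite /J mulrC rmorphM.
apply: (derM leM (dbnd_mono le0 bsO) (dbnd_mono le0 (bd _ bu))).
rewrite toDpoly_ofTerms; last exact: sm.
apply: der_mem => //; apply: leq_trans le_u (growth_infl growth_derlevel z).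
Qed.
Lemma compatible_far (L : fieldType) (iota : {rmorphism k -> L}) a q r :
  compatible vs m iota a (m * q) ->
  exists (L' : fieldType) (kap : {rmorphism L -> L'}) (a' : nat -> L'),
    (forall i, (i < m * q + m)%N -> a' i = kap (a i)) /\
    compatible vs m (kap \o iota : {rmorphism k -> L'}) a' (m * q + r).
Proof.
case: (posnP m) => [m0 _|m_gt0 ca]; last exact: (compatible_extend_many m_gt0 r ca).
(* Without variables, the point 0 will do: both sides of [compatible] are images of one constant
   [c]. *)
exists L, idfun, (fun=> 0); split=> [i|p]; first by rewrite m0.
pose c := ev (idfun : {rmorphism k -> k}) (fun=> 0) (m * q + r) p.
have E (g : {rmorphism k -> L}) x : (forall i, x i = 0) -> ev g x (m * q + r) p = g c.
  by move=> x0; symmetry; apply: ev_comp => // i _; rewrite rmorph0 x0.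
rewrite !E //=; split=> /eqP; rewrite !fmorph_eq0 => /eqP->; by rewrite !rmorph0.
Qed.

(** * Completeness of bounded derivations *)

Section Closure.
Variable ts : seq dterms.

Definition evaluates (L : fieldType) (iota : {rmorphism k -> L}) (a : nat -> L)
    (h : {rmorphism dpoly k m -> L}) :=
  (forall c, h (dC m c) = iota c) /\ forall v, h (dX k v) = a (vindex v).

Lemma eval_terms (L : fieldType) (iota : {rmorphism k -> L}) a h n t :
  evaluates iota a h -> small n t -> h (dpoly_of t) = ev iota a n (ofTerms n t).
Proof.
move=> [hC hX] sm; rewrite ev_ofTerms // rmorph_dpoly_of.
apply: eq_bigr => u _; congr (_ * _); first exact: hC.
by apply: eq_bigr => v _; exact: hX.
Qed.

Lemma eval_sigma (L : fieldType) (iota : {rmorphism k -> L}) a h n t :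
  evaluates iota a h -> small n t ->
  h (ds (dpoly_of t)) =
    ev (iota \o vs : {rmorphism k -> L}) (fun i => a (i + m)%N) n (ofTerms n t).
Proof.
move=> [hC hX] sm; rewrite ev_ofTerms // dsE -dpoly_sigma rmorph_dpoly_of big_map.
have indexE v : a (vindex (dvar_shift v)) = a (vindex v + m)%N.
  by rewrite /vindex /= mulSn -addnA addnC.
apply: eq_bigr => u _; congr (_ * _); first exact: hC.
by rewrite big_map; apply: eq_bigr => v _; rewrite -indexE; exact: hX.
Qed.

(* The points have to extend far enough for both [g] and [ds g] to be evaluated. *)
Definition vanishing (g : dpoly k m) := exists Q0, forall Q, (Q0 <= Q)%N ->
  forall (L : fieldType) (iota : {rmorphism k -> L}) a h, evaluates iota a h ->
    compatible vs m iota a Q -> (forall u, u \in ts -> h (dpoly_of u) = 0) -> h g = 0.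

(** If [g * ds g] vanishes at a point with values in a field, then one factor does, and
    compatibility makes the other vanish too. *)
Lemma vanishing_perfect : is_perfect_ideal ds vanishing.
Proof.
split; first split.
- by exists 0%N => Q _ L iota a h _ _ _; apply: rmorph0.
- move=> f g [Q1 H1] [Q2 H2]; exists (maxn Q1 Q2) => Q; rewrite geq_max => /andP[le1 le2].
  move=> L iota a h hP ca hts; rewrite rmorphD.
  by rewrite (H1 Q le1 L iota a h) ?(H2 Q le2 L iota a h) ?addr0.
- move=> f g [Q1 H1]; exists Q1 => Q le1 L iota a h hP ca hts; rewrite rmorphM.
  by rewrite (H1 Q le1 L iota a h) ?mulr0.
move=> g [Q1 H1]; have [t gE] := dpoly_of_surj g; have [Q2 sm] := small_exists t.
suff H Q : (maxn Q1 Q2 <= Q)%N -> forall (L : fieldType) (iota : {rmorphism k -> L}) a h,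
    evaluates iota a h -> compatible vs m iota a Q ->
    (forall u, u \in ts -> h (dpoly_of u) = 0) -> h g = 0 /\ h (ds g) = 0.
  by split; exists (maxn Q1 Q2) => Q le_Q L iota a h hP ca hts; case: (H Q le_Q L iota a h hP ca hts).
rewrite geq_max => /andP[le1 le2] L iota a h hP ca hts.
have := H1 Q le1 L iota a h hP ca hts; rewrite rmorphM gE.
rewrite (eval_terms hP (sm Q le2)) (eval_sigma hP (sm Q le2)) => /eqP.
have caE := ca (ofTerms Q t).
by rewrite mulf_eq0 => /orP[/eqP E|/eqP E]; split=> //; apply/caE.
Qed.

(** The witness has a length fixed by [z], while membership in [vanishing] concerns long points
    only; so the witness is first extended by [compatible_far]. *)
Theorem derivation_complete z (t : dterms) : (m <= z)%N -> (dc t <= z)%N ->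
  (forall u, u \in ts -> (dc u <= z)%N) ->
  perfect_closure ds (fun g => g \in [seq dpoly_of u | u <- ts]) (dpoly_of t) ->
  der (derlevel z) (CodeSeq.code (map dc ts)) (dpoly_of t).
Proof.
move=> le_m le_t le_ts closed; apply: NNPP => nd.
have [L [iota [a [ca aF at0]]]] := witness_point le_m le_t le_ts nd.
have [|Q0 HQ] := closed vanishing vanishing_perfect.
  by move=> g /mapP[u tsu ->]; exists 0%N => Q _ L' iota' a' h _ _; apply.
have [L' [kap [a' [aE ca']]]] := compatible_far Q0 ca.
have [h hP] := deval_exists (kap \o iota : {rmorphism k -> L'}) a'.
have hE u : (dc u <= z)%N ->
    h (dpoly_of u) = kap (ev iota a (m * z.+1 + m) (ofTerms (m * z.+1 + m) u)).
  move=> le_u; have sm : small (m * z.+1 + m) u.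
    by move=> i v ui iv; apply: leq_trans (small_bounded erefl le_u ui iv) _; apply: leq_addr.
  rewrite (eval_terms hP sm); symmetry; apply: ev_comp => // i lt_i.
  by rewrite aE.
case/eqP: at0; apply: (fmorph_inj kap); rewrite rmorph0 -hE //.
apply: (HQ _ (leq_addl _ _) L' _ a' h hP ca') => u tsu.
by rewrite hE ?le_ts // aF // rmorph0.
Qed.
End Closure.
End Difference.
End Bounds.

(** * The decision procedure *)

Section InverseMorphism.
Variables (R : pzRingType) (f : {rmorphism R -> R}) (g : R -> R).
Hypotheses (fK : cancel f g) (gK : cancel g f).

(** The cancellation proofs are arguments, so that the morphism structures can be attached to this
    constant. *)
Definition inverse_morphism of cancel f g & cancel g f := g.
Local Notation inv := (inverse_morphism fK gK).

Lemma inverse_zmod : zmod_morphism inv.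
Proof. exact: can2_zmod_morphism fK gK. Qed.

Lemma inverse_monoid : monoid_morphism inv.
Proof. exact: can2_monoid_morphism fK gK. Qed.

HB.instance Definition _ := GRing.isZmodMorphism.Build R R inv inverse_zmod.
HB.instance Definition _ := GRing.isMonoidMorphism.Build R R inv inverse_monoid.

Lemma inverse_rmorphism : exists h : {rmorphism R -> R}, h =1 g.
Proof. by exists inv. Qed.
End InverseMorphism.

Lemma perfect_closure_ext (R : comNzRingType) (s1 s2 : {rmorphism R -> R}) E (f : R) :
  s1 =1 s2 -> perfect_closure s1 E f -> perfect_closure s2 E f.
Proof.
move=> E12 H I [I_ideal IP]; apply: H; split=> // g.
by rewrite E12; apply: IP.
Qed.

Lemma primrec3_prs F : prs (fun e => F (nth 0%N e 0) (nth 0%N e 1) (nth 0%N e 2)) -> primrec3 F.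
Proof. by move=> pF; apply: primrec_ext (pF 3%N) => v; rewrite !(tnth_nth 0%N). Qed.

Theorem corollary6p13 (k : fieldType) (code : k -> nat)
    (vs : {rmorphism k -> k}) :
  effective_difference_field code vs ->
  exists D : nat -> nat -> nat -> bool,
    primrec3 (fun m c cs => nat_of_bool (D m c cs)) /\
    forall (m : nat) (t : dterms k m) (ts : seq (dterms k m)),
      D m (dterms_code code t)
          (CodeSeq.code [seq dterms_code code u | u <- ts]) <->
      perfect_closure (@dsigma k m vs)
        (fun g => g \in [seq dpoly_of u | u <- ts]) (dpoly_of t).
Proof.
case=> -[code_inj [KS pKS KSP] [Fa pFa FaE] [Fm pFm FmE] [Fi pFi FiE]] _ [Fd pFd FdE].
case=> [Fs pFs FsE] [vsi0 [vsK0 vsiK0 [Fsi pFsi FsiE0]]].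
have [vsi vsiE] := inverse_rmorphism vsK0 vsiK0.
have vsK : cancel vs vsi by move=> x; rewrite vsiE vsK0.
have vsiK : cancel vsi vs by move=> x; rewrite vsiE vsiK0.
have FsiE a : Fsi (code a) = code (vsi a) by rewrite vsiE.
have {}pKS : prb (fun e => KS (nth 0%N e 0)) := primrec1_prs pKS (prs_nth 0).
have {}pFa := primrec2_prs pFa (prs_nth 0) (prs_nth 1).
have {}pFm := primrec2_prs pFm (prs_nth 0) (prs_nth 1).
have {}pFi := primrec1_prs pFi (prs_nth 0).
have {}pFd := primrec1_prs pFd (prs_nth 0).
have {}pFs := primrec1_prs pFs (prs_nth 0).
have {}pFsi := primrec1_prs pFsi (prs_nth 0).
pose lev := derlevel code Fa Fm Fi Fs Fsi Fd.
have glev : growth lev by apply: growth_derlevel.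
(* The sum of the three inputs dominates [m] and the codes of all the presentations, as
   [derivation_complete] requires of [z]. *)
exists (fun m c cs => derives KS Fa Fm Fs (code 0) m (lev (m + c + cs)%N) c cs); split.
  apply: (primrec3_prs (F := fun m c cs =>
    nat_of_bool (derives KS Fa Fm Fs (code 0) m (lev (m + c + cs)%N) c cs))).
  have plev : prs (fun e => lev (nth 0 e 0 + nth 0 e 1 + nth 0 e 2)%N).
    apply: (prs_comp1 (growth_prs glev)).
    by apply: prs_add; [apply: prs_add|]; exact: prs_nth.
  exact: (prb_derives _ pKS pFa pFm pFs (prs_nth 0) plev (prs_nth 1) (prs_nth 2)).
move=> m t ts; set z := (m + _ + _)%N; rewrite derivesP.
have [ds dsE] : exists ds : {rmorphism dpoly k m -> dpoly k m}, forall f, ds f = dsigma vs f.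
  by exists (dsigma vs).
have le_mem x : x \in map (dterms_code code) ts -> (x <= z)%N.
  by move=> sx; apply: leq_trans (mem_code_leq sx) (leq_addl _ _).
have le_t : (dterms_code code t <= z)%N by rewrite /z -addnA addnCA leq_addr.
have le_m : (m <= z)%N by rewrite /z -addnA leq_addr.
have le_ts u : u \in ts -> (dterms_code code u <= z)%N by move=> tsu; apply/le_mem/map_f.
split=> [/(derc_sound code_inj KSP FaE FmE FsE dsE)[t' tE closed]|closed].
  have -> : dpoly_of t = dpoly_of t'.
    (* [eqPoly] depends on codes only, so presentations with equal codes have equal polynomials. *)
    by apply/(eqPolyP code_inj FaE); rewrite -tE; apply/(eqPolyP code_inj FaE).
  exact: (perfect_closure_ext dsE closed).
have {}closed := perfect_closure_ext (fun f => esym (dsE f)) closed.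
apply: (der_eq code_inj KSP FaE _ erefl); last exact: leq_trans le_t (growth_infl glev z).
exact: (derivation_complete code_inj KSP FaE FmE FiE FsE vsK vsiK FsiE FdE pFa pFm pFi pFs pFsi
  pFd dsE le_m le_t le_ts closed).
Qed.
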